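(* Let $M$ be a $d\times d$ dilation matrix, $2\le p\le\infty$, $1/p+1/q=1$. Let $\{\varphi_j\}_{j\in\mathbb N}$ be a sequence of periodic functions in $L_p$ and $\{\widetilde\varphi_j\}_{j\in\mathbb N}$ a sequence of periodic distributions which satisfy the growth condition of order $N\ge 0$ for $\{\widetilde\varphi_j\}_j$, the Strang-Fix conditions of order $s>0$ for $\{\varphi_j\}_j$, the weak compatibility conditions of order $s$ for $\{\varphi_j\}_j$ and $\{\widetilde\varphi_j\}_j$, and the uniform boundedness condition for $\{\varphi_j\}_j$ (all as defined in the context), with $\{b_n\}_{n\in\mathbb{Z}^d}\in\ell_q$. Let $f\in A_q^\gamma$, where $\gamma>0$ and, moreover, $\gamma>N+d/p$ if $q\ne1$, or $\gamma\ge N$ if $q=1$. Then, for every $j\in\mathbb{N}$, $$\left\|f-Q_j(f,\varphi_j,\widetilde\varphi_j)\right\|_p\le C_1\|M^{*-j}\|^{s}\,\|f\|^{In}_{A_q^{s},j}+C_2\|M^{*-j}\|^{\gamma}\,\|f\|^{Out}_{A_q^\gamma,j},$$ where $C_1$ and $C_2$ do not depend on $j$ and $f$. If $\vartheta$ is any positive number which is smaller than the absolute value of every eigenvalue of $M$, then $$\left\|f-Q_j(f,\varphi_j,\widetilde\varphi_j)\right\|_p\le C\,\vartheta^{-j\min\{s,\gamma\}}\,\|f\|_{A_q^\gamma},$$ where $C$ does not depend on $j$ and $f$. In addition, if $M$ is an isotropic matrix and $\lambda$ is its eigenvalue, then $\vartheta$ can be replaced by $|\lambda|$ in the last inequality.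
   Context: Notation. $\mathbb{T}^d=\mathbb{R}^d/\mathbb{Z}^d$, $L_p=L_p(\mathbb{T}^d)$ with norm $\|\cdot\|_p$, $(x,y)$ and $|x|$ are the Euclidean inner product and norm on $\mathbb{R}^d$, $\widehat f(k)$ is the $k$-th Fourier coefficient (with respect to $e^{2\pi i(k,x)}$), $\mathbf 0$ is the zero vector. A dilation matrix $M$ is an integer $d\times d$ matrix all of whose eigenvalues have absolute value greater than $1$; $m=|\det M|$; $M^*$ is the conjugate (adjoint) matrix, $M^{*j}=(M^* )^j$, $M^{*-j}=(M^* )^{-j}$; $\|\cdot\|$ applied to matrices is the operator norm on $\mathbb{R}^d$. $M$ is isotropic if it is similar to a diagonal matrix with diagonal entries $\lambda_1,\dots,\lambda_d$ satisfying $|\lambda_1|=\dots=|\lambda_d|$. For an integer matrix $A$, $D(A):=A[-1/2,1/2)^d\cap\mathbb{Z}^d$. Spaces. $\theta_\alpha(x)=(1+|x|^2)^{\alpha/2}$; $\ell_q=\ell_q(\mathbb{Z}^d)$; $A_q^\alpha$ is the space of $f\in L_1$ with $\|f\|_{A_q^\alpha}=\|\{\theta_\alpha(k)\widehat f(k)\}_k\|_{\ell_q}<\infty$. For $1\le q<\infty$, $$\|f\|^{Out}_{A_q^\alpha,j}=\Big(\sum_{k\in\mathbb{Z}^d\setminus D(M^{*j})}|\widehat f(k)|^q\theta_\alpha^q(k)\Big)^{1/q},\qquad \|f\|^{In}_{A_q^\alpha,j}=\Big(\sum_{k\in D(M^{*j})}|\widehat f(k)|^q\theta_\alpha^q(k)\Big)^{1/q}.$$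 Operators. A periodic distribution is a continuous linear functional on $C^\infty(\mathbb{T}^d)$; it is determined by its Fourier coefficients, which grow at most polynomially. For a periodic distribution $\widetilde\varphi_j$ and a function $f$ for which the series converges, set $$\langle f,\widetilde\varphi_j(\cdot-M^{-j}k)\rangle:=\sum_{l\in\mathbb{Z}^d}\widehat f(l)\,\overline{\widehat{\widetilde\varphi_j}(l)}\,e^{2\pi i(k,M^{*-j}l)},$$ and $$Q_j(f,\varphi_j,\widetilde\varphi_j)=\frac1{m^j}\sum_{k\in D(M^j)}\langle f,\widetilde\varphi_j(\cdot-M^{-j}k)\rangle\,\varphi_j(\cdot-M^{-j}k).$$ Conditions (constants $C_{\widetilde\varphi},C_\varphi$ and nonnegative numbers $b_n$, $n\in\mathbb{Z}^d$, do not depend on $j$). (1) Growth of order $N$ for $\{\widetilde\varphi_j\}_j$: for all $j\in\mathbb{N}$, $|\widehat{\widetilde\varphi_j}(k)|\le C_{\widetilde\varphi}|M^{*-j}k|^N$ for all $k\in\mathbb{Z}^d\setminus D(M^{*j})$, and $\max_{k\in D(M^{*j})}|\widehat{\widetilde\varphi_j}(k)|\le C_{\widetilde\varphi}$. (2) Strang-Fix conditions of order $s$ for $\{\varphi_j\}_j$: $|\widehat{\varphi_j}(M^{*j}n+r)|\le b_n|M^{*-j}r|^s$ for all $n\in\mathbb{Z}^d\setminus\{\mathbf 0\}$, $r\in D(M^{*j})$, $j\in\mathbb{N}$. (3) Weak compatibility of order $s$: $|1-\widehat{\varphi_j}(r)\overline{\widehat{\widetilde\varphi_j}(r)}|\le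 b_{\mathbf 0}|M^{*-j}r|^s$ for all $r\in D(M^{*j})$, $j\in\mathbb{N}$. (4) Uniform boundedness: $\max_{k\in D(M^{*j})}|\widehat{\varphi_j}(k)|\le C_\varphi$ for all $j\in\mathbb{N}$. *)

(* Defs.v *)
From HB Require Import structures.
From mathcomp Require Import all_boot all_order all_algebra.
From mathcomp Require Import all_classical all_reals all_analysis.
From mathcomp Require Import complex.

Set Implicit Arguments.
Unset Strict Implicit.
Unset Printing Implicit Defensive.

Import Order.TTheory GRing.Theory Num.Theory.
Import numFieldNormedType.Exports.

Local Open Scope classical_set_scope.
Local Open Scope ring_scope.
Local Open Scope complex_scope.

(* MathComp-Analysis. R^d is 'cV[R]_d, Z^d is 'cV[int]_d, C is R[i]; functions
   on the torus R^d/Z^d are Z^d-periodic functions 'cV[R]_d -> R[i]. *)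

(* The norm of the numDomainType R[i] is R[i]-valued; this one is R-valued. *)
Notation cabs := Normc.normc.

Section Euclidean.
Context {R : realType} {d : nat}.
Implicit Types (x y : 'cV[R]_d).

Definition dotv x y : R := \sum_(i < d) x i 0 * y i 0.

Definition enorm x : R := Num.sqrt (dotv x x).

Definition opnorm (A : 'M[R]_d) : R :=
  sup [set enorm (A *m x) | x in [set x | enorm x <= 1]].

End Euclidean.

(* t |-> e^(2 pi i t) *)
Definition expi2pi {R : realType} (t : R) : R[i] :=
  cos (2 * pi * t) +i* sin (2 * pi * t).

Definition mxR {R : realType} {m n : nat} (A : 'M[int]_(m, n)) : 'M[R]_(m, n) :=
  map_mx intr A.

Definition mxC (R : realType) {d : nat} (M : 'M[int]_d) : 'M[R[i]]_d :=
  map_mx intr M.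

Section Dilation.
Context (R : realType) {d : nat}.
Implicit Types (A M : 'M[int]_d).

Definition dilation_matrix M : Prop :=
  forall z : R[i], eigenvalue (mxC R M) z -> 1 < cabs z.

Definition isotropic M : Prop :=
  exists2 l : 'rV[R[i]]_d,
    (forall i j, cabs (l 0 i) = cabs (l 0 j)) &
    simmx_in unitmx (mxC R M) (diag_mx l).

(* D(A) = A [-1/2, 1/2)^d /\ Z^d *)
Definition digits A : set 'cV[int]_d :=
  [set k | exists2 x : 'cV[R]_d,
     (forall i, - 2^-1 <= x i 0 < 2^-1) & mxR A *m x = mxR k].

(* M^{-j} and M^{*-j} as real matrices; the adjoint of a real matrix is its
   transpose. *)
Definition Minv M (j : nat) : 'M[R]_d := invmx (mxR (M ^+ j)).
Definition Mstarinv M (j : nat) : 'M[R]_d := invmx (mxR (M^T ^+ j)).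

Definition Dstar M (j : nat) : set 'cV[int]_d := digits (M^T ^+ j).

End Dilation.

Section TorusMeasure.
Context {R : realType}.
Local Notation borelR := (measurableTypeR R).

Definition pair_cons (n : nat) (z : borelR * n.-tuple borelR) :
    n.+1.-tuple borelR :=
  [the n.+1.-tuple borelR of z.1 :: z.2].

Lemma measurable_pair_cons (n : nat) : measurable_fun setT (@pair_cons n).
Proof. exact: measurable_cons. Qed.

HB.instance Definition _ (n : nat) :=
  isMeasurableFun.Build _ _ _ _ (@pair_cons n) (@measurable_pair_cons n).

(* The d-fold product of the uniform probability on [0, 1]: Lebesgue measure on
   [0, 1]^d, i.e. the normalised Haar measure of the torus. It lives on tuples,
   which unlike 'cV[R]_d carry the product sigma-algebra. *)
Fixpoint torus_measure (d : nat) : probability (d.-tuple borelR) R :=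
  match d with
  | 0 => \d_([tuple] : 0.-tuple borelR)
  | n.+1 => distribution (uniform_prob (@ltr01 R) \x torus_measure n)%E
              (@pair_cons n)
  end.

Definition vec_of_tuple {d : nat} (t : d.-tuple borelR) : 'cV[R]_d :=
  \col_(i < d) tnth t i.

End TorusMeasure.

Section TorusFunctions.
Context {R : realType} {d : nat}.
Implicit Types (f : 'cV[R]_d -> R[i]) (p : \bar R).

Definition Zd_periodic f : Prop :=
  forall x (k : 'cV[int]_d), f (x + mxR k) = f x.

Definition torus_measurable f : Prop :=
  measurable_fun setT
    (fun t : d.-tuple (measurableTypeR R) => complex.Re (f (vec_of_tuple t))) /\
  measurable_fun setT
    (fun t : d.-tuple (measurableTypeR R) => complex.Im (f (vec_of_tuple t))).

Definition Lp_norm p f : \bar R :=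
  ('N[torus_measure d]_p[EFin \o (fun t => cabs (f (vec_of_tuple t)))])%E.

Definition Lp_torus p f : Prop :=
  [/\ Zd_periodic f, torus_measurable f & (Lp_norm p f < +oo)%E].

Definition torus_integral f : R[i] :=
  (\int[torus_measure d]_t complex.Re (f (vec_of_tuple t))) +i*
  (\int[torus_measure d]_t complex.Im (f (vec_of_tuple t))).

(* x |-> e^(2 pi i (k, x)) *)
Definition torus_char (k : 'cV[int]_d) (x : 'cV[R]_d) : R[i] :=
  expi2pi (dotv (mxR k) x).

Definition fourier f (k : 'cV[int]_d) : R[i] :=
  torus_integral (fun x => f x * torus_char (- k) x).

End TorusFunctions.

Section PeriodicDistributions.
Context {R : realType} {d : nat}.

Definition mpartial (a : seq 'I_d) (h : 'cV[R]_d -> R) : 'cV[R]_d -> R :=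
  foldr (fun i g => 'D_(delta_mx i 0) g) h a.

Definition smooth (h : 'cV[R]_d -> R) : Prop :=
  forall a : seq 'I_d, continuous (mpartial a h) /\
    forall i x, derivable (mpartial a h) x (delta_mx i 0).

(* C^oo(T^d), complex-valued *)
Definition Cinfty_torus (f : 'cV[R]_d -> R[i]) : Prop :=
  [/\ Zd_periodic f, smooth (fun x => complex.Re (f x)) &
      smooth (fun x => complex.Im (f x))].

Definition cpartial (a : seq 'I_d) (f : 'cV[R]_d -> R[i]) (x : 'cV[R]_d) : R[i] :=
  mpartial a (fun y => complex.Re (f y)) x +i*
  mpartial a (fun y => complex.Im (f y)) x.

(* Continuity for the Frechet topology of C^oo(T^d): pd_app is bounded by a
   multiple of the maximum of the sup norms of the partial derivatives of order
   at most K. Values of pd_app outside C^oo(T^d) are irrelevant. *)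
Record periodic_distribution := PeriodicDistribution {
  pd_app :> ('cV[R]_d -> R[i]) -> R[i];
  pd_linear : forall (c : R[i]) (f g : 'cV[R]_d -> R[i]),
    Cinfty_torus f -> Cinfty_torus g ->
    pd_app (fun x => c * f x + g x) = c * pd_app f + pd_app g;
  pd_continuous : exists (C : R) (K : nat), forall f (B : R),
    Cinfty_torus f ->
    (forall a x, (size a <= K)%N -> cabs (cpartial a f x) <= B) ->
    cabs (pd_app f) <= C * B
}.

Definition dfourier (T : periodic_distribution) (k : 'cV[int]_d) : R[i] :=
  T (torus_char (- k)).

End PeriodicDistributions.
Arguments periodic_distribution : clear implicits.

Section WeightedFourierSpaces.
Context {R : realType} {d : nat}.
Implicit Types (f : 'cV[R]_d -> R[i]) (D : set 'cV[int]_d) (q alpha : R).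

Definition theta alpha (x : 'cV[R]_d) : R := (1 + enorm x ^+ 2) `^ (alpha / 2).

Definition lq_norm q D (u : 'cV[int]_d -> R) : \bar R :=
  ((\esum_(k in D) (`|u k| `^ q)%:E) `^ q^-1)%E.

(* For D = setT this is the norm of A_q^alpha. *)
Definition A_norm_on D q alpha f : \bar R :=
  lq_norm q D (fun k => theta alpha (mxR k) * cabs (fourier f k)).

Definition A_norm q alpha f : \bar R := A_norm_on setT q alpha f.

Definition A_space q alpha f : Prop :=
  Lp_torus 1%E f /\ (A_norm q alpha f < +oo)%E.

Definition A_norm_in (M : 'M[int]_d) j q alpha f : \bar R :=
  A_norm_on (Dstar R M j) q alpha f.

Definition A_norm_out (M : 'M[int]_d) j q alpha f : \bar R :=
  A_norm_on (~` Dstar R M j) q alpha f.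

End WeightedFourierSpaces.

Section QuasiProjection.
Context {R : realType} {d : nat}.
Implicit Types (M : 'M[int]_d) (f : 'cV[R]_d -> R[i]) (k l : 'cV[int]_d).

Definition csummable (u : 'cV[int]_d -> R[i]) : Prop :=
  summable setT (fun l => (cabs (u l))%:E).

Definition rsum (u : 'cV[int]_d -> R) : R :=
  fine (\esum_(l in setT) (Num.max (u l) 0)%:E) -
  fine (\esum_(l in setT) (Num.max (- u l) 0)%:E).

(* The sum over Z^d of a csummable family (a junk value otherwise). *)
Definition csum (u : 'cV[int]_d -> R[i]) : R[i] :=
  rsum (fun l => complex.Re (u l)) +i* rsum (fun l => complex.Im (u l)).

Definition pairing_term M j f (T : periodic_distribution R d) k l : R[i] :=
  fourier f l * (dfourier T l)^* *
  expi2pi (dotv (mxR k) (Mstarinv R M j *m mxR l)).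

(* < f, T(. - M^{-j} k) > *)
Definition pairing M j f T k : R[i] := csum (pairing_term M j f T k).

Definition quasi_projection M j f (phi : 'cV[R]_d -> R[i])
    (T : periodic_distribution R d) (x : 'cV[R]_d) : R[i] :=
  (((absz (\det M))%:R) ^+ j)^-1 *
  \sum_(k \in digits R (M ^+ j))
     (pairing M j f T k * phi (x - Minv R M j *m mxR k)).

End QuasiProjection.

(* Sequences are indexed by the positive integers j; the value at 0 is never
   used. *)
Section Conditions.
Context {R : realType} {d : nat} (M : 'M[int]_d).
Implicit Types (phi : nat -> 'cV[R]_d -> R[i])
  (phit : nat -> periodic_distribution R d) (b : 'cV[int]_d -> R) (N s : R).

Definition growth_condition N phit : Prop :=
  exists C : R, forall j, (0 < j)%N ->
    (forall k, ~ Dstar R M j k ->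
       cabs (dfourier (phit j) k) <= C * enorm (Mstarinv R M j *m mxR k) `^ N) /\
    (forall k, Dstar R M j k -> cabs (dfourier (phit j) k) <= C).

Definition strang_fix s b phi : Prop :=
  forall j, (0 < j)%N -> forall n r, n != 0 -> Dstar R M j r ->
    cabs (fourier (phi j) (M^T ^+ j *m n + r)) <=
      b n * enorm (Mstarinv R M j *m mxR r) `^ s.

Definition weak_compatibility s b phi phit : Prop :=
  forall j, (0 < j)%N -> forall r, Dstar R M j r ->
    cabs (1 - fourier (phi j) r * (dfourier (phit j) r)^*) <=
      b 0 * enorm (Mstarinv R M j *m mxR r) `^ s.

Definition uniformly_bounded phi : Prop :=
  exists C : R, forall j, (0 < j)%N -> forall k, Dstar R M j k ->
    cabs (fourier (phi j) k) <= C.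

End Conditions.

(* Main.v *)
(** The error g = f - Q_j f is estimated through its Fourier coefficients: the
    Hausdorff-Young inequality bounds its L_p norm by the l_q norm of
    {fourier g l}.  Averaging the characters over D(M^j) gives
    fourier (Q_j f) l = fourier phi_j l * z, where z is the sum of
    fourier f l' * conj (fourier phit_j l') over the coset l' = l mod M^{*j} Z^d.
    Write l = M^{*j} n + r with r in D(M^{*j}), so that M^{*-j} l = n + y with y
    in the unit cube.  The term l' = r of z is controlled by the compatibility
    condition for n = 0 and by the Strang-Fix condition for n <> 0; the rest of z
    is at most a constant times the l_q norm of |M^{*-j} l'|^gamma fourier f l'
    on the coset, by Hoelder and the convergence of the sum of
    |n + y|^(-(gamma - N) p) over n <> 0.  Summing q-th powers over r and n gives
    the estimate with |M^{*-j} l|^s and |M^{*-j} l|^gamma as weights, from which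
    the three inequalities follow by bounding the norm of M^{*-j}.

    The Hausdorff-Young inequality itself is obtained by real interpolation
    between L_2 and the trivial sup bound: a trigonometric polynomial is cut at a
    coefficient size depending on the dyadic level of its modulus. *)

Require Import Defs.
From HB Require Import structures.
From mathcomp Require Import all_boot all_order all_algebra.
From mathcomp Require Import all_classical all_reals all_analysis.
From mathcomp Require Import measurable_realfun ess_sup_inf complex.
From mathcomp Require Import ring lra.

Set Implicit Arguments.
Unset Strict Implicit.
Unset Printing Implicit Defensive.

Import Order.TTheory GRing.Theory Num.Theory.
Import numFieldNormedType.Exports.

Local Open Scope classical_set_scope.
Local Open Scope ring_scope.

(** Partial Fourier sums of an integrable function with coefficients in l_q, [q <= 2], hence in l_2,
    converge in mean square; identifying the limit with the function needs uniqueness of Fourier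
    coefficients. No summability kernel is used for it: the bounded functions that preserve the
    property of having zero coefficients are shown to include the indicators of all measurable sets.

    If s > gamma, the inner norm of weight s is not bounded by the norm of [A_q^gamma] uniformly in
    j. The core estimate is therefore proved for every exponent 0 < s' <= s, at the cost of a power
    of d. Taking s' = s gives the first inequality, s' = min(s, gamma) the two others.

    Powers of the inverse matrix are measured by the sum of the moduli of their entries, which is
    insensitive to transposition and to passing to complex entries. The strict bound theta < |z|
    absorbs multiple eigenvalues; in the isotropic case there is equality, and diagonalisation
    replaces that argument.

    The interpolation does not give the sharp Hausdorff-Young constant, which is harmless since the
    constants of the theorem are unspecified. *)

Section ComplexModulus.
Context {R : rcfType}.
Local Open Scope complex_scope.
Implicit Types (x y z : R[i]) (a : R).

Lemma cabs_sqr z : cabs z ^+ 2 = complex.Re z ^+ 2 + complex.Im z ^+ 2.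
Proof. by case: z => a b /=; rewrite sqr_sqrtr // addr_ge0 // sqr_ge0. Qed.

Lemma cabs_ge0 z : 0 <= cabs z.
Proof. by case: z => a b; apply: sqrtr_ge0. Qed.

Lemma cabs0_eq z : (cabs z == 0) = (z == 0).
Proof.
by apply/eqP/eqP => [/Normc.eq0_normc//|->]; rewrite Normc.normc0.
Qed.

Lemma cabsD x y : cabs (x + y) <= cabs x + cabs y.
Proof. exact: le_normcD. Qed.

Lemma cabsB x y : cabs (x - y) <= cabs x + cabs y.
Proof. by rewrite -(normcN y) cabsD. Qed.

Lemma cabs_conj z : cabs z^* = cabs z.
Proof. by case: z => a b /=; rewrite sqrrN. Qed.

Lemma cabs_real a : cabs a%:C = `|a|.
Proof. by rewrite /= expr0n addr0 sqrtr_sqr. Qed.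

Lemma cabsX z n : cabs (z ^+ n) = cabs z ^+ n.
Proof.
by elim: n => [|n IH]; rewrite ?expr0 ?Normc.normc1 // !exprS Normc.normcM IH.
Qed.

Lemma cabs_sum (I : Type) (r : seq I) (P : pred I) (F : I -> R[i]) :
  cabs (\sum_(i <- r | P i) F i) <= \sum_(i <- r | P i) cabs (F i).
Proof.
elim/big_ind2 : _ => [|x1 x2 y1 y2 h1 h2|//]; first by rewrite Normc.normc0.
by rewrite (le_trans (cabsD _ _))// lerD.
Qed.

Lemma Re_le_cabs z : `|complex.Re z| <= cabs z.
Proof.
by case: z => a b /=; rewrite -(sqrtr_sqr a) ler_wsqrtr// lerDl sqr_ge0.
Qed.

Lemma Im_le_cabs z : `|complex.Im z| <= cabs z.
Proof.
by case: z => a b /=; rewrite -(sqrtr_sqr b) ler_wsqrtr// lerDr sqr_ge0.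
Qed.

Lemma cabs_le_ReIm z : cabs z <= `|complex.Re z| + `|complex.Im z|.
Proof.
rewrite -(@ler_pXn2r _ 2) ?nnegrE ?cabs_ge0 ?addr_ge0// cabs_sqr.
rewrite -(real_normK (num_real (complex.Re z))).
rewrite -(real_normK (num_real (complex.Im z))) sqrrD addrAC lerDl.
by rewrite mulrn_wge0// mulr_ge0.
Qed.

Lemma ReM x y : complex.Re (x * y) =
  complex.Re x * complex.Re y - complex.Im x * complex.Im y.
Proof. by case: x y => a b [c e]. Qed.

Lemma ImM x y : complex.Im (x * y) =
  complex.Re x * complex.Im y + complex.Im x * complex.Re y.
Proof. by case: x y => a b [c e]. Qed.

Lemma ReD x y : complex.Re (x + y) = complex.Re x + complex.Re y.
Proof. by case: x y => a b [c e]. Qed.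

Lemma ImD x y : complex.Im (x + y) = complex.Im x + complex.Im y.
Proof. by case: x y => a b [c e]. Qed.

Lemma Re_sum (I : Type) (r : seq I) (P : pred I) (F : I -> R[i]) :
  complex.Re (\sum_(i <- r | P i) F i) = \sum_(i <- r | P i) complex.Re (F i).
Proof. by elim/big_ind2 : _ => // x1 x2 y1 y2 <- <-; rewrite ReD. Qed.

Lemma Im_sum (I : Type) (r : seq I) (P : pred I) (F : I -> R[i]) :
  complex.Im (\sum_(i <- r | P i) F i) = \sum_(i <- r | P i) complex.Im (F i).
Proof. by elim/big_ind2 : _ => // x1 x2 y1 y2 <- <-; rewrite ImD. Qed.

Lemma mulc_conj z : z * z^* = (cabs z ^+ 2)%:C.
Proof.
by apply/eqP; rewrite cabs_sqr; case: z => a b; rewrite eq_complex /=; apply/andP; split; apply/eqP; ring.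
Qed.

End ComplexModulus.

Section UnitCharacter.
Context {R : realType}.
Local Open Scope complex_scope.
Implicit Types (s t : R).

Lemma expi2piD s t : expi2pi (s + t) = expi2pi s * expi2pi t.
Proof.
apply/eqP; rewrite eq_complex /= mulrDr cosD sinD.
by apply/andP; split; apply/eqP; ring.
Qed.

Lemma expi2pi0 : expi2pi (0 : R) = 1.
Proof. by rewrite /expi2pi mulr0 cos0 sin0. Qed.

Lemma expi2piN t : expi2pi (- t) = (expi2pi t)^*.
Proof. by rewrite /expi2pi mulrN cosN sinN. Qed.

Lemma cabs_expi2pi t : cabs (expi2pi t) = 1.
Proof. by rewrite /= cos2Dsin2 sqrtr1. Qed.

Lemma expi2pi1 : expi2pi (1 : R) = 1.
Proof. by rewrite /expi2pi mulr1 mulr_natl cos2pi sin2pi. Qed.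

Lemma expi2pi_int (n : int) : expi2pi (n%:~R : R) = 1.
Proof.
have H k : expi2pi (k%:R : R) = 1.
  elim: k => [|k IH]; first exact: expi2pi0.
  by rewrite -natr1 expi2piD IH expi2pi1 mulr1.
case: n => n; first exact: H.
by rewrite NegzE mulrNz expi2piN H conjc1.
Qed.

(** Subtracting the floor leaves u in [0, 1). If u were nonzero, sin(pi u) would be positive, and
    cos(2 pi u) = 2 cos(pi u)^2 - 1 = 1 would contradict the Pythagorean identity. *)
Lemma expi2pi_eq1 t : expi2pi t = 1 -> exists n : int, t = n%:~R.
Proof.
move=> h; exists (Num.floor t); set u := t - (Num.floor t)%:~R.
have : expi2pi u = 1.
  by rewrite expi2piD h -mulrNz expi2pi_int mulr1.
have u0 : 0 <= u by rewrite subr_ge0 floor_le.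
have u1 : u < 1 by rewrite ltrBlDl -intrD1 floorD1_gt.
have [u00|un0] := eqVneq u 0.
  by move=> _; apply/eqP; rewrite -subr_eq0 -/u u00.
have up : 0 < u by rewrite lt_neqAle eq_sym un0.
have := pi_gt0 R => pi0; have : 0 < sin (pi * u).
  by apply: sin_gt0_pi; rewrite mulr_gt0//= -[ltRHS]mulr1 ltr_pM2l.
move=> sp [] + _; rewrite -mulrA mulr_natl cos_mulr2n => H.
have := cos2Dsin2 (pi * u); nra.
Qed.

End UnitCharacter.

(** * Integration of complex-valued functions over a probability space *)

Section ComplexIntegral.
Context d (T : measurableType d) (R : realType) (mu : probability T R).
Local Open Scope complex_scope.
Implicit Types (f g : T -> R[i]) (c : R[i]).

Definition cmeasurable f : Prop :=
  measurable_fun setT (fun x => complex.Re (f x)) /\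
  measurable_fun setT (fun x => complex.Im (f x)).

Definition cintegrable f : Prop :=
  mu.-integrable setT (EFin \o (fun x => complex.Re (f x))) /\
  mu.-integrable setT (EFin \o (fun x => complex.Im (f x))).

Definition cint f : R[i] :=
  (\int[mu]_x complex.Re (f x)) +i* (\int[mu]_x complex.Im (f x)).

Lemma cmeasurable_cst c : cmeasurable (fun=> c).
Proof. by split; exact: measurable_cst. Qed.

Lemma cmeasurableD f g : cmeasurable f -> cmeasurable g ->
  cmeasurable (fun x => f x + g x).
Proof.
move=> [f1 f2] [g1 g2]; split.
  by under eq_fun do rewrite ReD; exact: measurable_funD.
by under eq_fun do rewrite ImD; exact: measurable_funD.
Qed.

Lemma cmeasurableM f g : cmeasurable f -> cmeasurable g ->
  cmeasurable (fun x => f x * g x).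
Proof.
move=> [f1 f2] [g1 g2]; split.
  under eq_fun do rewrite ReM.
  by apply: measurable_funB; exact: measurable_funM.
under eq_fun do rewrite ImM.
by apply: measurable_funD; exact: measurable_funM.
Qed.

Lemma cmeasurableB f g : cmeasurable f -> cmeasurable g ->
  cmeasurable (fun x => f x - g x).
Proof.
move=> mf mg; have -> : (fun x => f x - g x) = (fun x => f x + -1 * g x).
  by apply/funext => x; rewrite mulN1r.
by apply: cmeasurableD => //; apply: cmeasurableM => //; exact: cmeasurable_cst.
Qed.

Lemma cmeasurable_real (h : T -> R) : measurable_fun setT h ->
  cmeasurable (fun x => (h x)%:C).
Proof. by move=> mh; split => //; exact: measurable_cst. Qed.

Lemma measurable_cabs f : cmeasurable f ->
  measurable_fun setT (fun x => cabs (f x)).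
Proof.
move=> [f1 f2].
have -> : (fun x => cabs (f x)) =
    (fun x => Num.sqrt (complex.Re (f x) ^+ 2 + complex.Im (f x) ^+ 2)).
  by apply/funext => x; case: (f x).
apply: measurableT_comp; first exact: (continuous_measurable_fun (@sqrt_continuous R)).
by apply: measurable_funD; exact: measurable_funX.
Qed.

Lemma cintegrable_meas f : cintegrable f -> cmeasurable f.
Proof.
by move=> [f1 f2]; split; apply/measurable_EFinP; [exact: measurable_int f1|
  exact: measurable_int f2].
Qed.

Lemma cintegrable_le f (h : T -> R) : cmeasurable f ->
  mu.-integrable setT (EFin \o h) -> (forall x, cabs (f x) <= h x) ->
  cintegrable f.
Proof.
move=> [f1 f2] ih fh; split.
  apply: (le_integrable measurableT _ _ ih); first exact/measurable_EFinP.
  move=> x _ /=; rewrite lee_fin (le_trans (Re_le_cabs _))//.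
  by rewrite (le_trans (fh x))// ler_norm.
apply: (le_integrable measurableT _ _ ih); first exact/measurable_EFinP.
move=> x _ /=; rewrite lee_fin (le_trans (Im_le_cabs _))//.
by rewrite (le_trans (fh x))// ler_norm.
Qed.

Lemma cintegrable_bounded f (C : R) : cmeasurable f ->
  (forall x, cabs (f x) <= C) -> cintegrable f.
Proof.
move=> mf; apply: cintegrable_le => //.
exact: finite_measure_integrable_cst.
Qed.

Lemma cintegrable_cabs f : cintegrable f ->
  mu.-integrable setT (EFin \o (fun x => cabs (f x))).
Proof.
move=> fi; have mf := cintegrable_meas fi; case: fi => f1 f2.
have := integrableD measurableT (integrable_norm f1) (integrable_norm f2).
apply: le_integrable => //; first exact/measurable_EFinP/measurable_cabs.
move=> x _ /=; rewrite lee_fin ger0_norm ?cabs_ge0//.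
by rewrite (le_trans (cabs_le_ReIm _))// ler_norm.
Qed.

Lemma cintegrableD f g : cintegrable f -> cintegrable g ->
  cintegrable (fun x => f x + g x).
Proof.
move=> fi gi.
apply: (cintegrable_le _
  (integrableD measurableT (cintegrable_cabs fi) (cintegrable_cabs gi))).
  by apply: cmeasurableD; exact: cintegrable_meas.
by move=> x; exact: cabsD.
Qed.

Lemma cintegrableMl f g (C : R) : cintegrable f -> cmeasurable g ->
  (forall x, cabs (g x) <= C) -> cintegrable (fun x => g x * f x).
Proof.
move=> fi mg gC.
apply: (cintegrable_le _ (integrableZl measurableT C (cintegrable_cabs fi))).
  by apply: cmeasurableM => //; exact: cintegrable_meas.
by move=> x; rewrite Normc.normcM ler_wpM2r ?cabs_ge0.
Qed.

Lemma cintegrableMr f g (C : R) : cintegrable f -> cmeasurable g ->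
  (forall x, cabs (g x) <= C) -> cintegrable (fun x => f x * g x).
Proof.
by move=> fi mg gC; under eq_fun do rewrite mulrC; exact: cintegrableMl gC.
Qed.

Lemma cintegrableZ c f : cintegrable f -> cintegrable (fun x => c * f x).
Proof. by move=> fi; apply: (@cintegrableMl _ _ (cabs c)). Qed.

Lemma cintegrable0 : cintegrable (fun=> 0).
Proof. by split; exact: integrable0. Qed.

Lemma cintegrable_sum (I : Type) (r : seq I) (P : pred I) (F : I -> T -> R[i]) :
  (forall i, P i -> cintegrable (F i)) ->
  cintegrable (fun x => \sum_(i <- r | P i) F i x).
Proof.
move=> mF; elim: r => [|i r IH].
  rewrite (_ : (fun x => _) = (fun=> 0)); first exact: cintegrable0.
  by apply/funext => x; rewrite big_nil.
have [Pi|nPi] := boolP (P i).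
  rewrite (_ : (fun x => _) =
      (fun x => F i x + \sum_(i <- r | P i) F i x)).
    by apply: cintegrableD => //; exact: mF.
  by apply/funext => x; rewrite big_cons Pi.
rewrite (_ : (fun x => _) = (fun x => \sum_(i <- r | P i) F i x))//.
by apply/funext => x; rewrite big_cons (negbTE nPi).
Qed.

Lemma cintegrableB f g : cintegrable f -> cintegrable g ->
  cintegrable (fun x => f x - g x).
Proof.
move=> mf mg; have -> : (fun x => f x - g x) = (fun x => f x + -1 * g x).
  by apply/funext => x; rewrite mulN1r.
by apply: cintegrableD => //; exact: cintegrableZ.
Qed.

Lemma cintD f g : cintegrable f -> cintegrable g ->
  cint (fun x => f x + g x) = cint f + cint g.
Proof.
move=> [f1 f2] [g1 g2]; apply/eqP; rewrite eq_complex /=; apply/andP; split.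
  by apply/eqP; rewrite -RintegralD//; apply: eq_Rintegral => x _; rewrite ReD.
by apply/eqP; rewrite -RintegralD//; apply: eq_Rintegral => x _; rewrite ImD.
Qed.

Lemma cintZ c f : cintegrable f -> cint (fun x => c * f x) = c * cint f.
Proof.
case: c => a b [f1 f2]; apply/eqP; rewrite eq_complex /=.
have Z (k : R) (h : T -> R) : mu.-integrable setT (EFin \o h) ->
    mu.-integrable setT (EFin \o (fun x => k * h x)).
  by move=> /(integrableZl measurableT k).
apply/andP; split; apply/eqP.
  under eq_Rintegral do rewrite ReM /=.
  rewrite RintegralB ?RintegralZl//; exact: Z.
under eq_Rintegral do rewrite ImM /=.
rewrite RintegralD ?RintegralZl//; exact: Z.
Qed.

Lemma cintB f g : cintegrable f -> cintegrable g ->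
  cint (fun x => f x - g x) = cint f - cint g.
Proof.
move=> mf mg; have -> : (fun x => f x - g x) = (fun x => f x + -1 * g x).
  by apply/funext => x; rewrite mulN1r.
by rewrite cintD ?cintZ ?mulN1r//; exact: cintegrableZ.
Qed.

Lemma cint0 : cint (fun=> 0) = 0.
Proof. by rewrite /cint /= !Rintegral_cst//= mul0r. Qed.

Lemma cint_cst c : cint (fun=> c) = c.
Proof.
case: c => a b; rewrite /cint /= !Rintegral_cst//=.
by rewrite probability_setT /= !mulr1.
Qed.

Lemma cint_sum (I : Type) (r : seq I) (P : pred I) (F : I -> T -> R[i]) :
  (forall i, P i -> cintegrable (F i)) ->
  cint (fun x => \sum_(i <- r | P i) F i x) = \sum_(i <- r | P i) cint (F i).
Proof.
move=> mF; elim: r => [|i r IH].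
  by rewrite big_nil -[RHS]cint0; congr cint; apply/funext => x; rewrite big_nil.
rewrite big_cons; case: ifPn => [Pi|nPi].
  rewrite -IH -cintD; [|exact: mF|exact: cintegrable_sum].
  by congr cint; apply/funext => x; rewrite big_cons Pi.
by rewrite -IH; congr cint; apply/funext => x; rewrite big_cons (negbTE nPi).
Qed.

(** Real and imaginary parts are estimated separately, whence the factor 2; it does no harm because
    the bound only serves to show that integrals tend to 0. *)
Lemma cabs_cint f : cintegrable f ->
  cabs (cint f) <= 2 * \int[mu]_x cabs (f x).
Proof.
move=> fi; have fa := cintegrable_cabs fi; case: fi => f1 f2.
rewrite (le_trans (cabs_le_ReIm _))//= mulr_natl mulr2n lerD//.
  rewrite (le_trans (le_normr_Rintegral measurableT f1))//.
  apply: le_Rintegral => //; first exact: integrable_norm.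
  by move=> x _; exact: Re_le_cabs.
rewrite (le_trans (le_normr_Rintegral measurableT f2))//.
apply: le_Rintegral => //; first exact: integrable_norm.
by move=> x _; exact: Im_le_cabs.
Qed.

(** Domination is asked of the differences [f_ n - f], which is what a telescoping argument
    provides, so integrability of f belongs to the conclusion. The majorant is extended-real because
    it will be an infinite series. *)
Lemma cint_dominated (f_ : nat -> T -> R[i]) f (G : T -> \bar R) :
  (forall n, cintegrable (f_ n)) -> cmeasurable f ->
  mu.-integrable setT G ->
  {ae mu, forall x n, ((cabs (f_ n x - f x))%:E <= G x)%E} ->
  {ae mu, forall x, cabs (f_ n x - f x) @[n --> \oo] --> 0} ->
  cintegrable f /\ cabs (cint (f_ n) - cint f) @[n --> \oo] --> 0.
Proof.
move=> fi mf ig fg fcvg.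
have mB n : cmeasurable (fun x => f_ n x - f x).
  by apply: cmeasurableB => //; exact: cintegrable_meas.
have f'i : cintegrable f.
  have -> : f = (fun x => f_ 0%N x - (f_ 0%N x - f x)).
    by apply/funext => x; rewrite opprB addrCA subrr addr0.
  apply: cintegrableB => //.
  suff i0 : mu.-integrable setT (EFin \o (fun x => cabs (f_ 0%N x - f x))).
    exact: cintegrable_le i0 _.
  (* Dominated convergence for a constant sequence: it only turns the almost everywhere bound by G
     into integrability of [f_ 0 - f]. *)
  have [|||||i1 _ _] := @dominated_convergence _ _ _ mu setT measurableT
    (fun=> EFin \o (fun x => cabs (f_ 0%N x - f x)))
    (EFin \o (fun x => cabs (f_ 0%N x - f x))) G.
  - by move=> n; exact/measurable_EFinP/measurable_cabs.
  - exact/measurable_EFinP/(measurable_cabs (mB 0%N)).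
  - by apply: aeW => x _; exact: cvg_cst.
  - exact: ig.
  - by apply: filterS fg => x h n _ /=; rewrite ger0_norm ?cabs_ge0.
  - exact: i1.
split=> //.
have [|||||_ _] := @dominated_convergence _ _ _ mu setT measurableT
    (fun n => EFin \o (fun x => cabs (f_ n x - f x))) (cst 0%E) G.
- by move=> n; exact/measurable_EFinP/measurable_cabs.
- exact: measurable_cst.
- apply: filterS fcvg => x h _; apply: cvg_EFin; first exact: nearW.
  exact: h.
- exact: ig.
- by apply: filterS fg => x h n _ /=; rewrite ger0_norm ?cabs_ge0.
rewrite integral0 => /fine_cvgP[_ h].
apply: (@squeeze_cvgr _ _ _ _ (fun=> 0)
  (fun n => 2 * \int[mu]_x cabs (f_ n x - f x))).
- apply: nearW => n; rewrite cabs_ge0 -cintB//; apply: cabs_cint.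
  exact: cintegrableB.
- exact: cvg_cst.
- by rewrite -[0](mulr0 2); apply: cvgM; [exact: cvg_cst|exact: h].
Qed.

End ComplexIntegral.

(** * Translation invariance of integrals of periodic functions *)

Section LebesgueTranslation.
Context {R : realType}.
Local Notation borelR := (measurableTypeR R).
Local Notation leb := (@lebesgue_measure R).
Local Open Scope ereal_scope.
Implicit Types (a : R) (f : borelR -> \bar R).

Definition translation a : borelR -> borelR := fun x => (x + a)%R.

Lemma measurable_translation a : measurable_fun setT (translation a).
Proof. exact: measurable_funD. Qed.

HB.instance Definition _ a :=
  isMeasurableFun.Build _ _ _ _ (translation a) (measurable_translation a).

Lemma lebesgue_measure_translation a (A : set borelR) : measurable A ->
  pushforward leb (translation a) A = leb A.
Proof.
move=> mA; apply/esym; apply: (@lebesgue_measure_unique _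
  (pushforward leb (translation a))) mA => X [[x y] _ <-].
rewrite [RHS](_ : _ = leb [set` `](x - a)%R, (y - a)%R]]); last first.
  by congr (leb _); apply/seteqP; split => z /=; rewrite /translation !in_itv /= ltrBlDr lerBrDr.
rewrite !lebesgue_measure_itv /= !lte_fin ltrD2r; case: ifP => // _.
by rewrite -!EFinB; congr (_%:E); rewrite opprB addrA subrK.
Qed.

Lemma ge0_integral_translation a (D : set borelR) f :
  measurable D -> measurable_fun setT f -> (forall x, 0 <= f x) ->
  \int[leb]_(x in translation a @^-1` D) f (x + a)%R = \int[leb]_(x in D) f x.
Proof.
move=> mD mf f0.
transitivity (\int[pushforward leb (translation a)]_(x in D) f x).
  rewrite (ge0_integral_pushforward (measurable_translation a))//.
  exact: measurable_funTS.
by apply: eq_measure_integral => A mA _; exact: lebesgue_measure_translation.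
Qed.

Section Periodic.
Variable f : borelR -> \bar R.
Hypothesis f_ge0 : forall x, 0 <= f x.
Hypothesis f_meas : measurable_fun setT f.
Hypothesis f_periodic : forall x, f (x + 1)%R = f x.

Lemma periodic_int (n : int) x : f (x + n%:~R)%R = f x.
Proof.
have H k y : f (y + k%:R)%R = f y.
  elim: k y => [|k IH] y; first by rewrite addr0.
  by rewrite -natr1 addrA f_periodic.
case: n => n; first exact: H.
by rewrite NegzE mulrNz -[LHS](H n.+1) subrK.
Qed.

(** Let n be the integer in ]a, a + 1]. Moving the piece [a, n[ by 1 turns [a, a + 1[ into [n, n +
    1[, which is an integer translate of [0, 1[. *)
Lemma integral_period_itv a :
  \int[leb]_(x in `[a, (a + 1)%R[) f x = \int[leb]_(x in `[(0 : R)%R, (1 : R)%R[) f x.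
Proof.
pose n : R := (Num.floor a + 1)%:~R.
have an : (a < n)%R by exact: floorD1_gt.
have na : (n <= a + 1)%R by rewrite /n intrD1 lerD2r floor_le.
have fn x : f (x + n)%R = f x by exact: periodic_int.
have S (x y z : R) : (x <= y)%R -> (y <= z)%R ->
    \int[leb]_(t in `[x, z[) f t =
    \int[leb]_(t in `[x, y[) f t + \int[leb]_(t in `[y, z[) f t.
  move=> xy yz; rewrite -ge0_integral_setU//=.
  - by rewrite -itv_bndbnd_setU// bnd_simp.
  - exact: measurable_funTS.
  - apply/disj_setPS => t [] /=; rewrite !in_itv /= => /andP[_ ty] /andP[yt _].
    by have := lt_le_trans ty yt; rewrite ltxx.
have T b (x y : R) : (forall t, f (t + b)%R = f t) ->
    \int[leb]_(t in `[x, y[) f t = \int[leb]_(t in `[(x + b)%R, (y + b)%R[) f t.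
  move=> fb; rewrite -(ge0_integral_translation b (D := [set` `[(x + b)%R, (y + b)%R[]))//.
  have -> : translation b @^-1` `[(x + b)%R, (y + b)%R[ = [set` `[x, y[].
    by apply/seteqP; split => z /=; rewrite /translation !in_itv /= lerD2r ltrD2r.
  by apply: eq_integral => t _; rewrite fb.
rewrite (S a n (a + 1)%R (ltW an) na).
have := T n 0%R 1%R fn; rewrite add0r => ->.
rewrite (S n (a + 1)%R (1 + n)%R)//; last by rewrite addrC lerD2l ltW.
by rewrite addeC (T 1%R a n)// (addrC n).
Qed.

Lemma integral_uniform_translation a :
  \int[uniform_prob (@ltr01 R)]_x f (x + a)%R =
  \int[uniform_prob (@ltr01 R)]_x f x.
Proof.
have mfa : measurable_fun setT (fun x : borelR => f (x + a)%R).
  exact: (measurableT_comp f_meas (measurable_translation a)).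
rewrite !integral_uniform// ?subr0 ?invr1 ?mul1e.
rewrite -(@integral_itv_bndo_bndc _ (BLeft 0%R) 1%R _ (measurable_funTS mfa)).
rewrite -(@integral_itv_bndo_bndc _ (BLeft 0%R) 1%R _ (measurable_funTS f_meas)).
rewrite -[RHS](integral_period_itv a).
rewrite -(ge0_integral_translation a (D := [set` `[a, (a + 1)%R[]))//.
congr (integral _ _ _); apply/seteqP.
by split => z /=; rewrite /translation !in_itv /= -[X in (X <= _ + _)%R]add0r lerD2r addrC ltrD2l.
Qed.

End Periodic.
End LebesgueTranslation.

Section TorusTranslation.
Context {R : realType}.
Local Notation borelR := (measurableTypeR R).
Local Open Scope ereal_scope.

Definition tuple_translation n (a : 'I_n -> R) (t : n.-tuple borelR) :
    n.-tuple borelR :=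
  [tuple (tnth t i + a i)%R | i < n].

Lemma measurable_tuple_translation n (a : 'I_n -> R) :
  measurable_fun setT (tuple_translation a).
Proof.
apply/measurable_fun_tnthP => i.
rewrite (_ : _ \o _ = (fun t => tnth t i + a i)%R); last first.
  by apply/funext => t /=; rewrite tnth_mktuple.
apply: measurable_funD => //; exact: measurable_tnth.
Qed.

Lemma tuple_translation_cons n (a : 'I_n.+1 -> R) (z : borelR * n.-tuple borelR) :
  tuple_translation a (pair_cons z) =
  pair_cons ((z.1 + a ord0)%R, tuple_translation (fun i => a (lift ord0 i)) z.2).
Proof.
apply: eq_from_tnth => i; rewrite tnth_mktuple.
have [j ->|->] := unliftP ord0 i; last by rewrite !tnth0.
by rewrite !tnthS tnth_mktuple.
Qed.

Lemma ge0_integral_torus_measureS n (g : n.+1.-tuple borelR -> \bar R) :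
  measurable_fun setT g -> (forall t, 0 <= g t) ->
  \int[torus_measure n.+1]_t g t =
  \int[uniform_prob (@ltr01 R)]_x \int[torus_measure n]_t g (pair_cons (x, t)).
Proof.
move=> mg g0; rewrite /= ge0_integral_distribution// fubini_tonelli1//=.
exact: measurableT_comp.
Qed.

Lemma measurable_integral_pair_cons n (g : n.+1.-tuple borelR -> \bar R) :
  measurable_fun setT g -> (forall t, 0 <= g t) ->
  measurable_fun setT
    (fun x : borelR => \int[torus_measure n]_t g (pair_cons (x, t))).
Proof.
move=> mg g0.
apply: (@measurable_fun_fubini_tonelli_F _ _ borelR (n.-tuple borelR) R
  (torus_measure n) (g \o @pair_cons R n)) => //.
  exact: measurableT_comp.
by move=> z /=; exact: g0.
Qed.

(** Induction on the dimension. Tonelli splits off the first coordinate, which the one-dimensional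
    result translates; the induction hypothesis translates the others in each slice, whose periods
    are those of g with 0 in the first place. *)
Lemma ge0_integral_torus_translation n (a : 'I_n -> R)
    (g : n.-tuple borelR -> \bar R) :
  measurable_fun setT g -> (forall t, 0 <= g t) ->
  (forall (k : 'I_n -> int) t,
    g (tuple_translation (fun i => (k i)%:~R%R) t) = g t) ->
  \int[torus_measure n]_t g (tuple_translation a t) = \int[torus_measure n]_t g t.
Proof.
elim: n a g => [a g mg g0 _|n IH a g mg g0 gper].
  by apply: eq_integral => t _; congr g; apply: eq_from_tnth => -[].
rewrite ge0_integral_torus_measureS//; last first.
  exact: (measurableT_comp mg (measurable_tuple_translation a)).
rewrite ge0_integral_torus_measureS//.
have mcons x : measurable_fun setT (fun t => g (pair_cons (x, t))).
  exact: (measurableT_comp mg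
    (measurableT_comp (@measurable_pair_cons R n) (pair1_measurable x))).
rewrite -[RHS](integral_uniform_translation _ _ _ (a ord0)).
- apply: eq_integral => x _.
  pose gx t := g (pair_cons ((x + a ord0)%R, t)).
  transitivity (\int[torus_measure n]_t
      gx (tuple_translation (fun i => a (lift ord0 i)) t)).
    by apply: eq_integral => t _; rewrite tuple_translation_cons.
  apply: (IH _ gx (mcons _) (fun t => g0 _)) => k t; rewrite /gx.
  rewrite -[RHS](gper (fun i => oapp k 0%R (unlift ord0 i))).
  rewrite tuple_translation_cons /= unlift_none /= addr0; congr (g (pair_cons (_, _))).
  by apply: eq_from_tnth => i; rewrite !tnth_mktuple liftK.
- by move=> x; exact: integral_ge0.
- exact: measurable_integral_pair_cons.
- move=> x; apply: eq_integral => t _.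
  rewrite -[RHS](gper (fun i => if i == ord0 then 1%R else 0%R)).
  rewrite tuple_translation_cons /=; congr (g (pair_cons (_, _))).
  by apply: eq_from_tnth => i; rewrite !tnth_mktuple /= addr0.
Qed.

Lemma ge0_integral_torus_coord n (i : 'I_n) (h : borelR -> \bar R) :
  measurable_fun setT h -> (forall x, 0 <= h x) ->
  \int[torus_measure n]_t h (tnth t i) = \int[uniform_prob (@ltr01 R)]_x h x.
Proof.
move=> mh h0; elim: n i => [[]//|n IH i].
rewrite ge0_integral_torus_measureS//; last first.
  by apply: measurableT_comp => //; exact: measurable_tnth.
have [j ->|->] := unliftP ord0 i; last first.
  apply: eq_integral => x _; under eq_integral do rewrite tnth0 /=.
  rewrite integral_cst//; transitivity (h x * 1); last exact: mule1.
  by congr (_ * _); exact: probability_setT.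
under eq_integral.
  move=> x _; under eq_integral do rewrite tnthS /=.
  rewrite IH; over.
rewrite integral_cst//; set c := integral _ _ _.
by transitivity (c * 1); [congr (_ * _); exact: probability_setT|exact: mule1].
Qed.

End TorusTranslation.

(** * Characters and Fourier coefficients on the torus *)

Section TorusFourier.
Context {R : realType} {d : nat}.
Local Open Scope complex_scope.
Local Notation borelR := (measurableTypeR R).
Local Notation P := (@torus_measure R d).
Implicit Types (f g : 'cV[R]_d -> R[i]) (k l : 'cV[int]_d) (x y a : 'cV[R]_d).

Definition torus_integrable f : Prop :=
  cintegrable P (fun t => f (vec_of_tuple t)).

Lemma vec_of_tuple_translation a (t : d.-tuple borelR) :
  vec_of_tuple (tuple_translation (fun i => a i 0) t) = vec_of_tuple t + a.
Proof. by apply/colP => i; rewrite !mxE tnth_mktuple. Qed.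

Lemma torus_measurable_translation f a :
  torus_measurable f -> torus_measurable (fun x => f (x + a)).
Proof.
move=> [f1 f2]; split.
  have := measurableT_comp f1 (measurable_tuple_translation (fun i => a i 0)).
  by apply: eq_measurable_fun => t _ /=; rewrite vec_of_tuple_translation.
have := measurableT_comp f2 (measurable_tuple_translation (fun i => a i 0)).
by apply: eq_measurable_fun => t _ /=; rewrite vec_of_tuple_translation.
Qed.

Lemma ge0_integral_vec_translation (h : 'cV[R]_d -> \bar R) a :
  measurable_fun setT (fun t => h (vec_of_tuple t)) ->
  (forall x, (0 <= h x)%E) -> (forall x (k : 'cV[int]_d), h (x + mxR k) = h x) ->
  (\int[P]_t h (vec_of_tuple t + a)%R = \int[P]_t h (vec_of_tuple t))%E.
Proof.
move=> mh h0 hper.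
rewrite -(ge0_integral_torus_translation (fun i => a i 0)
  (g := fun t => h (vec_of_tuple t)))//.
  by apply: eq_integral => t _; rewrite vec_of_tuple_translation.
move=> k t; rewrite -[RHS](hper _ (\col_i k i)); congr h.
by apply/colP => i; rewrite !mxE tnth_mktuple.
Qed.

Lemma torus_integrable_translation f a : Zd_periodic f ->
  torus_integrable f -> torus_integrable (fun x => f (x + a)).
Proof.
move=> fper fi; have mf : torus_measurable f := cintegrable_meas fi.
have mfa : cmeasurable (fun t : d.-tuple borelR => f (vec_of_tuple t + a)) :=
  torus_measurable_translation a mf.
have : P.-integrable setT (EFin \o (fun t => cabs (f (vec_of_tuple t + a)))).
  apply/integrableP; split; first by apply/measurable_EFinP; exact: measurable_cabs mfa.
  have /integrableP[mc] := cintegrable_cabs fi.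
  rewrite -(@ge0_integral_vec_translation (fun x => `|(cabs (f x))%:E|%E) a)//.
    exact: measurableT_comp.
  by move=> x k; rewrite fper.
by move=> ia; apply: cintegrable_le ia _.
Qed.

(** The invariance known so far rests on Tonelli and concerns nonnegative functions, so the positive
    and negative parts are translated separately. *)
Lemma Rintegral_translation (h : 'cV[R]_d -> R) a :
  P.-integrable setT (EFin \o (fun t => h (vec_of_tuple t))) ->
  (forall x (k : 'cV[int]_d), h (x + mxR k) = h x) ->
  \int[P]_t h (vec_of_tuple t + a) = \int[P]_t h (vec_of_tuple t).
Proof.
move=> hi hper; rewrite /Rintegral; congr fine.
have mh := measurable_int _ hi.
have h0 x : (0 <= maxe (h x)%:E 0)%E by rewrite le_max lexx orbT.
have h0' x : (0 <= maxe (- (h x)%:E) 0)%E by rewrite le_max lexx orbT.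
rewrite integralE [RHS]integralE; congr (_ - _)%E.
  transitivity (\int[P]_t maxe (h (vec_of_tuple t))%:E 0)%E; last first.
    by apply: eq_integral => t _; rewrite funeposE.
  rewrite -(@ge0_integral_vec_translation _ a _ h0).
  - by apply: eq_integral => t _; rewrite funeposE.
  - by have := measurable_funepos mh; apply: eq_measurable_fun => t _; rewrite funeposE.
  - by move=> x k; rewrite hper.
transitivity (\int[P]_t maxe (- (h (vec_of_tuple t))%:E) 0)%E; last first.
  by apply: eq_integral => t _; rewrite funenegE.
rewrite -(@ge0_integral_vec_translation _ a _ h0').
- by apply: eq_integral => t _; rewrite funenegE.
- by have := measurable_funeneg mh; apply: eq_measurable_fun => t _; rewrite funenegE.
- by move=> x k; rewrite hper.
Qed.

Lemma torus_integral_translation f a : Zd_periodic f -> torus_integrable f ->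
  torus_integral (fun x => f (x + a)) = torus_integral f.
Proof.
move=> fper [f1 f2]; apply/eqP; rewrite eq_complex /=; apply/andP; split.
  apply/eqP/(@Rintegral_translation (fun x => complex.Re (f x))) => // x k.
  by rewrite fper.
apply/eqP/(@Rintegral_translation (fun x => complex.Im (f x))) => // x k.
by rewrite fper.
Qed.

Lemma dotvDl x y a : dotv (x + y) a = dotv x a + dotv y a.
Proof. by rewrite -big_split; apply: eq_bigr => i _; rewrite mxE mulrDl. Qed.

Lemma dotvDr x y a : dotv a (x + y) = dotv a x + dotv a y.
Proof. by rewrite -big_split; apply: eq_bigr => i _; rewrite mxE mulrDr. Qed.

Lemma dotvNl x a : dotv (- x) a = - dotv x a.
Proof. by rewrite -sumrN; apply: eq_bigr => i _; rewrite mxE mulNr. Qed.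

Lemma dotv_int k l : dotv (mxR k) (mxR l) = (\sum_i k i 0 * l i 0)%:~R :> R.
Proof. by rewrite rmorph_sum; apply: eq_bigr => i _; rewrite !mxE rmorphM. Qed.

Lemma torus_charD k l x :
  torus_char (k + l) x = torus_char k x * torus_char l x.
Proof. by rewrite /torus_char /mxR map_mxD dotvDl expi2piD. Qed.

Lemma torus_charDr k x y :
  torus_char k (x + y) = torus_char k x * torus_char k y.
Proof. by rewrite /torus_char dotvDr expi2piD. Qed.

Lemma torus_charN k x : torus_char (- k) x = (torus_char k x)^*.
Proof. by rewrite /torus_char /mxR map_mxN dotvNl expi2piN. Qed.

Lemma torus_char0 x : torus_char 0 x = 1.
Proof.
rewrite /torus_char /mxR map_mx0 /dotv big1 ?expi2pi0// => i _.
by rewrite mxE mul0r.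
Qed.

Lemma cabs_torus_char k x : cabs (torus_char k x) = 1.
Proof. exact: cabs_expi2pi. Qed.

Lemma torus_char_periodic k : Zd_periodic (torus_char (R := R) k).
Proof. by move=> x l; rewrite torus_charDr /torus_char dotv_int expi2pi_int mulr1. Qed.

Lemma torus_char_measurable k : torus_measurable (torus_char (R := R) k).
Proof.
have md : measurable_fun setT (fun t : d.-tuple borelR =>
    2 * pi * dotv (mxR k) (vec_of_tuple t)).
  apply: measurable_funM => //; rewrite /dotv.
  apply: measurable_sum => i; apply: measurable_funM => //.
  apply: eq_measurable_fun (measurable_tnth (T := borelR) i) => t _.
  by rewrite mxE.
split => /=.
  exact: (measurableT_comp (continuous_measurable_fun (@continuous_cos R)) md).
exact: (measurableT_comp (continuous_measurable_fun (@continuous_sin R)) md).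
Qed.

Lemma torus_char_integrable k : torus_integrable (torus_char (R := R) k).
Proof.
apply: (@cintegrable_bounded _ _ _ _ _ 1); first exact: torus_char_measurable.
by move=> t; rewrite cabs_torus_char.
Qed.

(** For k nonzero, the vector [a] is chosen with (k, a) = 1/2. Translation by it multiplies the
    character by -1 and leaves the integral unchanged, so the integral equals its opposite. *)
Lemma torus_integral_char k : torus_integral (torus_char (R := R) k) = (k == 0)%:R.
Proof.
have [->|k0] := eqVneq k 0.
  rewrite -[RHS](cint_cst P); congr (cint P _).
  by apply/funext => t; rewrite torus_char0.
have [i ki] : exists i, k i 0 != 0.
  apply/existsP; apply: contra_neqT k0 => /existsPn h.
  by apply/colP => i; rewrite mxE; apply/eqP; have := h i; rewrite negbK.
pose a : 'cV[R]_d := \col_j (if j == i then (2 * (k i 0)%:~R)^-1 else 0).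
have ea : torus_char k a = -1.
  rewrite /torus_char /dotv (bigD1 i)//= big1 ?addr0; last first.
    by move=> j /negbTE ji; rewrite !mxE ji mulr0.
  rewrite !mxE eqxx invfM mulrCA divff ?intr_eq0// mulr1 /expi2pi mulrAC divff ?pnatr_eq0//.
  by rewrite mul1r cospi sinpi; apply/eqP; rewrite eq_complex /= oppr0 !eqxx.
have := torus_integral_translation a (@torus_char_periodic k) (torus_char_integrable k).
have -> : torus_integral (fun x => torus_char k (x + a)) =
    -1 * torus_integral (torus_char (R := R) k).
  rewrite -[RHS](cintZ (-1) (torus_char_integrable k)).
  by congr (cint P _); apply/funext => t; rewrite torus_charDr ea mulrC.
rewrite mulN1r => /eqP.
by rewrite eq_sym -addr_eq0 -mulr2n mulrn_eq0 /= => /eqP.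
Qed.

Lemma fourier_char k l : fourier (torus_char (R := R) k) l = (k == l)%:R.
Proof.
rewrite /fourier; have -> : (fun x => torus_char k x * torus_char (- l) x) =
   torus_char (R := R) (k - l) by apply/funext => x; rewrite torus_charD.
by rewrite torus_integral_char subr_eq0.
Qed.

Lemma fourier_integrable f k : torus_integrable f ->
  torus_integrable (fun x => f x * torus_char (- k) x).
Proof.
move=> fi; apply: (@cintegrableMr _ _ _ _ _ _ 1) => //.
  exact: torus_char_measurable.
by move=> t; rewrite cabs_torus_char.
Qed.

Lemma fourierB f g k : torus_integrable f -> torus_integrable g ->
  fourier (fun x => f x - g x) k = fourier f k - fourier g k.
Proof.
move=> fi gi; rewrite /fourier /torus_integral.
rewrite -(cintB (fourier_integrable k fi) (fourier_integrable k gi)).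
by congr (cint P _); apply/funext => t; rewrite mulrBl.
Qed.

Lemma fourierZ (c : R[i]) f k : torus_integrable f ->
  fourier (fun x => c * f x) k = c * fourier f k.
Proof.
move=> fi; rewrite /fourier /torus_integral -(cintZ _ (fourier_integrable k fi)).
by congr (cint P _); apply/funext => t; rewrite mulrA.
Qed.

Lemma fourier_sum (I : Type) (r : seq I) (F : I -> 'cV[R]_d -> R[i]) k :
  (forall i, torus_integrable (F i)) ->
  fourier (fun x => \sum_(i <- r) F i x) k = \sum_(i <- r) fourier (F i) k.
Proof.
move=> iF; rewrite /fourier /torus_integral.
rewrite -(cint_sum (P := xpredT) r (fun i _ => fourier_integrable k (iF i))).
by congr (cint P _); apply/funext => t; rewrite mulr_suml.
Qed.

Lemma fourier_translation f a k : Zd_periodic f -> torus_integrable f ->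
  fourier (fun x => f (x - a)) k = torus_char (- k) a * fourier f k.
Proof.
move=> fper fi; rewrite /fourier.
have gper : Zd_periodic (fun x => f x * torus_char (- k) x).
  by move=> x l; rewrite fper torus_char_periodic.
rewrite -[X in _ * X](torus_integral_translation (- a) gper (fourier_integrable k fi)).
rewrite -[RHS]cintZ; last first.
  exact: (torus_integrable_translation (- a) gper (fourier_integrable k fi)).
congr (cint P _); apply/funext => t; rewrite mulrCA -torus_charDr.
by rewrite addrCA subrr addr0.
Qed.

Lemma Lp_torus_integrable (p : \bar R) f : (1 <= p)%E -> Lp_torus p f ->
  torus_integrable f.
Proof.
move=> p1 [_ mf fp]; have mcf : measurable_fun setT
   (fun t : d.-tuple borelR => cabs (f (vec_of_tuple t))) := measurable_cabs mf.
have : (fun t => cabs (f (vec_of_tuple t))) \in Lfun P p.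
  by apply/andP; split; rewrite inE /=.
have Pfin : P setT \is a fin_num by rewrite fin_num_measure.
move=> /(Lfun_subset (lexx 1%E) p1 Pfin p1) /Lfun1_integrable ip.
exact: cintegrable_le ip _.
Qed.

End TorusFourier.

(** * Uniqueness of Fourier coefficients *)

Section Multipliers.
Context {R : realType} {d : nat}.
Local Open Scope complex_scope.
Local Notation borelR := (measurableTypeR R).
Local Notation T := (d.-tuple borelR).
Local Notation P := (@torus_measure R d).
Implicit Types (g h : T -> R[i]).

Definition null_coefficients g : Prop :=
  forall k, cint P (fun t => g t * torus_char k (vec_of_tuple t)) = 0.

(* A class of bounded functions closed under algebra operations and bounded
   limits, whose members cannot detect a function with zero coefficients. *)
Definition multiplier h : Prop :=
  [/\ cmeasurable h, exists C, forall t, cabs (h t) <= C &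
      forall g, cintegrable P g -> null_coefficients g ->
        null_coefficients (fun t => g t * h t)].

Lemma char_cmeasurable k :
  cmeasurable (fun t : T => torus_char k (vec_of_tuple t)).
Proof. exact: torus_char_measurable. Qed.

Lemma cintegrable_mul_char g k : cintegrable P g ->
  cintegrable P (fun t => g t * torus_char k (vec_of_tuple t)).
Proof.
move=> gi; apply: (@cintegrableMr _ _ _ _ _ _ 1) => //.
  exact: char_cmeasurable.
by move=> t; rewrite cabs_torus_char.
Qed.

Lemma multiplier_integrable g h : multiplier h -> cintegrable P g ->
  cintegrable P (fun t => g t * h t).
Proof. by move=> [mh [C hC] _] gi; apply: (@cintegrableMr _ _ _ _ _ _ C). Qed.

Lemma multiplier_char k : multiplier (fun t => torus_char k (vec_of_tuple t)).
Proof.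
split; first exact: char_cmeasurable.
  by exists 1 => t; rewrite cabs_torus_char.
move=> g gi g0 l; rewrite -[RHS](g0 (k + l)); congr (cint P _).
by apply/funext => t; rewrite torus_charD mulrA.
Qed.

Lemma multiplierD h1 h2 : multiplier h1 -> multiplier h2 ->
  multiplier (fun t => h1 t + h2 t).
Proof.
move=> H1 H2; have [m1 [C1 b1] n1] := H1; have [m2 [C2 b2] n2] := H2.
split; first exact: cmeasurableD.
  by exists (C1 + C2) => t; rewrite (le_trans (cabsD _ _))// lerD.
move=> g gi g0 k.
transitivity (cint P (fun t => g t * h1 t * torus_char k (vec_of_tuple t) +
                               g t * h2 t * torus_char k (vec_of_tuple t))).
  by congr (cint P _); apply/funext => t; rewrite mulrDr mulrDl.
by rewrite cintD ?n1 ?n2 ?addr0//; apply: cintegrable_mul_char;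
  exact: multiplier_integrable.
Qed.

Lemma multiplierM h1 h2 : multiplier h1 -> multiplier h2 ->
  multiplier (fun t => h1 t * h2 t).
Proof.
move=> H1 H2; have [m1 [C1 b1] n1] := H1; have [m2 [C2 b2] n2] := H2.
split; first exact: cmeasurableM.
  by exists (C1 * C2) => t; rewrite Normc.normcM ler_pM ?cabs_ge0.
move=> g gi g0; have := n2 _ (multiplier_integrable H1 gi) (n1 _ gi g0).
by congr null_coefficients; apply/funext => t; rewrite mulrA.
Qed.

Lemma multiplier_cst c : multiplier (fun=> c).
Proof.
split; [exact: cmeasurable_cst|by exists (cabs c)|move=> g gi g0 k].
transitivity (cint P (fun t => c * (g t * torus_char k (vec_of_tuple t)))).
  by congr (cint P _); apply/funext => t; rewrite mulrAC mulrC.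
by rewrite cintZ ?g0 ?mulr0//; exact: cintegrable_mul_char.
Qed.

(** Dominated convergence: the products of g with [h_ n] have zero coefficients, and they differ
    from g h by at most 2 C |g|, which is integrable. *)
Lemma multiplier_lim (h_ : nat -> T -> R[i]) h (C : R) :
  (forall n, multiplier (h_ n)) -> cmeasurable h ->
  (forall n t, cabs (h_ n t) <= C) -> (forall t, cabs (h t) <= C) ->
  {ae P, forall t, cabs (h_ n t - h t) @[n --> \oo] --> 0} ->
  multiplier h.
Proof.
move=> H mh hC0 hC hl; split=> //; first by exists C.
move=> g gi g0 k.
have gki := cintegrable_mul_char k gi.
have ig : P.-integrable setT (EFin \o (fun t => (C + C) * cabs (g t))).
  exact: (integrableZl measurableT (C + C) (cintegrable_cabs gi)).
have [||||_] := @cint_dominated _ _ _ P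
    (fun n t => g t * h_ n t * torus_char k (vec_of_tuple t))
    (fun t => g t * h t * torus_char k (vec_of_tuple t)) _ _ _ ig.
- by move=> n; exact/cintegrable_mul_char/multiplier_integrable.
- apply: cmeasurableM; last exact: char_cmeasurable.
  by apply: cmeasurableM => //; exact: cintegrable_meas gi.
- apply: aeW => t n; rewrite lee_fin -mulrBl -mulrBr !Normc.normcM cabs_torus_char mulr1 mulrC.
  by rewrite ler_wpM2r ?cabs_ge0// (le_trans (cabsB _ _))// lerD.
- apply: filterS hl => t ht.
  rewrite (_ : (fun n => _) = (fun n => cabs (g t) * cabs (h_ n t - h t))).
    rewrite -[X in _ --> X](mulr0 (cabs (g t))).
    by apply: cvgM; [exact: cvg_cst|exact: ht].
  by apply/funext => n; rewrite -mulrBl -mulrBr !Normc.normcM cabs_torus_char mulr1.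
rewrite (_ : (fun n => _) = (fun=> cabs (cint P
    (fun t => g t * h t * torus_char k (vec_of_tuple t))))); last first.
  by apply/funext => n; have [_ _ -> //] := H n; rewrite sub0r normcN.
move=> /(cvg_unique (@Rhausdorff R) (cvg_cst _)) h0.
by apply/eqP; rewrite -cabs0_eq h0.
Qed.

(* Cubic Newton iteration for the sign function on [-1, 1]. *)
Definition sign_step (u : R) : R := (3 * u - u ^+ 3) / 2.

Lemma sign_step_bounded (u : R) : `|u| <= 1 -> `|sign_step u| <= 1.
Proof.
rewrite !ler_norml /sign_step => /andP[a b].
(* The two products are 2 (1 - [sign_step u]) and 2 (1 + [sign_step u]). *)
have h1 : 0 <= (1 - u) ^+ 2 * (2 + u) by apply: mulr_ge0; [exact: sqr_ge0|lra].
have h2 : 0 <= (1 + u) ^+ 2 * (2 - u) by apply: mulr_ge0; [exact: sqr_ge0|lra].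
by apply/andP; split; lra.
Qed.

Lemma iter_sign_step_bounded n (u : R) : `|u| <= 1 -> `|iter n sign_step u| <= 1.
Proof. by move=> u1; elim: n => // n IH; rewrite iterS sign_step_bounded. Qed.

Lemma iter_sign_stepN n (u : R) : iter n sign_step (- u) = - iter n sign_step u.
Proof. by elim: n => //= n ->; rewrite /sign_step; ring. Qed.

(** One step from v multiplies the distance to 1 by (1 - v)(2 + v)/2 = 1 - v(1 + v)/2. This factor
    is at most 1 - u/2 once v >= u, and the iterates never fall below their starting point u. *)
Lemma iter_sign_step_pos n (u : R) : 0 < u <= 1 ->
  u <= iter n sign_step u <= 1 /\ 1 - iter n sign_step u <= (1 - u / 2) ^+ n.
Proof.
move=> /andP[u0 u1]; elim: n => [|n [/andP[IH1 IH2] IH3]].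
  by rewrite /= lexx u1 expr0 lerBlDr lerDl ltW.
rewrite iterS exprS; set v := iter n sign_step u in IH1 IH2 IH3 *.
set w := (1 - u / 2) ^+ n in IH3 *.
have h1 : 0 <= (1 - v) ^+ 2 * (2 + v) by apply: mulr_ge0; [exact: sqr_ge0|lra].
have h2 : 0 <= v * (1 - v) * (1 + v) by do ?apply: mulr_ge0; lra.
rewrite /sign_step; split; first by apply/andP; split; lra.
have -> : 1 - (3 * v - v ^+ 3) / 2 = ((1 - v) * (2 + v) / 2) * (1 - v) by field.
have w0 : 0 <= w by rewrite exprn_ge0//; lra.
have h3 : 0 <= (1 - v) * (2 + v) by apply: mulr_ge0; lra.
have h4 : 0 <= (v - u) * (v + u + 1) by apply: mulr_ge0; lra.
have h5 : 0 <= u * u by exact: mulr_ge0 (ltW u0) (ltW u0).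
by apply: ler_pM => //; lra.
Qed.

Lemma cvg_iter_sign_step (u : R) : `|u| <= 1 ->
  iter n sign_step u @[n --> \oo] --> Num.sg u.
Proof.
have pos v : 0 < v <= 1 -> iter n sign_step v @[n --> \oo] --> (1 : R).
  move=> v01; have /andP[v0 v1] := v01.
  apply: (@squeeze_cvgr _ _ _ _ (fun n => 1 - (1 - v / 2) ^+ n) (fun=> 1)).
  - apply: nearW => n; have [/andP[_ ->] h] := iter_sign_step_pos n v01.
    by rewrite andbT; lra.
  - rewrite -[X in _ --> X]subr0; apply: cvgB; first exact: cvg_cst.
    by apply: cvg_expr; rewrite ger0_norm; lra.
  - exact: cvg_cst.
move=> u1; have [u0|u0|->] := ltgtP u 0.
- rewrite ltr0_sg// -[u]opprK.
  under eq_fun do rewrite iter_sign_stepN.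
  by apply: cvgN; apply: pos; move: u1; rewrite ltr0_norm// oppr_gt0 u0.
- by rewrite gtr0_sg//; apply: pos; move: u1; rewrite gtr0_norm// u0.
- rewrite sgr0 (_ : (fun n => _) = (fun=> 0)); first exact: cvg_cst.
  apply/funext; elim=> // n IH; rewrite iterS IH /sign_step; ring.
Qed.

Lemma multiplier_sign_step (u : T -> R) : multiplier (fun t => (u t)%:C) ->
  multiplier (fun t => (sign_step (u t))%:C).
Proof.
move=> mu; have -> : (fun t => (sign_step (u t))%:C) =
   (fun t => (2^-1)%:C * (3%:C * (u t)%:C + (-1)%:C * ((u t)%:C * ((u t)%:C * (u t)%:C)))).
  by apply/funext => t; rewrite -!rmorphM -rmorphD -rmorphM /sign_step; congr (_%:C); field.
by do ?[apply: multiplierM|apply: multiplierD|exact: multiplier_cst|assumption].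
Qed.

(** [sign_step] is a polynomial, so its iterates at u stay in the class; they converge boundedly to
    the sign of u. This reaches discontinuous functions without any uniform approximation
    theorem. *)
Lemma multiplier_sg (u : T -> R) : (forall t, `|u t| <= 1) ->
  multiplier (fun t => (u t)%:C) -> multiplier (fun t => (Num.sg (u t))%:C).
Proof.
move=> u1 mu; have [[m1 _] _ _] := mu.
have mit n : multiplier (fun t => (iter n sign_step (u t))%:C).
  by elim: n => // n IH; exact: multiplier_sign_step IH.
have msg : measurable_fun setT (fun t => Num.sg (u t)).
  apply: (@measurable_fun_cvg _ _ _ _ (fun n t => iter n sign_step (u t))) => //.
    by move=> n; have [[] ] := mit n.
  by move=> t _; exact: cvg_iter_sign_step.
apply: (@multiplier_lim (fun n t => (iter n sign_step (u t))%:C) _ 1) => //.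
- by move=> n t; rewrite cabs_real iter_sign_step_bounded.
- by move=> t; rewrite cabs_real normr_sg; case: eqP.
- apply: aeW => t.
  rewrite (_ : (fun n => _) = (fun n => `|iter n sign_step (u t) - Num.sg (u t)|)).
    rewrite -[0](@normr0 _ R) -(subrr (Num.sg (u t))); apply: cvg_norm.
    by apply: cvgB; [exact: cvg_iter_sign_step|exact: cvg_cst].
  by apply/funext => n; rewrite -rmorphB cabs_real.
Qed.

End Multipliers.

Section Uniqueness.
Context {R : realType} {d : nat}.
Local Open Scope complex_scope.
Local Notation borelR := (measurableTypeR R).
Local Notation T := (d.-tuple borelR).
Local Notation P := (@torus_measure R d).
Implicit Types (g h : T -> R[i]) (A : set T).

Lemma torus_aeS (A B : T -> Prop) : {ae P, forall t, A t} ->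
  (forall t, A t -> B t) -> {ae P, forall t, B t}.
Proof. by move=> hA AB; apply: filterS hA => t; exact: AB. Qed.

Lemma multiplier_ae h1 h2 (C : R) : multiplier h1 -> cmeasurable h2 ->
  (forall t, cabs (h1 t) <= C) -> (forall t, cabs (h2 t) <= C) ->
  {ae P, forall t, h1 t = h2 t} -> multiplier h2.
Proof.
move=> m1 m2 c1 c2 h12; apply: (@multiplier_lim _ _ (fun=> h1) _ C) => //.
apply: filterS h12 => t ->.
by rewrite (_ : (fun n => _) = (fun=> 0)); [exact: cvg_cst|apply/funext => n; rewrite subrr Normc.normc0].
Qed.

Lemma ae_coord_itv (i : 'I_d) : {ae P, forall t, 0 < tnth t i < 1}.
Proof.
pose A : set T := [set t | ~ (0 < tnth t i < 1)].
have mI : measurable (~` [set` `](0 : R), (1 : R)[] : set borelR).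
  by apply: measurableC; exact: measurable_itv.
have mA : measurable A.
  have := measurable_tnth (T := borelR) i measurableT mI.
  by rewrite setTI; congr measurable; apply/seteqP; split => t /=; rewrite in_itv.
exists A; split => //.
pose h (x : borelR) : \bar R := (\1_(~` [set` `](0 : R), (1 : R)[]) x)%:E.
have mh : measurable_fun setT h by apply/measurable_EFinP; exact: measurable_indic.
have h0 x : (0 <= h x)%E by rewrite lee_fin.
transitivity (\int[P]_t h (tnth t i))%E.
  transitivity (\int[P]_t (\1_A t)%:E)%E; first by rewrite integral_indic// setIT.
  apply: eq_integral => t _; rewrite /h !indicE.
  suff -> : (t \in A) = (tnth t i \in ~` [set` `](0 : R), (1 : R)[]) by [].
  by apply/idP/idP; rewrite !inE /A /= ?in_itv.
rewrite ge0_integral_torus_coord// integral_uniform// subr0 invr1 mul1e.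
rewrite -(@integral_itv_bndo_bndc _ (BLeft 0) 1 _ (measurable_funTS mh)).
rewrite -(@integral_itv_obnd_cbnd _ 0 (BLeft 1) _ (measurable_funTS mh)).
apply: integral0_eq => x /= x01; rewrite /h indicE memNset//=.
Qed.

(** Neither factor has period 1, but the product is (cos(2 pi (t_i - a/2)) - cos(pi a))/2, a
    combination of 1 and two characters. For 0 < a < 1 and t_i in ]0, 1[ it is positive exactly when
    t_i < a, so its sign detects a half-space. *)
Lemma multiplier_sin_sin (i : 'I_d) (a : R) :
  multiplier (fun t : T => (sin (pi * tnth t i) * sin (pi * (a - tnth t i)))%:C).
Proof.
pose e : 'cV[int]_d := delta_mx i 0.
pose c := expi2pi (- (a / 2)).
have E (t : T) : (sin (pi * tnth t i) * sin (pi * (a - tnth t i)))%:C =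
    (4^-1)%:C * (c * torus_char e (vec_of_tuple t) +
    conjc c * torus_char (- e) (vec_of_tuple t)) + (- (cos (pi * a) / 2))%:C.
  rewrite torus_charN -[conjc c * _](rmorphM (@conjc R)).
  have -> : c * torus_char e (vec_of_tuple t) = expi2pi (tnth t i - a / 2).
    rewrite /c /torus_char -expi2piD addrC; congr (expi2pi (_ + _)).
    rewrite /dotv (bigD1 i)//= big1 ?addr0; last first.
      by move=> j ji; rewrite !mxE (negbTE ji) mul0r.
    by rewrite !mxE !eqxx mul1r.
  rewrite addcJ (_ : 2%:R = (2 : R)%:C); last by rewrite rmorph_nat.
  rewrite -!rmorphM -rmorphD /=; congr (_%:C).
  rewrite (_ : 2 * pi * (tnth t i - a / 2) = pi * tnth t i - pi * (a - tnth t i)).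
    rewrite [in cos (pi * a)](_ : pi * a = pi * tnth t i + pi * (a - tnth t i)); last by ring.
    by rewrite cosB cosD; field.
  by field.
rewrite (_ : (fun t => _) = (fun t => (4^-1)%:C * (c * torus_char e (vec_of_tuple t) +
    conjc c * torus_char (- e) (vec_of_tuple t)) + (- (cos (pi * a) / 2))%:C)).
  by do ?[apply: multiplierM|apply: multiplierD|exact: multiplier_cst|
    exact: multiplier_char].
by apply/funext => t; exact: E.
Qed.

Lemma cmeasurable_indic A : measurable A -> cmeasurable (fun t => (\1_A t : R)%:C).
Proof. by move=> mA; apply: cmeasurable_real; exact: measurable_indic. Qed.

Lemma cabs_indic A t : cabs ((\1_A t : R)%:C) <= 1.
Proof. by rewrite cabs_real indicE ger0_norm// lern1; case: (_ \in _). Qed.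

Lemma multiplier_coord_lt (i : 'I_d) (a : R) :
  multiplier (fun t => (\1_[set t : T | tnth t i < a] t : R)%:C).
Proof.
have mA : measurable [set t : T | tnth t i < a].
  have := measurable_tnth (T := borelR) i measurableT (measurable_itv `]-oo, a[).
  by rewrite setTI; congr measurable; apply/seteqP; split => t /=; rewrite in_itv.
have mI := cmeasurable_indic mA.
have inE' t : (\1_[set t : T | tnth t i < a] t : R) = (tnth t i < a)%R%:R.
  by rewrite indicE (_ : (t \in _) = (tnth t i < a)%R)//; apply/idP/idP; rewrite inE.
(* Outside 0 < a < 1 the indicator is almost everywhere constant, since almost every point has its
   coordinates in ]0, 1[. *)
have [a0|a0] := leP a 0.
  apply: (multiplier_ae (C := 1) (multiplier_cst 0)) => //.
  - by move=> t; rewrite Normc.normc0.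
  - by move=> t; exact: cabs_indic.
  - apply: (torus_aeS (ae_coord_itv i)) => t /andP[t0 t1].
    by rewrite inE' ltNge (le_trans a0 (ltW t0)).
have [a1|a1] := leP 1 a.
  apply: (multiplier_ae (C := 1) (multiplier_cst 1)) => //.
  - by move=> t; rewrite Normc.normc1.
  - by move=> t; exact: cabs_indic.
  - apply: (torus_aeS (ae_coord_itv i)) => t /andP[t0 t1].
    by rewrite inE' (lt_le_trans t1 a1).
pose u (t : T) : R := sin (pi * tnth t i) * sin (pi * (a - tnth t i)).
have u1 t : `|u t| <= 1.
  by rewrite normrM mulr_ile1// ler_norml sin_geN1 sin_le1.
have ms := multiplier_sg u1 (multiplier_sin_sin i a).
(* The polynomial (x + x^2)/2 sends the sign values -1, 0, 1 to 0, 0, 1, which turns the sign of u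
   into the indicator of u > 0. *)
have {}ms : multiplier (fun t =>
    (2^-1)%:C * ((Num.sg (u t))%:C + (Num.sg (u t))%:C * (Num.sg (u t))%:C)).
  by do ?[apply: multiplierM|apply: multiplierD|exact: multiplier_cst|
    exact: ms].
have E t : (2^-1)%:C * ((Num.sg (u t))%:C + (Num.sg (u t))%:C * (Num.sg (u t))%:C)
    = ((0 < u t)%R%:R : R)%:C.
  rewrite -!(rmorphM, rmorphD) /=; congr (_%:C).
  case: (ltgtP (u t) 0) => [ut|ut|->].
  - by rewrite ltr0_sg//= mulr0n; field.
  - by rewrite gtr0_sg//= mulr1n; field.
  - by rewrite sgr0 mulr0n; field.
apply: (multiplier_ae (C := 1) ms) => //.
- by move=> t; rewrite E cabs_real ger0_norm// lern1; case: (0 < _).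
- by move=> t; exact: cabs_indic.
- apply: (torus_aeS (ae_coord_itv i)) => t /andP[t0 t1]; rewrite E inE'.
  have pi0 := pi_gt0 R.
  have s1 : 0 < sin (pi * tnth t i).
    by apply: sin_gt0_pi; rewrite mulr_gt0//= -[ltRHS]mulr1 ltr_pM2l.
  rewrite /u pmulr_rgt0//; have [ta|ta] := ltP (tnth t i) a.
    rewrite sin_gt0_pi// mulr_gt0 ?subr_gt0//=.
    by rewrite -[ltRHS]mulr1 ltr_pM2l//; lra.
  rewrite -[a - _]opprB mulrN sinN oppr_gt0 ltNge sin_ge0_pi//.
  apply/andP; split; first by rewrite mulr_ge0 ?subr_ge0// ltW.
  by rewrite -[leRHS]mulr1 ler_pM2l//; lra.
Qed.

Definition multiplier_set A := measurable A /\ multiplier (fun t => (\1_A t : R)%:C).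

Lemma multiplier_setC A : multiplier_set A -> multiplier_set (~` A).
Proof.
move=> [mA MA]; split; first exact: measurableC.
rewrite (_ : (fun t => _) = (fun t => (1 : R)%:C + (-1)%:C * (\1_A t : R)%:C)).
  by do ?[apply: multiplierM|apply: multiplierD|exact: multiplier_cst|exact: MA].
apply/funext => t; rewrite -rmorphM -rmorphD mulN1r !indicE in_setC.
by case: (t \in A); rewrite /= ?subrr ?subr0.
Qed.

Lemma multiplier_setI A (B : set T) :
  multiplier_set A -> multiplier_set B -> multiplier_set (A `&` B).
Proof.
move=> [mA MA] [mB MB]; split; first exact: measurableI.
rewrite (_ : (fun t => _) = (fun t => (\1_A t : R)%:C * (\1_B t : R)%:C)).
  exact: multiplierM.
apply/funext => t; rewrite -rmorphM !indicE in_setI.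
by case: (t \in A); rewrite /= ?mul1r ?mul0r.
Qed.

Lemma multiplier_set0 : multiplier_set set0.
Proof.
split=> //; rewrite (_ : (fun t => _) = (fun=> 0)); first exact: multiplier_cst.
by apply/funext => t; rewrite indic0.
Qed.

Lemma multiplier_setU A (B : set T) :
  multiplier_set A -> multiplier_set B -> multiplier_set (A `|` B).
Proof.
by move=> HA HB; rewrite -[_ `|` _]setCK setCU; apply: multiplier_setC;
  apply: multiplier_setI; exact: multiplier_setC.
Qed.

Lemma multiplier_set_bigcup (F : nat -> set T) :
  (forall n, multiplier_set (F n)) -> multiplier_set (\bigcup_n F n).
Proof.
move=> H; have mU : measurable (\bigcup_n F n).
  by apply: bigcupT_measurable => n; have [] := H n.
split => //; pose G n := \big[setU/set0]_(i < n) F i.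
have HG n : multiplier_set (G n).
  rewrite /G; elim/big_ind : _ => // [|A B]; first exact: multiplier_set0.
  exact: multiplier_setU.
apply: (@multiplier_lim _ _ (fun n t => (\1_(G n) t : R)%:C) _ 1).
- by move=> n; have [] := HG n.
- exact: cmeasurable_indic.
- by move=> n t; exact: cabs_indic.
- by move=> t; exact: cabs_indic.
- apply: aeW => t; apply: cvg_near_cst.
  have E n : (\1_(G n) t : R) = \1_(\bigcup_n F n) t ->
      cabs ((\1_(G n) t : R)%:C - (\1_(\bigcup_n F n) t : R)%:C) = 0.
    by move=> ->; rewrite subrr Normc.normc0.
  have [[k _ Fk]|nF] := pselect ((\bigcup_n F n) t).
    exists k.+1 => // n /= kn; apply: E; rewrite !indicE !mem_set//.
    + by exists k.
    + by rewrite /G -bigcup_mkord; exists k.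
  apply: nearW => n; apply: E; rewrite !indicE !memNset//.
  by rewrite /G -bigcup_mkord => -[k _ Fk]; apply: nF; exists k.
Qed.

(** Multiplier sets form a sigma-algebra. The product sigma-algebra is generated by preimages under
    coordinates, and the Borel sets of the line by the half-lines ]-oo, a[, so two successive
    generation arguments reduce the claim to coordinate half-spaces. *)
Lemma multiplier_set_measurable A : measurable A -> multiplier_set A.
Proof.
have sa : sigma_algebra setT multiplier_set.
  split; [exact: multiplier_set0| |exact: multiplier_set_bigcup].
  by move=> B HB; rewrite setTD; exact: multiplier_setC.
apply: smallest_sub => // X.
rewrite -bigcup_seq => -[i _ [B mB <-]].
rewrite setTI.
have sb : sigma_algebra setT [set C : set borelR | multiplier_set ((@tnth d borelR)^~ i @^-1` C)].
  split => /=.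
  - by rewrite preimage_set0; exact: multiplier_set0.
  - by move=> C HC; rewrite setTD preimage_setC; exact: multiplier_setC.
  - by move=> F HF; rewrite preimage_bigcup; exact: multiplier_set_bigcup.
move: B mB; rewrite RGenInftyO.measurableE; apply: smallest_sub => // C [a ->] /=.
rewrite (_ : _ @^-1` _ = [set t : T | tnth t i < a]); last first.
  by apply/seteqP; split => t /=; rewrite in_itv.
split; last exact: multiplier_coord_lt.
have := measurable_tnth (T := borelR) i measurableT (measurable_itv `]-oo, a[).
by rewrite setTI; congr measurable; apply/seteqP; split => t /=; rewrite in_itv.
Qed.

(** Multiplying g by the indicator of A keeps its coefficients zero, and the coefficient at k = 0 is
    then the integral of g over A. A function whose integral over every measurable set vanishes is
    null. *)
Lemma null_coefficients_ae g : cintegrable P g -> null_coefficients g ->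
  {ae P, forall t, g t = 0}.
Proof.
move=> gi g0; have [g1 g2] := gi.
have H A : measurable A -> cint P (fun t => g t * (\1_A t : R)%:C) = 0.
  move=> /multiplier_set_measurable[_ [_ _ /(_ _ gi g0 0)]]; apply: etrans.
  by congr (cint P _); apply/funext => t; rewrite torus_char0 mulr1.
have S (w : T -> R) : P.-integrable setT (EFin \o w) ->
    (forall A, measurable A -> \int[P]_t (w t * \1_A t) = 0) ->
    {ae P, forall t, w t = 0}.
  move=> wi hw; have : ae_eq P setT (EFin \o w) (cst 0%E).
    apply: integral_ae_eq => // A _ mA; rewrite integral0.
    have wiA : P.-integrable A (EFin \o w) by exact: integrableS wi.
    have fA := integrable_fin_num mA wiA.
    rewrite -(fineK fA); congr (_%:E).
    rewrite -[RHS](hw A mA) /Rintegral; congr fine.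
    rewrite integral_mkcond; apply: eq_integral => t _ /=.
    by rewrite patchE indicE; case: ifP; rewrite ?mulr1 ?mulr0.
  by move=> h; apply: (torus_aeS h) => t /(_ I) [].
have r1 : {ae P, forall t, complex.Re (g t) = 0}.
  apply: S => // A /H [+ _]; apply: etrans; apply: eq_Rintegral => t _.
  by rewrite ReM /= mulr0 subr0.
have r2 : {ae P, forall t, complex.Im (g t) = 0}.
  apply: S => // A /H [_]; apply: etrans; apply: eq_Rintegral => t _.
  by rewrite ImM /= mulr0 add0r.
apply: (torus_aeS (filterI r1 r2)) => t [].
by case: (g t) => a b /= -> ->.
Qed.

End Uniqueness.

(** * Almost everywhere limits of rapidly converging sequences in L_1 *)

Section FastLimit.
Context d (T : measurableType d) (R : realType) (mu : probability T R).
Local Open Scope complex_scope.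
Implicit Types (f h : T -> R[i]).

Lemma ReB (z z' : R[i]) : complex.Re (z - z') = complex.Re z - complex.Re z'.
Proof. by case: z z' => a b [a' b']. Qed.

Lemma ImB (z z' : R[i]) : complex.Im (z - z') = complex.Im z - complex.Im z'.
Proof. by case: z z' => a b [a' b']. Qed.

Lemma cabs_telescope (u : nat -> R[i]) (n m : nat) : (n <= m)%N ->
  cabs (u n - u m) <= \sum_(n <= i < m) cabs (u i.+1 - u i).
Proof.
elim: m => [|m IH].
  by rewrite leqn0 => /eqP ->; rewrite subrr Normc.normc0 big_geq.
rewrite leq_eqVlt => /predU1P[->|nm].
  by rewrite subrr Normc.normc0 big_geq.
rewrite big_nat_recr//= -[u n - u m.+1](subrKA (u m)).
by rewrite (le_trans (cabsD _ _))// lerD ?IH// -normcN opprB.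
Qed.

Lemma cvg_abs_series (u : nat -> R) (B : R) :
  (forall n, \sum_(0 <= i < n) `|u i.+1 - u i| <= B) -> cvgn u.
Proof.
move=> uB; pose v i := u i.+1 - u i.
have cv : cvgn (series v).
  apply: (@normed_cvg R R^o); apply: nondecreasing_is_cvgn.
    by apply/nondecreasing_seqP => n; rewrite [leRHS]seriesSr lerDl; exact: normr_ge0.
  by exists B => _ [n _ <-]; exact: uB.
rewrite (_ : u = (fun n => u 0%N + series v n)); first exact: is_cvgD (is_cvg_cst _) cv.
by apply/funext => n; rewrite /series /= telescope_sumr// addrC subrK.
Qed.

(** By monotone convergence the series G of the moduli of the increments has integral at most 2 C.
    Wherever G is finite the sequence converges, and the tail of the series, hence G, bounds its
    distance to the limit for all n at once. *)
Lemma fast_limit (f_ : nat -> T -> R[i]) (C : R) :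
  (forall n, cintegrable mu (f_ n)) ->
  (forall n, \int[mu]_x cabs (f_ n.+1 x - f_ n x) <= C * 2 ^- n) ->
  exists h G, [/\ cmeasurable h, mu.-integrable setT G,
    {ae mu, forall x n, ((cabs (f_ n x - h x))%:E <= G x)%E} &
    {ae mu, forall x, cabs (f_ n x - h x) @[n --> \oo] --> 0}].
Proof.
move=> fi fC; pose D n x := cabs (f_ n.+1 x - f_ n x).
have Di n : mu.-integrable setT (EFin \o D n).
  exact: cintegrable_cabs (cintegrableB (fi _) (fi _)).
have D0 n x : (0 <= (D n x)%:E)%E by rewrite lee_fin cabs_ge0.
have mD n : measurable_fun setT (EFin \o D n) by exact: measurable_int (Di n).
pose G x := (\sum_(0 <= n <oo) (D n x)%:E)%E.
have G0 x : (0 <= G x)%E by apply: nneseries_ge0.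
have C0 : 0 <= C.
  have := fC 0%N; rewrite expr0 invr1 mulr1; apply: le_trans.
  by apply: Rintegral_ge0 => x _; exact: cabs_ge0.
have geo n : \sum_(0 <= i < n) (2 ^- i : R) <= 2 - 2 ^- n * 2.
  elim: n => [|n IH]; first by rewrite big_geq// expr0 invr1 mul1r subrr.
  rewrite big_nat_recr//= (le_trans (lerD IH (lexx _)))// exprS invfM.
  have : 0 <= (2 ^+ n)^-1 :> R by rewrite invr_ge0 exprn_ge0.
  lra.
have Gi : mu.-integrable setT G.
  apply/integrableP; split; first by apply: ge0_emeasurable_sum => n *; [exact: D0|exact: mD].
  under eq_integral do rewrite gee0_abs//.
  rewrite integral_nneseries//.
  apply: (@le_lt_trans _ _ (C * 2)%:E); last exact: ltry.
  apply: lime_le; first by apply: is_cvg_nneseries => n _ _; exact: integral_ge0.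
  apply: nearW => n.
  apply: (@le_trans _ _ (\sum_(0 <= i < n) (C * 2 ^- i)%:E)%E).
    apply: lee_sum => i _; rewrite -[leLHS]fineK; last exact: integrable_fin_num (Di i).
    by rewrite lee_fin; exact: fC.
  rewrite sumEFin lee_fin -mulr_sumr ler_wpM2l// (le_trans (geo n))//.
  by rewrite gerBl mulr_ge0// invr_ge0 exprn_ge0.
have Gsum x n m : G x \is a fin_num -> \sum_(n <= i < m) D i x <= fine (G x).
  move=> Gx; rewrite -lee_fin fineK// -sumEFin.
  apply: (@le_trans _ _ (\sum_(0 <= i < m) (D i x)%:E)%E); last first.
    by apply: nneseries_lim_ge => i _ _; exact: D0.
  have [nm|mn] := leqP n m; last first.
    have -> : (\sum_(n <= i < m) (D i x)%:E)%E = 0%E by rewrite big_geq ?(ltnW mn).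
    by apply: sume_ge0 => i _; exact: D0.
  have -> : (\sum_(0 <= i < m) (D i x)%:E = \sum_(0 <= i < n) (D i x)%:E +
     \sum_(n <= i < m) (D i x)%:E)%E by rewrite -big_cat_nat.
  by apply: leeDr; apply: sume_ge0 => i _; exact: D0.
(* Upper limits make h measurable everywhere; the values where G is infinite are irrelevant. *)
pose h x : R[i] := fine (limn_esup (fun n => (complex.Re (f_ n x))%:E)) +i*
                   fine (limn_esup (fun n => (complex.Im (f_ n x))%:E)).
have mh : cmeasurable h.
  split; apply: measurableT_comp => //; apply: measurable_fun_limn_esup => n;
  by apply/measurable_EFinP; have [] := cintegrable_meas (fi n).
have hc x : G x \is a fin_num -> cabs (f_ n x - h x) @[n --> \oo] --> 0.
  move=> Gx.
  have lim (w : R[i] -> R) : (forall z z', `|w z - w z'| <= cabs (z - z')) ->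
      w (f_ n x) @[n --> \oo] --> fine (limn_esup (fun n => (w (f_ n x))%:E)).
    move=> wle.
    have cw : cvgn (fun n => w (f_ n x)).
      apply: (@cvg_abs_series _ (fine (G x))) => n.
      by rewrite (le_trans _ (Gsum x 0%N n Gx))//; apply: ler_sum => i _; exact: wle.
    rewrite is_cvg_limn_esupE; last first.
      by apply/cvg_ex; exists (limn (fun n => w (f_ n x)))%:E; apply: cvg_EFin; [exact: nearW|exact: cw].
    by rewrite EFin_lim.
  apply: (@squeeze_cvgr _ _ _ _ (fun=> 0) (fun n =>
      `|complex.Re (f_ n x) - complex.Re (h x)| +
      `|complex.Im (f_ n x) - complex.Im (h x)|)).
  - apply: nearW => n; rewrite cabs_ge0 -ReB -ImB.
    exact: cabs_le_ReIm.
  - exact: cvg_cst.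
  - rewrite -[X in _ --> X](addr0 0) -{1}(@normr0 _ R) -{2}(@normr0 _ R).
    rewrite -{1}(subrr (complex.Re (h x))) -(subrr (complex.Im (h x))).
    apply: cvgD; apply: cvg_norm; apply: cvgB (cvg_cst _).
      by apply: lim => z z'; rewrite -ReB Re_le_cabs.
    by apply: lim => z z'; rewrite -ImB Im_le_cabs.
have Gae : {ae mu, forall x, G x \is a fin_num}.
  by have := integrable_ae measurableT Gi; apply: filterS => x /(_ I).
exists h, G; split => //; apply: filterS Gae => x Gx; last exact: hc.
(* The bound for h is the limit of telescoped bounds: [f_ n] and [f_ m] differ by at most G x for
   every m >= n, and [f_ m x] is within e of h x for m large. *)
move=> n; rewrite -(fineK Gx) lee_fin; apply/ler_addgt0Pr => e e0.
have /cvgr0Pnorm_lt /(_ e e0)[N _ HN] := hc x Gx.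
pose m := maxn n N.
rewrite -[f_ n x - h x](subrKA (f_ m x)) (le_trans (cabsD _ _))// lerD//.
  rewrite (le_trans (@cabs_telescope (f_^~ x) n m (leq_maxl _ _)))//.
  exact: Gsum.
by rewrite ltW// (le_lt_trans (ler_norm _))// HN//= leq_maxr.
Qed.

End FastLimit.

Section RealIntegrable.
Context d (T : measurableType d) (R : realType) (mu : {measure set T -> \bar R}).
Implicit Types f g : T -> R.

Lemma integrableD_EFin f g :
  mu.-integrable setT (EFin \o f) -> mu.-integrable setT (EFin \o g) ->
  mu.-integrable setT (EFin \o (fun x => f x + g x)).
Proof. by move=> fi gi; exact: (integrableD measurableT fi gi). Qed.

Lemma integrableZ_EFin (k : R) f : mu.-integrable setT (EFin \o f) ->
  mu.-integrable setT (EFin \o (fun x => k * f x)).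
Proof. by move=> fi; exact: (integrableZl measurableT k fi). Qed.

End RealIntegrable.

Section FiniteSums.
Context {R : realType} {K : choiceType}.
Implicit Types (a : K -> R) (s r : seq K).

Lemma sum_le_esum a s : (forall k, 0 <= a k) -> uniq s ->
  ((\sum_(k <- s) a k)%:E <= \esum_(k in setT) (a k)%:E)%E.
Proof.
move=> a0 us; apply: esum_ge; exists [set` s]; first by split.
by rewrite -fsbig_seq// sumEFin.
Qed.

Lemma esum_le_sum a (D : set K) (B : \bar R) :
  (forall s, uniq s -> (forall k, k \in s -> D k) ->
    ((\sum_(k <- s) a k)%:E <= B)%E) ->
  (\esum_(k in D) (a k)%:E <= B)%E.
Proof.
move=> aB; apply: ge_ereal_sup => _ [A [fA AD] <-].
rewrite fsbig_finite// sumEFin; apply: aB; first exact: finmap.fset_uniq.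
by move=> k; rewrite in_fset_set// inE; exact: AD.
Qed.

(** A finite set whose sum is within e of the supremum leaves at most e to any finite set disjoint
    from it. *)
Lemma esum_tail a (e : R) : (forall k, 0 <= a k) ->
  (\esum_(k in setT) (a k)%:E < +oo)%E -> 0 < e ->
  exists2 r, uniq r & forall s, uniq s -> (forall k, k \in s -> k \notin r) ->
    \sum_(k <- s) a k <= e.
Proof.
move=> a0 afin e0.
have S0 : (0 <= \esum_(k in setT) (a k)%:E)%E by apply: esum_ge0 => k _; rewrite lee_fin.
have Sfin : \esum_(k in setT) (a k)%:E \is a fin_num by rewrite ge0_fin_numE.
have [_ [A [fA _] <-] hA] := ub_ereal_sup_adherent e0 Sfin.
exists (finmap.enum_fset (fset_set A)); first exact: finmap.fset_uniq.
move=> s us sA; set r := finmap.enum_fset (fset_set A) in sA.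
have h1 : ((\sum_(k <- r ++ s) a k)%:E <= \esum_(k in setT) (a k)%:E)%E.
  apply: sum_le_esum => //.
  by rewrite cat_uniq finmap.fset_uniq us andbT/=; apply/hasPn => k /sA.
move: hA; rewrite -/(esum _ _) fsbig_finite// sumEFin => hA.
move: h1 hA; rewrite -(fineK Sfin) big_cat /= -EFinB lee_fin lte_fin.
by rewrite -/r; lra.
Qed.

End FiniteSums.

(** * Trigonometric polynomials, Parseval and partial Fourier sums *)

Section TrigPolynomials.
Context {R : realType} {d : nat}.
Local Open Scope complex_scope.
Local Notation borelR := (measurableTypeR R).
Local Notation P := (@torus_measure R d).
Implicit Types (c : 'cV[int]_d -> R[i]) (s : seq 'cV[int]_d).

Lemma conjcM (x y : R[i]) : conjc (x * y) = conjc x * conjc y.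
Proof. exact: rmorphM. Qed.

Definition trig_sum s c (x : 'cV[R]_d) : R[i] := \sum_(k <- s) c k * torus_char k x.

Lemma trig_sum_integrable s c : torus_integrable (trig_sum s c).
Proof.
by apply: cintegrable_sum => k _; apply: cintegrableZ; exact: torus_char_integrable.
Qed.

Lemma cabs_trig_sum s c x : cabs (trig_sum s c x) <= \sum_(k <- s) cabs (c k).
Proof.
rewrite (le_trans (cabs_sum _ _ _))//; apply: ler_sum => k _.
by rewrite Normc.normcM cabs_torus_char mulr1.
Qed.

Lemma fourier_trig_sum s c k : uniq s ->
  fourier (trig_sum s c) k = if k \in s then c k else 0.
Proof.
move=> us; rewrite fourier_sum; last first.
  by move=> l; apply: cintegrableZ; exact: torus_char_integrable.
rewrite (eq_bigr (fun l => c l * (l == k)%:R)); last first.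
  by move=> l _; rewrite fourierZ ?fourier_char//; exact: torus_char_integrable.
case: ifPn => ks.
  rewrite (bigD1_seq k)//= eqxx mulr1 big1 ?addr0// => l /negbTE lk.
  by rewrite lk mulr0.
rewrite big_seq big1// => l ls; case: eqP => [lk|_]; last by rewrite mulr0.
by rewrite -lk ls in ks.
Qed.

Lemma parseval_trig_sum s c : uniq s ->
  \int[P]_t (cabs (trig_sum s c (vec_of_tuple t)) ^+ 2) =
  \sum_(k <- s) cabs (c k) ^+ 2.
Proof.
move=> us.
have Fi := trig_sum_integrable s c.
pose F t := trig_sum s c (vec_of_tuple t).
have E : cint P (fun t => F t * conjc (F t)) = (\sum_(k <- s) cabs (c k) ^+ 2)%:C.
  transitivity (cint P (fun t => \sum_(k <- s)
      conjc (c k) * (F t * torus_char (- k) (vec_of_tuple t)))).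
    congr (cint P _); apply/funext => t.
    have -> : conjc (F t) = \sum_(k <- s) conjc (c k * torus_char k (vec_of_tuple t)).
      exact: rmorph_sum.
    rewrite mulr_sumr; apply: eq_bigr => k _.
    by rewrite conjcM -torus_charN mulrCA.
  rewrite cint_sum; last first.
    by move=> k _; apply: cintegrableZ; exact: fourier_integrable Fi.
  rewrite rmorph_sum big_seq [RHS]big_seq; apply: eq_bigr => k ks.
  rewrite (cintZ _ (fourier_integrable k Fi)) [cint _ _](fourier_trig_sum c k us) ks.
  by rewrite mulrC mulc_conj.
have := congr1 (@complex.Re R) E; rewrite /=; apply: etrans.
by apply: eq_Rintegral => t _; rewrite mulc_conj.
Qed.

(** The index sets [r n] leave a square-summable tail of at most 4^-n, so consecutive partial sums
    are of order 2^-n apart in L_1 and [fast_limit] yields a limit h. Its coefficients are those of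
    f, so uniqueness identifies it with f almost everywhere. *)
Lemma trig_partial_sums (f : 'cV[R]_d -> R[i]) : torus_integrable f ->
  (\esum_(k in setT) (cabs (fourier f k) ^+ 2)%:E < +oo)%E ->
  exists2 r : nat -> seq 'cV[int]_d, (forall n, uniq (r n)) &
    {ae P, forall t, cabs (trig_sum (r n) (fourier f) (vec_of_tuple t) -
                           f (vec_of_tuple t)) @[n --> \oo] --> 0}.
Proof.
move=> fi f2; pose c := fourier f.
have c0 k : 0 <= cabs (c k) ^+ 2 by rewrite sqr_ge0.
have q0 n : 0 < (4 ^+ n)^-1 :> R by rewrite invr_gt0 exprn_gt0.
have /choice[r hr] n : exists r, uniq r /\ forall s, uniq s ->
    (forall k, k \in s -> k \notin r) -> \sum_(k <- s) cabs (c k) ^+ 2 <= (4 ^+ n)^-1.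
  by have [r ur hr] := esum_tail c0 f2 (q0 n); exists r.
have ur n : uniq (r n) by have [] := hr n.
exists r => //.
pose S n x := trig_sum (r n) c x.
have Si n : torus_integrable (S n) by exact: trig_sum_integrable.
have Dle n : \int[P]_t cabs (S n.+1 (vec_of_tuple t) - S n (vec_of_tuple t)) <= 3 * 2 ^- n.
  pose s1 := [seq k <- r n.+1 | k \notin r n].
  pose s2 := [seq k <- r n | k \notin r n.+1].
  have u1 : uniq s1 by rewrite filter_uniq.
  have u2 : uniq s2 by rewrite filter_uniq.
  (* The sets [r n] need not be nested. The common frequencies cancel, and what remains are two
     polynomials with frequencies outside [r n] and outside [r n.+1]. *)
  have DE x : S n.+1 x - S n x = trig_sum s1 c x - trig_sum s2 c x.
    have E (u v : seq 'cV[int]_d) : trig_sum u c x = trig_sum [seq k <- u | k \in v] c x +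
        trig_sum [seq k <- u | k \notin v] c x.
      by rewrite /trig_sum 2!big_filter [LHS](bigID (mem v)).
    rewrite /S (E (r n.+1) (r n)) (E (r n) (r n.+1)) opprD addrACA -/s1 -/s2.
    have -> : trig_sum [seq k <- r n.+1 | k \in r n] c x =
        trig_sum [seq k <- r n | k \in r n.+1] c x; last by rewrite subrr add0r.
    apply: perm_big.
    apply: uniq_perm; rewrite ?filter_uniq// => k.
    by rewrite !mem_filter andbC.
  have b1 : \int[P]_t (cabs (trig_sum s1 c (vec_of_tuple t)) ^+ 2) <= (4 ^+ n)^-1.
    rewrite parseval_trig_sum//; have [_] := hr n; apply => // k.
    by rewrite mem_filter => /andP[].
  have b2 : \int[P]_t (cabs (trig_sum s2 c (vec_of_tuple t)) ^+ 2) <= (4 ^+ n)^-1.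
    rewrite parseval_trig_sum//; apply: (@le_trans _ _ (4 ^+ n.+1)^-1).
      have [_] := hr n.+1; apply => // k.
      by rewrite mem_filter => /andP[].
    by rewrite lef_pV2 ?posrE ?exprn_gt0// ler_eXn2l// ltr1n.
  have sqi s : P.-integrable setT
      (EFin \o (fun t => cabs (trig_sum s c (vec_of_tuple t)) ^+ 2)).
    have mF := measurable_cabs (cintegrable_meas (trig_sum_integrable s c)).
    apply: (le_integrable measurableT _ _
      (finite_measure_integrable_cst P ((\sum_(k <- s) cabs (c k)) ^+ 2) measurableT)).
      by apply/measurable_EFinP; exact: measurable_funX.
    move=> t _ /=; rewrite lee_fin !ger0_norm ?sqr_ge0//.
    by rewrite lerXn2r ?nnegrE ?cabs_ge0 ?cabs_trig_sum// sumr_ge0// => k _; exact: cabs_ge0.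
  have w0 : 0 < 2 ^+ n :> R by rewrite exprn_gt0.
  (* Expanding (u - B/2)^2 + (v - B/2)^2 >= 0 with B = 2^-n gives u + v <= 2^n (u^2 + v^2) + B/2.
     This turns the mean-square bounds 4^-n into the L_1 bound 2 * 2^-n + 2^-n. *)
  apply: (@le_trans _ _ (\int[P]_t (2 ^+ n * (cabs (trig_sum s1 c (vec_of_tuple t)) ^+ 2 +
      cabs (trig_sum s2 c (vec_of_tuple t)) ^+ 2) + 2 ^- n))).
    apply: le_Rintegral => //.
    - exact: cintegrable_cabs (cintegrableB (Si _) (Si _)).
    - apply: integrableD_EFin; last exact: finite_measure_integrable_cst.
      by apply: integrableZ_EFin; exact: integrableD_EFin.
    - move=> t _; rewrite DE (le_trans (cabsB _ _))//.
      set u := cabs _; set v := cabs _.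
      have e1 : 2 ^- n = (2 ^+ n)^-1 * ((2 ^+ n)^-1 * 2 ^+ n) :> R.
        by rewrite mulVf ?gt_eqF// mulr1.
      have : 0 <= 2 ^+ n * ((u - (2 ^+ n)^-1 / 2) ^+ 2 + (v - (2 ^+ n)^-1 / 2) ^+ 2).
        by apply: mulr_ge0; [exact: ltW|apply: addr_ge0; exact: sqr_ge0].
      have e2 : 2 ^+ n * (2 ^+ n)^-1 = 1 :> R by rewrite divff ?gt_eqF.
      have e3 : 0 < (2 ^+ n)^-1 :> R by rewrite invr_gt0.
      move: e2 e3; set A := 2 ^+ n; set B := A^-1 => e2 e3.
      have -> : A * ((u - B / 2) ^+ 2 + (v - B / 2) ^+ 2) =
         A * (u ^+ 2 + v ^+ 2) - (A * B) * (u + v) + (A * B) * B / 2 by field.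
      rewrite e2; lra.
  rewrite RintegralD//; last 2 first.
  - by apply: integrableZ_EFin; exact: integrableD_EFin.
  - exact: finite_measure_integrable_cst.
  rewrite RintegralZl//; last exact: integrableD_EFin.
  rewrite RintegralD// Rintegral_cst//= probability_setT /= mulr1.
  have : 2 ^+ n * (4 ^+ n)^-1 = 2 ^- n :> R.
    have -> : (4 : R) = 2 * 2 by ring.
    by rewrite exprMn invfM mulrA divff ?mul1r ?gt_eqF.
  move: b1 b2; set i1 := Rintegral _ _ _; set i2 := Rintegral _ _ _ => b1 b2 e.
  have : 2 ^+ n * (i1 + i2) <= 2 ^+ n * ((4 ^+ n)^-1 + (4 ^+ n)^-1).
    by rewrite ler_pM2l// lerD.
  rewrite mulrDr [leRHS]mulrDr e; lra.
have [h [G [mh Gi hG hc]]] := fast_limit Si Dle.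
have key k : cintegrable P h /\ cint P (fun t => h t * torus_char (- k) (vec_of_tuple t)) = c k.
  have mch := char_cmeasurable (R := R) (- k).
  have [hi hlim] := cint_dominated Si mh Gi hG hc; split => //.
  have [|||||] := @cint_dominated _ _ _ P
    (fun n t => S n (vec_of_tuple t) * torus_char (- k) (vec_of_tuple t))
    (fun t => h t * torus_char (- k) (vec_of_tuple t)) G.
  - by move=> n; exact: fourier_integrable (Si n).
  - exact: cmeasurableM.
  - exact: Gi.
  - apply: filterS hG => t + n => /(_ n).
    by rewrite -mulrBl Normc.normcM cabs_torus_char mulr1.
  - apply: filterS hc => t ht.
    rewrite (_ : (fun n => _) = (fun n => cabs (S n (vec_of_tuple t) - h t)))//.
    by apply/funext => n; rewrite -mulrBl Normc.normcM cabs_torus_char mulr1.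
  set I := cint P (fun t => h t * _) => _ cI.
  have cc : cabs (fourier (S n) k - c k) @[n --> \oo] --> 0.
    (* Either k belongs to [r n] and the difference vanishes, or the singleton of k is disjoint from
       [r n] and the tail bound gives |c k|^2 <= 4^-n. *)
    have s2 n : cabs (fourier (S n) k - c k) <= 2 ^- n.
      rewrite -(@ler_pXn2r _ 2) ?nnegrE ?cabs_ge0 ?invr_ge0 ?exprn_ge0//.
      rewrite -exprVn -exprM mulnC exprM (_ : (2^-1) ^+ 2 = 4^-1 :> R); last by field.
      rewrite exprVn fourier_trig_sum//; case: ifPn => kr.
        by rewrite subrr Normc.normc0 expr0n invr_ge0 exprn_ge0.
      rewrite sub0r normcN; have [_ /(_ [:: k])] := hr n.
      by rewrite big_seq1; apply => // l; rewrite inE => /eqP ->.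
    apply: (@squeeze_cvgr _ _ _ _ (fun=> 0) (fun n => (2^-1) ^+ n)).
    - by apply: nearW => n; rewrite cabs_ge0 exprVn s2.
    - exact: cvg_cst.
    - by apply: cvg_expr; rewrite ger0_norm ?invr_ge0//; lra.
  have : cabs (I - c k) <= 0.
    apply/ler_addgt0Pr => e e0; rewrite add0r.
    have e20 : 0 < e / 2 by rewrite divr_gt0.
    have /cvgr0Pnorm_lt /(_ _ e20)[N1 _ H1] := cI.
    have /cvgr0Pnorm_lt /(_ _ e20)[N2 _ H2] := cc.
    pose m := maxn N1 N2.
    have h1 : cabs (fourier (S m) k - I) < e / 2.
      by rewrite -[ltLHS]ger0_norm ?cabs_ge0//; exact: H1 m (leq_maxl _ _).
    have h2 : cabs (fourier (S m) k - c k) < e / 2.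
      by rewrite -[ltLHS]ger0_norm ?cabs_ge0//; exact: H2 m (leq_maxr _ _).
    have -> : I - c k = (I - fourier (S m) k) + (fourier (S m) k - c k).
      by rewrite addrA subrK.
    rewrite (le_trans (cabsD _ _))//.
    rewrite [e]splitr lerD ?ltW// -normcN opprB//.
  rewrite le_eqVlt ltNge cabs_ge0 orbF cabs0_eq subr_eq0 => /eqP //.
have hi : cintegrable P h by have [] := key 0.
have hf : {ae P, forall t, h t - f (vec_of_tuple t) = 0}.
  apply: null_coefficients_ae; first exact: cintegrableB.
  move=> k; have [_] := key (- k); rewrite opprK => hk.
  transitivity (cint P (fun t => h t * torus_char k (vec_of_tuple t) -
      f (vec_of_tuple t) * torus_char k (vec_of_tuple t))).
    by congr (cint P _); apply/funext => t; rewrite mulrBl.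
  rewrite cintB ?hk; [|exact: cintegrable_mul_char..].
  rewrite /c /fourier /torus_integral /cint opprK -/(cint _ _) subrr//.
apply: (torus_aeS (filterI hc hf)) => t [ht /eqP].
by rewrite subr_eq0 => /eqP <-.
Qed.

End TrigPolynomials.

(** * Scalar inequalities behind the interpolation for p > 2 *)

Section DyadicInterpolation.
Context {R : realType} (p q : R).
Hypotheses (p_gt2 : 2 < p) (pq : p^-1 + q^-1 = 1).
Local Notation two := (2 : R).

Lemma conjugate_expE : q = p / (p - 1).
Proof.
have p2 := p_gt2.
have : q^-1 = 1 - p^-1 by rewrite -pq addrAC subrr add0r.
have p0 : p != 0. by rewrite gt_eqF//; lra.
have -> : 1 - p^-1 = (p - 1) / p by field.
by move=> h; rewrite -[q]invrK h invf_div.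
Qed.

Lemma pow2D (x y : R) : two `^ (x + y) = two `^ x * two `^ y.
Proof. by rewrite powRD// pnatr_eq0 implybT. Qed.

Lemma pow2_gt0 (x : R) : 0 < two `^ x.
Proof. by rewrite powR_gt0. Qed.

(* Coefficients above the threshold contribute at most 2^(n-1), see
   sum_above_threshold. *)
Definition dyadic_threshold (n : nat) : R := two `^ (- ((n%:R - 1) * (p - 1))).

(** Normalised so that [dyadic_weight n] times (2^(n-1))^2 equals 2^((n+1)p), the largest p-th power
    on the dyadic level ]2^n, 2^(n+1)]. *)
Definition dyadic_weight (n : nat) : R := two `^ (p + 2) * two `^ (n%:R * (p - 2)).

Lemma threshold_gt0 n : 0 < dyadic_threshold n.
Proof. exact: pow2_gt0. Qed.

(** Above the threshold tau, u = u^(1-q) u^q <= tau^(1-q) u^q because 1 - q = -1/(p - 1) is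
    negative; the threshold is the solution of tau^(1-q) = 2^(n-1). *)
Lemma sum_above_threshold (I : Type) (s : seq I) (u : I -> R) n :
  (forall i, 0 <= u i) -> \sum_(i <- s) u i `^ q <= 1 ->
  \sum_(i <- s | ~~ (u i <= dyadic_threshold n)) u i <= two `^ (n%:R - 1).
Proof.
have p2 := p_gt2.
move=> u0 u1; have p1 : 0 < p - 1 by lra.
have q1 : 1 - q = - (p - 1)^-1 by rewrite conjugate_expE; field; apply/eqP; lra.
have tE : dyadic_threshold n `^ (1 - q) = two `^ (n%:R - 1).
  by rewrite /dyadic_threshold -powRrM q1 mulrNN -mulrA divff ?mulr1// gt_eqF.
apply: (@le_trans _ _ (\sum_(i <- s | ~~ (u i <= dyadic_threshold n))
    two `^ (n%:R - 1) * u i `^ q)).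
  apply: ler_sum => i; rewrite -ltNge => ti.
  have ui : 0 < u i := lt_trans (threshold_gt0 n) ti.
  rewrite [leLHS](_ : _ = u i `^ (1 - q) * u i `^ q); last first.
    by rewrite -powRD ?subrK ?powRr1 ?ltW// gt_eqF// implybT.
  rewrite ler_wpM2r ?powR_ge0// -tE q1 !powRN lef_pV2 ?posrE ?powR_gt0 ?threshold_gt0//.
  by rewrite ge0_ler_powR ?nnegrE ?invr_ge0 ?ltW// ?threshold_gt0.
rewrite -mulr_sumr ler_piMr ?powR_ge0//; apply: le_trans u1.
rewrite [leRHS](bigID (fun i => ~~ (u i <= dyadic_threshold n)))/=.
by rewrite lerDl sumr_ge0// => i _; rewrite powR_ge0.
Qed.

(** With rho = 2^(p-2), this is the prefactor of the weights times rho * rho/(rho - 1): rho/(rho -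
    1) comes from the geometric sum, the other rho from the shift n - 1 in the threshold. The
    denominator vanishes at p = 2. *)
Definition dyadic_constant : R :=
  two `^ (p + 2) * (two `^ (p - 2) * (two `^ (p - 2) / (two `^ (p - 2) - 1))).

Lemma ratio_gt1 : 1 < two `^ (p - 2).
Proof.
have p2 := p_gt2.
rewrite /powR pnatr_eq0 /= -[ltLHS]expR0 ltr_expR.
by rewrite mulr_gt0 ?subr_gt0// ln_gt0// ltr1n.
Qed.

Lemma dyadic_constant_ge0 : 0 <= dyadic_constant.
Proof.
have := ratio_gt1 => h.
by rewrite /dyadic_constant !mulr_ge0 ?powR_ge0// invr_ge0 subr_ge0 ltW.
Qed.

(** Only the last counted level matters. If L is counted, all weights up to L have a geometric sum
    of the order of rho^L, and rho^L = rho * tau_L^(q-2) <= rho * u^(q-2), since u <= tau_L and q <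
    2. *)
Lemma sum_weights_below (u : R) (L : nat) : 0 < u ->
  \sum_(0 <= n < L) (if u <= dyadic_threshold n then dyadic_weight n else 0)
  <= dyadic_constant * u `^ (q - 2).
Proof.
have p2 := p_gt2.
move=> u0; have p1 : 0 < p - 1 by lra.
have r1 := ratio_gt1; set rho := two `^ (p - 2) in r1.
have rn n : two `^ (n%:R * (p - 2)) = rho ^+ n.
  by rewrite mulrC powRrM powR_mulrn// powR_ge0.
have geo n : \sum_(0 <= i < n) rho ^+ i <= rho ^+ n / (rho - 1).
  rewrite ler_pdivlMr ?subr_gt0//; elim: n => [|n IH].
    by rewrite big_geq// mul0r expr0.
  rewrite big_nat_recr//= mulrDl (le_trans (lerD IH (lexx _)))// exprS.
  by rewrite mulrBr mulr1 [rho * _]mulrC addrCA subrr addr0.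
elim: L => [|L IH]; first by rewrite big_geq// mulr_ge0 ?powR_ge0 ?dyadic_constant_ge0.
have [uL|uL] := leP u (dyadic_threshold L); last first.
  by rewrite big_nat_recr//= [u <= dyadic_threshold L]leNgt uL /= addr0.
apply: (@le_trans _ _ (\sum_(0 <= n < L.+1) dyadic_weight n)).
  by apply: ler_sum => n _; case: ifP => // _; rewrite mulr_ge0 ?powR_ge0.
rewrite /dyadic_weight; under eq_bigr do rewrite rn.
rewrite -mulr_sumr /dyadic_constant -/rho -mulrA ler_wpM2l ?powR_ge0//.
rewrite (le_trans (geo L.+1))// exprS.
have hL : rho ^+ L <= rho * u `^ (q - 2).
  have e : q - 2 = - ((p - 2) / (p - 1)).
    by rewrite conjugate_expE; field; apply/eqP; lra.
  have -> : rho ^+ L = rho * dyadic_threshold L `^ (q - 2).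
    rewrite -rn /dyadic_threshold -powRrM e /rho -pow2D; congr (_ `^ _).
    by field; apply/eqP; lra.
  rewrite ler_pM2l ?(lt_trans _ r1)// e !powRN lef_pV2 ?posrE ?powR_gt0 ?threshold_gt0//.
  rewrite ge0_ler_powR ?nnegrE ?divr_ge0 ?(ltW u0) ?(ltW (threshold_gt0 _)) ?(ltW p1)//; lra.
have -> : rho * (rho / (rho - 1)) * u `^ (q - 2) = rho / (rho - 1) * (rho * u `^ (q - 2)).
  ring.
rewrite mulrAC ler_wpM2l// divr_ge0; lra.
Qed.

Lemma sqr_sum_weights (u : R) (L : nat) : 0 <= u -> u <= 1 ->
  u ^+ 2 * (1 + \sum_(0 <= n < L)
    (if u <= dyadic_threshold n then dyadic_weight n else 0))
  <= (1 + dyadic_constant) * u `^ q.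
Proof.
have p2 := p_gt2.
move=> u0 u1; have q12 : 1 < q < 2.
  have p1 : 0 < p - 1 by lra.
  by rewrite conjugate_expE ltr_pdivlMr// ltr_pdivrMr//; apply/andP; split; lra.
have := u0; rewrite le_eqVlt => /predU1P[<-|ugt].
  by rewrite expr0n mul0r mulr_ge0 ?powR_ge0// addr_ge0 ?dyadic_constant_ge0.
rewrite mulrDr mulr1 mulrDl mul1r lerD//.
  rewrite -powR_mulrn//; apply: ger_powR; first by rewrite ugt.
  by case/andP: q12 => _ /ltW.
apply: (@le_trans _ _ (u ^+ 2 * (dyadic_constant * u `^ (q - 2)))).
  by rewrite ler_wpM2l ?sqr_ge0// sum_weights_below.
rewrite mulrCA -powR_mulrn// -powRD ?(gt_eqF ugt) ?implybT//.
by rewrite [2%:R + _]addrC subrK.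
Qed.

(** Here y is the modulus of a polynomial and [g n] that of its part with coefficients below the
    n-th threshold. If 2^n < y <= 2^(n+1), then [g n] >= y - 2^(n-1) >= 2^(n-1), so the n-th summand
    alone exceeds y^p. If y <= 1, then y^p <= y^2. *)
Lemma dyadic_pointwise (y : R) (g : nat -> R) (L : nat) : 0 <= y ->
  y <= two ^+ L -> (forall n, y - g n <= two `^ (n%:R - 1)) ->
  y `^ p <= y ^+ 2 + \sum_(0 <= n < L) dyadic_weight n * g n ^+ 2.
Proof.
have p2 := p_gt2.
move=> y0 yL hg; have p0 : 0 <= p by lra.
have W0 n : 0 <= dyadic_weight n * g n ^+ 2.
  by rewrite mulr_ge0 ?sqr_ge0// mulr_ge0 ?powR_ge0.
have S0 m : 0 <= \sum_(0 <= n < m) dyadic_weight n * g n ^+ 2.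
  by rewrite sumr_ge0.
elim: L yL => [|L IH] yL.
  rewrite big_geq// addr0; have := y0; rewrite le_eqVlt => /predU1P[<-|ygt].
    by rewrite expr0n powR0// gt_eqF//; lra.
  by rewrite -powR_mulrn//; apply: ger_powR; [rewrite ygt -[leRHS](expr0 2)|lra].
rewrite big_nat_recr//=; have [/IH|yL'] := leP y (two ^+ L).
  by move/le_trans; apply; rewrite lerD2l lerDl.
rewrite -[leLHS]add0r addrA lerD ?addr_ge0 ?sqr_ge0//.
have two_n : two ^+ L = two `^ (L%:R - 1) * 2.
  by rewrite -powR_mulrn// -{1}[L%:R](subrK 1) pow2D powRr1.
have gn : two `^ (L%:R - 1) <= g L.
  by have := hg L; move: yL'; rewrite two_n; lra.
apply: (@le_trans _ _ ((two ^+ L.+1) `^ p)).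
  by rewrite ge0_ler_powR ?nnegrE ?exprn_ge0.
have -> : (two ^+ L.+1) `^ p = dyadic_weight L * (two `^ (L%:R - 1)) ^+ 2.
  rewrite -powR_mulrn// -powRrM /dyadic_weight -[_ ^+ 2]powR_mulrn ?powR_ge0//.
  rewrite -powRrM -!pow2D; congr (_ `^ _); rewrite -natr1; ring.
rewrite ler_wpM2l ?mulr_ge0 ?powR_ge0// lerXn2r ?nnegrE ?powR_ge0//.
exact: le_trans (powR_ge0 _ _) gn.
Qed.

End DyadicInterpolation.

(** * The Hausdorff-Young inequality *)

Section HausdorffYoung.
Context {R : realType} {d : nat}.
Local Open Scope complex_scope.
Local Notation borelR := (measurableTypeR R).
Local Notation P := (@torus_measure R d).
Implicit Types (c : 'cV[int]_d -> R[i]) (s : seq 'cV[int]_d).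

Lemma integrable_sum_EFin (I : Type) (r : seq I) (h : I -> d.-tuple borelR -> R) :
  (forall i, P.-integrable setT (EFin \o h i)) ->
  P.-integrable setT (EFin \o (fun t => \sum_(i <- r) h i t)).
Proof.
move=> hi; elim: r => [|i r IH].
  rewrite (_ : _ \o _ = EFin \o cst 0).
    exact: (finite_measure_integrable_cst P 0 measurableT).
  by apply/funext => t /=; rewrite big_nil.
rewrite (_ : (fun t => _) = (fun t => h i t + \sum_(i <- r) h i t)).
  exact: integrableD_EFin.
by apply/funext => t; rewrite big_cons.
Qed.

Lemma Rintegral_sum (I : Type) (r : seq I) (h : I -> d.-tuple borelR -> R) :
  (forall i, P.-integrable setT (EFin \o h i)) ->
  \int[P]_t (\sum_(i <- r) h i t) = \sum_(i <- r) \int[P]_t h i t.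
Proof.
move=> hi; elim: r => [|i r IH].
  rewrite big_nil (@eq_Rintegral _ _ _ P setT (fun=> 0)); first by rewrite Rintegral_cst// mul0r.
  by move=> t _; rewrite big_nil.
rewrite big_cons -IH -RintegralD//; last exact: integrable_sum_EFin.
by apply: eq_Rintegral => t _; rewrite big_cons.
Qed.

Lemma integrable_trig_sum_bound s c (h : R -> R) (B : R) :
  measurable_fun setT h -> (forall y, 0 <= y <= \sum_(k <- s) cabs (c k) -> `|h y| <= B) ->
  P.-integrable setT (EFin \o (fun t => h (cabs (trig_sum s c (vec_of_tuple t))))).
Proof.
move=> mh hB.
have mF := measurable_cabs (cintegrable_meas (trig_sum_integrable s c)).
apply: (le_integrable measurableT _ _ (finite_measure_integrable_cst P B measurableT)).
  by apply/measurable_EFinP; exact: measurableT_comp mF.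
move=> t _ /=; rewrite lee_fin (le_trans _ (ler_norm _))// hB//.
by rewrite cabs_ge0 cabs_trig_sum.
Qed.

Lemma integrable_trig_sum_powR (p : R) s c : 0 <= p ->
  P.-integrable setT (EFin \o (fun t => cabs (trig_sum s c (vec_of_tuple t)) `^ p)).
Proof.
move=> p0; apply: (@integrable_trig_sum_bound s c (fun y => y `^ p)
    ((\sum_(k <- s) cabs (c k)) `^ p)); first exact: measurable_powR.
move=> y /andP[y0 yB]; rewrite ger0_norm ?powR_ge0//.
by rewrite ge0_ler_powR ?nnegrE// (le_trans y0).
Qed.

Lemma integrable_trig_sum_sqr s c :
  P.-integrable setT (EFin \o (fun t => cabs (trig_sum s c (vec_of_tuple t)) ^+ 2)).
Proof.
have := integrable_trig_sum_powR s c (ler0n _ 2).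
apply: eq_integrable => // t _ /=.
by rewrite powR_mulrn// cabs_ge0.
Qed.

(** After integrating the pointwise bound, Parseval turns each square into a sum over frequencies.
    Exchanging the sums over levels and frequencies leaves, for each k, the quantity bounded by
    [sqr_sum_weights]. *)
Lemma trig_sum_Lp_unit (p q : R) s c : 2 < p -> p^-1 + q^-1 = 1 -> uniq s ->
  \sum_(k <- s) cabs (c k) `^ q <= 1 ->
  \int[P]_t (cabs (trig_sum s c (vec_of_tuple t)) `^ p) <= 1 + dyadic_constant p.
Proof.
move=> p2 pq us c1; have p0 : 0 <= p by lra.
pose n := Num.bound (\sum_(k <- s) cabs (c k)).
have S2 : \sum_(k <- s) cabs (c k) <= 2 ^+ n.
  apply: (@le_trans _ _ n%:R); last by rewrite -natrX ler_nat ltnW// ltn_expl.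
  by apply/ltW/archi_boundP/sumr_ge0 => k _; exact: cabs_ge0.
pose sm i := [seq k <- s | cabs (c k) <= dyadic_threshold p i].
pose W (i : nat) := dyadic_weight p i.
apply: (@le_trans _ _ (\int[P]_t (cabs (trig_sum s c (vec_of_tuple t)) ^+ 2 +
   \sum_(0 <= i < n) W i * cabs (trig_sum (sm i) c (vec_of_tuple t)) ^+ 2))).
  apply: le_Rintegral => //.
  - exact: integrable_trig_sum_powR.
  - apply: integrableD_EFin; first exact: integrable_trig_sum_sqr.
    by apply: integrable_sum_EFin => i; apply: integrableZ_EFin; exact: integrable_trig_sum_sqr.
  - move=> t _; set x := vec_of_tuple t.
    apply: (dyadic_pointwise p2 (g := fun i => cabs (trig_sum (sm i) c x))).
    + exact: cabs_ge0.
    + by rewrite (le_trans (cabs_trig_sum _ _ _)).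
    + move=> i; rewrite lerBlDr.
      have -> : trig_sum s c x = trig_sum [seq k <- s | ~~ (cabs (c k) <= dyadic_threshold p i)] c x
          + trig_sum (sm i) c x.
        by rewrite /trig_sum 2!big_filter addrC [LHS](bigID (fun k => cabs (c k) <= dyadic_threshold p i)).
      rewrite (le_trans (cabsD _ _))// lerD2r (le_trans (cabs_trig_sum _ _ _))// big_filter.
      by apply: (sum_above_threshold p2 pq) => // k; exact: cabs_ge0.
rewrite RintegralD//; first last.
- by apply: integrable_sum_EFin => i; apply: integrableZ_EFin; exact: integrable_trig_sum_sqr.
- exact: integrable_trig_sum_sqr.
rewrite Rintegral_sum; last first.
  by move=> i; apply: integrableZ_EFin; exact: integrable_trig_sum_sqr.
rewrite parseval_trig_sum//.
have -> : \sum_(0 <= i < n) \int[P]_t (W i * cabs (trig_sum (sm i) c (vec_of_tuple t)) ^+ 2)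
   = \sum_(0 <= i < n) \sum_(k <- s) cabs (c k) ^+ 2 *
       (if cabs (c k) <= dyadic_threshold p i then W i else 0).
  apply: eq_bigr => i _; rewrite RintegralZl//; last exact: integrable_trig_sum_sqr.
  rewrite parseval_trig_sum ?filter_uniq// big_filter mulr_sumr big_mkcond.
  by apply: eq_bigr => k _; case: ifP; rewrite ?mulr0// mulrC.
rewrite exchange_big -big_split /=.
apply: (@le_trans _ _ (\sum_(k <- s) (1 + dyadic_constant p) * cabs (c k) `^ q)).
  rewrite big_seq [leRHS]big_seq; apply: ler_sum => k ks.
  rewrite -mulr_sumr -[X in X + _]mulr1 -mulrDr.
  apply: (sqr_sum_weights p2 pq); first exact: cabs_ge0.
  have ck1 : cabs (c k) `^ q <= 1.
    apply: le_trans c1; rewrite (bigD1_seq k)//= lerDl sumr_ge0// => l _.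
    exact: powR_ge0.
  rewrite leNgt; apply/negP => c_gt1; move: ck1; rewrite leNgt => /negP; apply.
  have q_gt0 : 0 < q.
    by rewrite (conjugate_expE p2 pq) divr_gt0; lra.
  have := gt0_ltr_powR q_gt0 (ler01 : 1 \in Num.nneg) (cabs_ge0 (c k) : _ \in Num.nneg) c_gt1.
  by rewrite powR1.
rewrite -mulr_sumr -[leRHS]mulr1 ler_wpM2l// addr_ge0// dyadic_constant_ge0//.
Qed.

(** Dividing the coefficients by A reduces p > 2 to the normalised case. At p = 2, where
    [dyadic_constant] degenerates, Parseval gives the bound with constant 1. *)
Lemma trig_sum_Lp (p q : R) : 2 <= p -> p^-1 + q^-1 = 1 -> exists2 K, 0 <= K &
  forall s c (A : R), uniq s -> 0 < A -> \sum_(k <- s) cabs (c k) `^ q <= A `^ q ->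
  \int[P]_t (cabs (trig_sum s c (vec_of_tuple t)) `^ p) <= K * A `^ p.
Proof.
rewrite le_eqVlt => /predU1P[<- q2|p2 pq].
  have -> : q = 2.
    by rewrite -[q]invrK; apply/(canLR invrK); rewrite -[RHS]addr0; lra.
  exists 1 => // s c A us A0; rewrite mul1r => h.
  apply: le_trans h; rewrite (@eq_Rintegral _ _ _ P setT (fun t => cabs (trig_sum s c (vec_of_tuple t)) ^+ 2)).
    rewrite parseval_trig_sum//; apply: ler_sum => k _.
    by rewrite powR_mulrn// cabs_ge0.
  by move=> t _; rewrite powR_mulrn// cabs_ge0.
exists (1 + dyadic_constant p); first by rewrite addr_ge0// dyadic_constant_ge0.
move=> s c A us A0 cA; pose c' k := (A^-1)%:C * c k.
have nA k : cabs (c' k) = A^-1 * cabs (c k).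
  by rewrite /c' Normc.normcM cabs_real ger0_norm ?invr_ge0 ?ltW.
have := trig_sum_Lp_unit (c := c') p2 pq us.
have -> : \sum_(k <- s) cabs (c' k) `^ q = (A `^ q)^-1 * \sum_(k <- s) cabs (c k) `^ q.
  rewrite mulr_sumr; apply: eq_bigr => k _.
  rewrite nA powRM ?cabs_ge0 ?invr_ge0 ?(ltW A0)//; congr (_ * _).
  by rewrite -[A^-1]powR_inv1 ?(ltW A0)// powRAC powR_inv1 ?powR_ge0.
rewrite ler_pdivrMl ?powR_gt0// mulr1 => /(_ cA) h.
rewrite (@eq_Rintegral _ _ _ P setT (fun t => A `^ p * cabs (trig_sum s c' (vec_of_tuple t)) `^ p)).
  rewrite RintegralZl//; last by apply: integrable_trig_sum_powR; lra.
  by rewrite mulrC ler_wpM2r ?powR_ge0.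
move=> t _; rewrite -powRM ?cabs_ge0 ?(ltW A0)//; congr (_ `^ _).
have -> : trig_sum s c' (vec_of_tuple t) = (A^-1)%:C * trig_sum s c (vec_of_tuple t).
  by rewrite /trig_sum mulr_sumr; apply: eq_bigr => k _; rewrite mulrA.
rewrite Normc.normcM cabs_real ger0_norm ?invr_ge0 ?(ltW A0)//.
by rewrite mulrA divff ?mul1r ?gt_eqF.
Qed.

Lemma cvg_cabs (u : nat -> R[i]) (v : R[i]) :
  cabs (u n - v) @[n --> \oo] --> 0 -> cabs (u n) @[n --> \oo] --> cabs v.
Proof.
move=> uv; rewrite (_ : (fun n => _) = (fun n => cabs v + (cabs (u n) - cabs v))).
  rewrite -[X in _ --> X]addr0; apply: cvgD; first exact: cvg_cst.
  apply: (@squeeze_cvgr _ _ _ _ (fun n => - cabs (u n - v)) (fun n => cabs (u n - v))) => //.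
    apply: nearW => n.
    have h1 := cabsD (u n - v) v; rewrite subrK in h1.
    have h2 := cabsD (u n) (v - u n).
    rewrite addrC subrK -[cabs (v - _)]normcN opprB in h2.
    by apply/andP; split; lra.
  by rewrite -[X in _ --> X]oppr0; exact: cvgN.
by apply/funext => n; rewrite addrC subrK.
Qed.

Lemma cvg_powR (u : nat -> R) (l p : R) : 1 <= p -> (forall n, 0 <= u n) ->
  u n @[n --> \oo] --> l -> u n `^ p @[n --> \oo] --> l `^ p.
Proof.
move=> p1 u0 ul; have p0 : 0 < p by lra.
have l0 : 0 <= l.
  by rewrite -(cvg_lim (@Rhausdorff R) ul); apply: limr_ge; [exact: cvgP ul|exact: nearW].
move: l0; rewrite le_eqVlt => /predU1P[l0|l0].
  rewrite -l0 in ul *; rewrite powR0 ?gt_eqF//.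
  apply: (@squeeze_cvgr _ _ _ _ (fun=> 0) u) => //; last exact: cvg_cst.
  have /cvgr0Pnorm_lt /(_ 1 ltr01) := ul.
  apply: filterS => n; rewrite ger0_norm// => un1; rewrite powR_ge0/=.
  have := u0 n; rewrite le_eqVlt => /predU1P[<-|un0].
    by rewrite powR0// gt_eqF.
  by apply: ge1r_powR => //; rewrite un0 ltW.
have h : expR (p * ln (u n)) @[n --> \oo] --> expR (p * ln l).
  apply: continuous_cvg; first exact: continuous_expR.
  apply: cvgM; first exact: cvg_cst.
  by apply: continuous_cvg => //; exact: continuous_ln.
rewrite [X in _ --> X]/powR (gt_eqF l0).
apply: cvg_trans h; apply: near_eq_cvg.
have : \forall n \near \oo, 0 < u n by exact: cvgr_gt ul _ l0.
by apply: filterS => n un; rewrite /powR (gt_eqF un).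
Qed.

(** Each a k is at most A, so a k ^ 2 <= A^(2-q) (a k)^q. *)
Lemma esum_sqr_lty (a : 'cV[int]_d -> R) (q A : R) : 0 < q <= 2 -> 0 < A ->
  (forall k, 0 <= a k) -> (\esum_(k in setT) (a k `^ q)%:E <= (A `^ q)%:E)%E ->
  (\esum_(k in setT) (a k ^+ 2)%:E < +oo)%E.
Proof.
move=> /andP[q0 q2] A0 a0 aA.
have fin_le s : uniq s -> \sum_(k <- s) a k `^ q <= A `^ q.
  move=> us; rewrite -lee_fin; apply: le_trans aA; apply: sum_le_esum => // k.
  exact: powR_ge0.
have aleA k : a k <= A.
  have := fin_le [:: k] isT; rewrite big_seq1 => h.
  rewrite leNgt; apply/negP => Ak; move: h; rewrite leNgt => /negP; apply.
  by apply: gt0_ltr_powR => //; rewrite nnegrE ?a0 ?(ltW A0).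
apply: (@le_lt_trans _ _ (A `^ (2 - q) * A `^ q)%:E); last exact: ltry.
apply: esum_le_sum => s us _; rewrite lee_fin.
apply: (@le_trans _ _ (\sum_(k <- s) A `^ (2 - q) * a k `^ q)); last first.
  by rewrite -mulr_sumr ler_wpM2l ?powR_ge0// fin_le.
apply: ler_sum => k _; have := a0 k; rewrite le_eqVlt => /predU1P[<-|ak].
  by rewrite expr0n mulr_ge0 ?powR_ge0.
rewrite -powR_mulrn// -{1}(subrK q 2%:R) powRD ?(gt_eqF ak) ?implybT//.
by rewrite ler_wpM2r ?powR_ge0// ge0_ler_powR ?nnegrE ?subr_ge0// ltW.
Qed.

(** The bound for polynomials is uniform along the almost everywhere convergent partial sums. It
    passes to f by Fatou's lemma when p is finite; when p is infinite, q = 1 and the sum of the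
    moduli of the coefficients bounds every partial sum pointwise. *)
Lemma hausdorff_young (p : \bar R) (q : R) : (2%:E <= p)%E ->
  (p^-1 + q%:E^-1 = 1)%E -> exists2 K, 0 < K &
  forall f (A : R), torus_integrable f -> 0 < A ->
  (\esum_(k in [set: 'cV[int]_d]) (cabs (fourier f k) `^ q)%:E <= (A `^ q)%:E)%E ->
  (Lp_norm p f <= (K * A)%:E)%E.
Proof.
case: p => [p| |//] p2 pq.
  have {}p2 : 2 <= p by [].
  have p0 : 0 < p by lra.
  (* The inverse of 0 in the extended reals is +oo, so q = 0 would make the sum of the inverses
     infinite. *)
  have q0 : q != 0.
    by apply/eqP => h; move: pq; rewrite !inver (gt_eqF p0) h eqxx.
  have {}pq : p^-1 + q^-1 = 1.
    by move: pq; rewrite !inver (gt_eqF p0) (negbTE q0) => -[].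
  have pi0 : 0 < p^-1 <= 2^-1 by rewrite invr_gt0 p0 lef_pV2 ?posrE.
  have q02 : 0 < q <= 2.
    have qi : 2^-1 <= q^-1 by lra.
    have qi0 : 0 < q^-1 by lra.
    by rewrite -invr_gt0 qi0 -lef_pV2 ?posrE// -invr_gt0.
  have [K K0 HK] := trig_sum_Lp p2 pq.
  exists (K `^ p^-1 + 1); first by rewrite ltr_wpDl ?powR_ge0.
  move=> f A fi A0 fA.
  have f2 := esum_sqr_lty q02 A0 (fun k => cabs_ge0 _) fA.
  have [r ur hr] := trig_partial_sums fi f2.
  have fin_le s : uniq s -> \sum_(k <- s) cabs (fourier f k) `^ q <= A `^ q.
    move=> us; rewrite -lee_fin; apply: le_trans fA; apply: sum_le_esum => // k.
    exact: powR_ge0.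
  have mfp : measurable_fun setT (fun t : d.-tuple borelR => cabs (f (vec_of_tuple t)) `^ p).
    apply: (measurableT_comp (measurable_powR p)).
    exact: (measurable_cabs (cintegrable_meas fi)).
  pose F n (t : d.-tuple borelR) := (cabs (trig_sum (r n) (fourier f) (vec_of_tuple t)) `^ p)%:E.
  have Fi n : P.-integrable setT (F n) by apply: integrable_trig_sum_powR; lra.
  have mF n : measurable_fun setT (F n) by exact: measurable_int (Fi n).
  have F0 n t : (0 <= F n t)%E by rewrite lee_fin powR_ge0.
  have key : (\int[P]_t (cabs (f (vec_of_tuple t)) `^ p)%:E <= (K * A `^ p)%:E)%E.
    have lim_le : (limn_einf (fun n => \int[P]_t F n t) <= (K * A `^ p)%:E)%E.
      have E n : (\int[P]_t F n t <= (K * A `^ p)%:E)%E.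
        rewrite -[leLHS]fineK; last exact: integrable_fin_num (Fi n).
        by rewrite lee_fin; apply: HK => //; exact: fin_le.
      apply: le_trans (limn_einf_sup _) _; rewrite limn_esup_lim.
      apply: lime_le; first exact: is_cvg_esups.
      apply: nearW => n; apply: ge_ereal_sup => _ [m _ <-]; exact: E.
    apply: le_trans lim_le.
    have := @fatou _ _ _ P setT measurableT F mF (fun n t _ => F0 n t).
    apply: le_trans; rewrite le_eqVlt; apply/orP; left; apply/eqP.
    apply: ge0_ae_eq_integral => //.
    - exact/measurable_EFinP.
    - rewrite (_ : (fun t => _) = (fun t => - limn_esup (fun n => - F n t)))%E.
        apply: measurableT_comp => //; apply: measurable_fun_limn_esup => n.
        exact: measurableT_comp.
      by apply/funext => t; rewrite -[X in limn_esup X]/(-%E \o F^~ t) limn_esupN oppeK.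
    - by move=> t _; rewrite lee_fin powR_ge0.
    - move=> t _; rewrite limn_einf_lim; apply: lime_ge; first exact: is_cvg_einfs.
      by apply: nearW => n; apply: le_ereal_inf_tmp => _ [m _ <-].
    - apply: (torus_aeS hr) => t ht _.
      have /cvg_limn_einf_sup[-> //] : F n t @[n --> \oo] --> (cabs (f (vec_of_tuple t)) `^ p)%:E.
      apply: cvg_EFin; first exact: nearW.
      apply: cvg_powR; first lra.
        by move=> n; exact: cabs_ge0.
      exact: cvg_cabs.
  rewrite /Lp_norm unlock.
  rewrite (eq_integral (fun t => (cabs (f (vec_of_tuple t)) `^ p)%:E)); last first.
    by move=> t _ /=; rewrite ger0_norm ?cabs_ge0.
  apply: (@le_trans _ _ ((K * A `^ p)%:E `^ p^-1)%E).
    apply: gt0_ler_poweR => //; first by rewrite invr_ge0 ltW.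
      by rewrite in_itv /= leey andbT; apply: integral_ge0 => t _; rewrite lee_fin powR_ge0.
    by rewrite in_itv /= leey andbT lee_fin mulr_ge0 ?powR_ge0.
  rewrite poweR_EFin lee_fin powRM ?powR_ge0// -powRrM divff ?gt_eqF// powRr1 ?(ltW A0)//.
  by rewrite ler_wpM2r ?(ltW A0)// lerDl.
have q1 : q = 1.
  move: pq; rewrite invey add0e inver; case: eqP => // _ [] h.
  by rewrite -[q]invrK h invr1.
exists 1 => // f A fi A0 fA; rewrite mul1r.
have f2 : (\esum_(k in setT) (cabs (fourier f k) ^+ 2)%:E < +oo)%E.
  by apply: (esum_sqr_lty _ A0 _ fA) => [|k]; rewrite ?cabs_ge0// q1 ltr01 ler1n.
have [r ur hr] := trig_partial_sums fi f2.
rewrite /Lp_norm unlock; case: ifP => _; last by rewrite lee_fin ltW.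
apply/ess_supP; apply: (torus_aeS hr) => t ht /=.
rewrite lee_fin ger0_norm ?cabs_ge0//; apply/ler_addgt0Pr => e e0.
have /cvgr0Pnorm_le /(_ e e0)[N _ /(_ N (leqnn _))] := ht.
rewrite /= ger0_norm ?cabs_ge0// => hN.
set v := f _ in hN *; set u := trig_sum _ _ _ in hN.
rewrite -(subrK u v) addrC (le_trans (cabsD _ _))// lerD//.
  rewrite (le_trans (cabs_trig_sum _ _ _))// -lee_fin.
  move: fA; rewrite q1 powRr1 ?(ltW A0)//; apply: le_trans.
  under eq_esum do rewrite powRr1 ?cabs_ge0//.
  by apply: sum_le_esum => // k; exact: cabs_ge0.
by rewrite -normcN opprB.
Qed.

End HausdorffYoung.

(** * Digit sets as residue systems, and character sums over them *)

Section DigitSets.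
Context {R : realType} {d : nat}.
Implicit Types (A B : 'M[int]_d) (k l n r : 'cV[int]_d).

Lemma mxRM (m n p : nat) (A : 'M[int]_(m, n)) (B : 'M[int]_(n, p)) :
  mxR (A *m B) = mxR A *m mxR B :> 'M[R]_(m, p).
Proof. exact: map_mxM. Qed.

Lemma mxRD (m n : nat) (A B : 'M[int]_(m, n)) :
  mxR (A + B) = mxR A + mxR B :> 'M[R]_(m, n).
Proof. exact: map_mxD. Qed.

Lemma mxRB (m n : nat) (A B : 'M[int]_(m, n)) :
  mxR (A - B) = mxR A - mxR B :> 'M[R]_(m, n).
Proof. exact: map_mxB. Qed.

Lemma mxR_inj (m n : nat) : injective (@mxR R m n).
Proof.
move=> A B /matrixP h; apply/matrixP => i j; have := h i j.
by rewrite !mxE => /eqP; rewrite eqr_int => /eqP.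
Qed.

Lemma mxR_unit A : \det A != 0 -> mxR A \in @unitmx R d.
Proof. by move=> A0; rewrite unitmxE det_map_mx unitfE intr_eq0. Qed.

Section Division.
Variables (A : 'M[int]_d) (detA : \det A != 0).
Let Ainv : 'M[R]_d := invmx (mxR A).

(** Coordinates of A^-1 l are rounded to the nearest integer, halves upwards: this matches the
    half-open interval [-1/2, 1/2) in the definition of the digits. *)
Definition lattice_quot l : 'cV[int]_d :=
  \col_i Num.floor ((Ainv *m mxR l) i 0 + 2^-1).

Definition lattice_rem l : 'cV[int]_d := l - A *m lattice_quot l.

Lemma digitsP r : digits R A r <-> forall i, - 2^-1 <= (Ainv *m mxR r) i 0 < 2^-1.
Proof.
have uA := mxR_unit detA; split => [[x hx <-] i|h].
  by rewrite mulKmx.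
by exists (Ainv *m mxR r) => //; rewrite mulKVmx.
Qed.

Lemma lattice_rem_digits l : digits R A (lattice_rem l).
Proof.
have uA := mxR_unit detA; apply/digitsP => i.
rewrite /lattice_rem mxRB mxRM mulmxBr mulKmx// !mxE.
set x := \sum_(j < d) _; have := floor_le (x + 2^-1); have := floorD1_gt (x + 2^-1).
rewrite intrD1; set z := (Num.floor _)%:~R => h1 h2; apply/andP; split; lra.
Qed.

Lemma lattice_divE l : l = A *m lattice_quot l + lattice_rem l.
Proof. by rewrite /lattice_rem addrC subrK. Qed.

(** Applying A^-1 exhibits n as a difference of two points of [-1/2, 1/2)^d, so its integer
    coordinates lie strictly between -1 and 1. *)
Lemma digits_unique r r' n : digits R A r -> digits R A r' ->
  r = A *m n + r' -> n = 0 /\ r = r'.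
Proof.
have uA := mxR_unit detA.
move=> /digitsP hr /digitsP hr' rE; suff n0 : n = 0.
  by split => //; rewrite rE n0 mulmx0 add0r.
apply/colP => i.
have E : (Ainv *m mxR r) i 0 = (n i 0)%:~R + (Ainv *m mxR r') i 0.
  rewrite rE mxRD mxRM mulmxDr mulKmx// [LHS]mxE; congr (_ + _).
  by rewrite mxE.
have /andP[y1 y2] := hr' i. have /andP[z1 z2] := hr i.
rewrite E in z1 z2.
have h1 : (-1)%:~R < (n i 0)%:~R :> R by rewrite rmorphN1; lra.
have h2 : (n i 0)%:~R < 1%:~R :> R by rewrite rmorph1; lra.
move: h1 h2; rewrite !ltr_int mxE.
by case: (n i 0) => [[|m]|m].
Qed.

Lemma lattice_rem_eq r n : digits R A r -> lattice_rem (A *m n + r) = r.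
Proof.
move=> hr; have := lattice_divE (A *m n + r).
set q := lattice_quot _; set r' := lattice_rem _ => E.
have E' : r' = A *m (n - q) + r.
  by rewrite mulmxBr addrAC E addrAC subrr add0r.
by have [_] := digits_unique (lattice_rem_digits _) hr E'.
Qed.

Lemma lattice_bij : set_bij (digits R A `*`` (fun=> [set: 'cV[int]_d])) setT
  (fun rn : 'cV[int]_d * 'cV[int]_d => A *m rn.2 + rn.1).
Proof.
split => [//|[r n] [r' n']|l _].
  rewrite !inE => -[/= hr _] [/= hr' _] E.
  have E1 : r = A *m (n' - n) + r'.
    by rewrite mulmxBr addrAC -E addrAC subrr add0r.
  have [/eqP] := digits_unique hr hr' E1.
  by rewrite subr_eq0 => /eqP -> ->.
exists (lattice_rem l, lattice_quot l); last by rewrite /= -lattice_divE.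
by split => //=; exact: lattice_rem_digits.
Qed.

Lemma esum_lattice (h : 'cV[int]_d -> \bar R) : (forall l, (0 <= h l)%E) ->
  (\esum_(l in setT) h l =
   \esum_(r in digits R A) \esum_(n in setT) h (A *m n + r)%R)%E.
Proof.
by move=> h0; rewrite esum_esum// (reindex_esum _ _ _ _ lattice_bij).
Qed.

End Division.

Lemma card_ord_lt (m e : nat) : (e <= m)%N -> #|[pred x : 'I_m | (x < e)%N]| = e.
Proof.
move=> em; transitivity (\sum_(i < e) 1)%N; last by rewrite sum1_card card_ord.
by rewrite -sum1_card (big_ord_widen m (fun=> 1%N) em).
Qed.

(** In the Smith normal form A = L S U with L, U unimodular, the vectors L v with 0 <= v_i < e_i
    represent each class modulo A Z^d once. Reducing them modulo A maps this box bijectively onto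
    the digits, and the box has prod e_i = |det A| points. *)
Lemma digits_count A : \det A != 0 -> finite_set (digits R A) /\
  (forall (K : comNzRingType) , \sum_(k \in digits R A) (1 : K) = (absz (\det A))%:R).
Proof.
move=> detA.
have [L uL [U uU [s _ AE]]] := int_Smith_normal_form A.
set S : 'M[int]_d := \matrix_(i, j) (s`_i *+ (i == j :> nat)) in AE.
have Sdiag : S = diag_mx (\row_i s`_i).
  by apply/matrixP => i j; rewrite !mxE.
pose e (i : 'I_d) : nat := absz s`_i.
have detS : absz (\det A) = (\prod_(i < d) e i)%N.
  rewrite AE !det_mulmx !abszM.
  have one (B : 'M[int]_d) : B \in unitmx -> absz (\det B) = 1%N.
    rewrite unitmxE => /divrr /(congr1 absz); rewrite abszM => /eqP.
    by rewrite muln_eq1 => /andP[/eqP].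
  rewrite (one _ uL) (one _ uU) mul1n muln1 Sdiag det_diag.
  rewrite (big_morph absz abszM (erefl : absz 1 = 1%N)).
  by apply: eq_bigr => i _; rewrite mxE.
have e0 i : (0 < e i)%N.
  rewrite lt0n; apply: contra_neqN detA => /eqP h.
  by apply/eqP; rewrite -absz_eq0 detS (bigD1 i)//= h mul0n.
(* The side lengths e_i of the box vary with i; a common bound lets its points be coded by functions
   into one ordinal type, restricted by the family [F]. *)
pose m := (\max_(i < d) e i)%N.
pose F (i : 'I_d) := [pred x : 'I_m.+1 | (x < e i)%N].
pose v (f : {ffun 'I_d -> 'I_m.+1}) : 'cV[int]_d := \col_i (f i : nat)%:Z.
pose Phi f := lattice_rem A (L *m v f).
have Sz (z : 'cV[int]_d) i : (S *m z) i 0 = s`_i * z i 0.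
  by rewrite Sdiag mul_diag_mx !mxE.
have bij : set_bij [set f | f \in family F] (digits R A) Phi.
  split.
  - by move=> f _; exact: lattice_rem_digits.
  - move=> f g; rewrite !inE /= => /familyP hf /familyP hg E.
    have : L *m v f - L *m v g = A *m (lattice_quot A (L *m v f) - lattice_quot A (L *m v g)).
      rewrite {1}(lattice_divE A (L *m v f)) {1}(lattice_divE A (L *m v g)).
      by rewrite -/(Phi f) -/(Phi g) E opprD addrACA subrr addr0 mulmxBr.
    rewrite -mulmxBr AE -mulmxA -mulmxA => /(congr1 (mulmx (invmx L))).
    rewrite !mulKmx//; set z := U *m _ => vE.
    apply/ffunP => i; apply/val_inj => /=.
    have := congr1 (fun x : 'cV[int]_d => x i 0) vE; rewrite Sz !mxE.
    move: (hf i) (hg i); rewrite !inE; set a := (f i : nat); set b := (g i : nat) => fa gb ab.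
    have [//|ab_ne] := eqVneq a b.
    have : (e i %| absz (a%:Z - b%:Z))%N by rewrite ab abszM dvdn_mulr.
    move/dvdn_leq; rewrite absz_gt0 subr_eq0 eqz_nat ab_ne => /(_ isT).
    apply: contraTeq => _; rewrite -ltnNge; have [h|h] := leqP a b.
      by rewrite distnEr//; exact: leq_ltn_trans (leq_subr _ _) gb.
    by rewrite (distnEl (ltnW h)); exact: leq_ltn_trans (leq_subr _ _) fa.
  - have sn0 i : s`_(i : 'I_d) != 0 by rewrite -absz_eq0 -lt0n; exact: e0.
    move=> k hk; pose w := invmx L *m k.
    have fm i : (absz (w i ord0 %% s`_i)%Z < m.+1)%N.
      rewrite ltnS; apply: (@leq_trans (e i)); last exact: (leq_bigmax (F := e) i).
      rewrite ltnW// -ltz_nat gez0_abs ?modz_ge0 ?sn0//.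
      exact: ltz_mod.
    pose f : {ffun 'I_d -> 'I_m.+1} := [ffun i => Ordinal (fm i)].
    have vf i : v f i 0 = (w i ord0 %% s`_i)%Z.
      by rewrite mxE ffunE /= gez0_abs// modz_ge0.
    exists f.
      rewrite /= inE; apply/familyP => i; rewrite inE ffunE /=.
      by rewrite -ltz_nat gez0_abs ?modz_ge0// ltz_mod.
    pose z : 'cV[int]_d := \col_i (w i ord0 %/ s`_i)%Z.
    have wE : w = S *m z + v f.
      apply/colP => i; rewrite [RHS]mxE Sz vf.
      have -> : z i 0 = (w i ord0 %/ s`_i)%Z by rewrite mxE.
      by rewrite mulrC; exact: divz_eq.
    have kE : L *m v f = A *m (- (invmx U *m z)) + k.
      rewrite -[k](mulKVmx uL) -/w wE mulmxDr AE -!mulmxA mulmxN mulKVmx// mulmxN.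
      by rewrite mulmxN addrA addNr add0r.
    by rewrite /Phi kE lattice_rem_eq.
have finD : finite_set (digits R A).
  have [_ _ sur] := bij; apply: (sub_finite_set sur); apply: finite_image.
  exact: finite_finpred.
split => // K; rewrite (reindex_fsbig _ _ _ _ bij).
transitivity (\sum_(f in family F) (1 : K)).
  rewrite -big_enum [RHS]fsbig_seq ?enum_uniq//; apply: eq_fsbigl => //.
  by apply/seteqP; split => f /=; rewrite mem_enum.
rewrite sumr_const card_family detS; congr (_%:R).
rewrite foldrE big_map big_enum /=; apply: eq_bigr => i _.
by rewrite card_ord_lt// ltnW// ltnS leq_bigmax.
Qed.

End DigitSets.

Section CharacterSums.
Context {R : realType} {d : nat}.
Local Open Scope complex_scope.
Implicit Types (A : 'M[int]_d) (k l n r : 'cV[int]_d) (y : 'cV[R]_d).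

(** The character k -> exp(2 pi i (k, y)) factors through Z^d / A Z^d. As y is not integral, it
    differs from 1 at some basis vector e; adding e permutes the digits modulo A, so the sum equals
    itself times a number other than 1. *)
Lemma digits_char_sum_eq0 A y : \det A != 0 ->
  (forall n, expi2pi (dotv (mxR (A *m n)) y) = 1) ->
  ~ (exists z : 'cV[int]_d, y = mxR z) ->
  \sum_(k \in digits R A) expi2pi (dotv (mxR k) y) = 0.
Proof.
move=> detA hA hy.
pose chi k : R[i] := expi2pi (dotv (mxR k) y).
have chiD k l : chi (k + l) = chi k * chi l by rewrite /chi mxRD dotvDl expi2piD.
have chiA n k : chi (A *m n + k) = chi k by rewrite chiD [chi (A *m n)]hA mul1r.
have [i hi] : exists i, expi2pi (y i 0) != 1.
  apply: contrapT => h; apply: hy.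
  have {}h i : exists z : int, y i 0 = z%:~R.
    by apply: expi2pi_eq1; apply/eqP/negPn/negP => hi; apply: h; exists i.
  have [z hz] := choice h.
  by exists (\col_i z i); apply/colP => j; rewrite !mxE.
pose e : 'cV[int]_d := delta_mx i 0.
have chie : chi e = expi2pi (y i 0).
  rewrite /chi /dotv (bigD1 i)//= big1 ?addr0; last first.
    by move=> j ji; rewrite !mxE (negbTE ji) mul0r.
  by rewrite !mxE !eqxx mul1r.
pose T k := lattice_rem (R := R) A (k + e).
have bij : set_bij (digits R A) (digits R A) T.
  split.
  - by move=> k _; exact: lattice_rem_digits.
  - move=> k l; rewrite !inE => hk hl E.
    have Ek := lattice_divE (R := R) A (k + e); have El := lattice_divE (R := R) A (l + e).
    rewrite -/(T k) -/(T l) in Ek El; set a := lattice_quot _ _ in Ek; set b := lattice_quot _ _ in El.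
    have kl : k = A *m (a - b) + l.
      rewrite mulmxBr; apply: (addIr e); rewrite Ek E -(addrA (A *m a - A *m b)) El.
      by rewrite -addrA addKr.
    by have [_] := digits_unique detA hk hl kl.
  - move=> l hl; exists (lattice_rem (R := R) A (l - e)).
      exact: lattice_rem_digits.
    have E : lattice_rem (R := R) A (l - e) + e =
        A *m (- lattice_quot (R := R) A (l - e)) + l.
      by rewrite /lattice_rem mulmxN addrAC subrK addrC.
    by rewrite /T E lattice_rem_eq.
have [fD _] := digits_count (R := R) detA.
have S : \sum_(k \in digits R A) chi k = chi e * \sum_(k \in digits R A) chi k.
  rewrite {1}(reindex_fsbig _ _ _ _ bij) !fsbig_finite// mulr_sumr.
  apply: eq_bigr => k _; rewrite mulrC -chiD [in RHS](lattice_divE (R := R) A (k + e)).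
  by rewrite chiA.
move/eqP: S; rewrite -subr_eq0 -{1}[X in X - _]mul1r -mulrBl mulf_eq0 subr_eq0.
by rewrite eq_sym chie (negbTE hi) => /eqP.
Qed.

Lemma digits_char_sum_int A y (z : 'cV[int]_d) : \det A != 0 -> y = mxR z ->
  \sum_(k \in digits R A) expi2pi (dotv (mxR k) y) = (absz (\det A))%:R :> R[i].
Proof.
move=> detA ->; have [_ <-] := digits_count (R := R) detA.
by apply: eq_fsbigr => k _; rewrite dotv_int expi2pi_int.
Qed.

End CharacterSums.

(** * Unordered sums of complex families *)

Section UnorderedSums.
Context {R : realType} {d : nat}.
Local Open Scope complex_scope.
Local Notation K := 'cV[int]_d.
Implicit Types (u v : K -> R[i]) (s r : seq K).

(** Convergence along the directed family of finite index sets. Linear operations are immediate in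
    this form, whereas [csum] is assembled from four nonnegative sums. *)
Definition has_csum u (z : R[i]) : Prop := forall e : R, 0 < e ->
  exists2 r, uniq r & forall s, uniq s -> {subset r <= s} ->
    cabs (\sum_(k <- s) u k - z) <= e.

Lemma has_csum_unique u z z' : has_csum u z -> has_csum u z' -> z = z'.
Proof.
move=> hz hz'; apply/eqP; rewrite -subr_eq0 -cabs0_eq eq_le cabs_ge0 andbT.
apply/ler_addgt0Pr => e e0; rewrite add0r.
have e20 : 0 < e / 2 by rewrite divr_gt0.
have [r ur hr] := hz _ e20; have [r' ur' hr'] := hz' _ e20.
pose s := undup (r ++ r').
have := hr s (undup_uniq _); have := hr' s (undup_uniq _).
move=> /(_ _)/wrap[|h']; first by move=> k kr; rewrite mem_undup mem_cat kr orbT.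
move=> /(_ _)/wrap[|h]; first by move=> k kr; rewrite mem_undup mem_cat kr.
have -> : z - z' = (\sum_(k <- s) u k - z') - (\sum_(k <- s) u k - z).
  by rewrite [RHS]addrC opprB subrKA.
by rewrite (le_trans (cabsB _ _))// [e]splitr lerD.
Qed.

Lemma has_csumD u v z w : has_csum u z -> has_csum v w ->
  has_csum (fun k => u k + v k) (z + w).
Proof.
move=> hu hv e e0; have e20 : 0 < e / 2 by rewrite divr_gt0.
have [r ur hr] := hu _ e20; have [r' ur' hr'] := hv _ e20.
exists (undup (r ++ r')); first exact: undup_uniq.
move=> s us rs; rewrite big_split /= opprD addrACA.
rewrite (le_trans (cabsD _ _))// [e]splitr lerD//.
  by apply: hr => // k kr; apply: rs; rewrite mem_undup mem_cat kr.
by apply: hr' => // k kr; apply: rs; rewrite mem_undup mem_cat kr orbT.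
Qed.

Lemma has_csumZ (c : R[i]) u z : has_csum u z -> has_csum (fun k => c * u k) (c * z).
Proof.
move=> hu e e0; have c0 := cabs_ge0 c.
have [r ur hr] := hu (e / (cabs c + 1)) (divr_gt0 e0 (ltr_wpDl c0 ltr01)).
exists r => // s us rs; rewrite -mulr_sumr -mulrBr Normc.normcM.
apply: (@le_trans _ _ ((cabs c + 1) * (e / (cabs c + 1)))).
  by rewrite ler_pM ?cabs_ge0// ?lerDl// hr.
by rewrite mulrCA divff ?mulr1// gt_eqF// ltr_wpDl.
Qed.

Lemma has_csum_finite u r : uniq r -> (forall k, k \notin r -> u k = 0) ->
  has_csum u (\sum_(k <- r) u k).
Proof.
move=> ur u0 e e0; exists r => // s us rs.
have -> : \sum_(k <- s) u k = \sum_(k <- r) u k.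
  rewrite (bigID (mem r)) /= [X in _ + X]big1 ?addr0; last by move=> k; exact: u0.
  rewrite -big_filter; apply: perm_big; apply: uniq_perm; rewrite ?filter_uniq//.
  by move=> k; rewrite mem_filter; case kr: (k \in r); rewrite //= (rs _ kr).
by rewrite subrr Normc.normc0 ltW.
Qed.

Lemma has_csum0 : has_csum (fun=> 0) 0.
Proof. by have := @has_csum_finite (fun=> 0) [::] isT (fun _ _ => erefl); rewrite big_nil. Qed.

Lemma has_csum_sum (I : Type) (t : seq I) (U : I -> K -> R[i]) (Z : I -> R[i]) :
  (forall i, has_csum (U i) (Z i)) ->
  has_csum (fun k => \sum_(i <- t) U i k) (\sum_(i <- t) Z i).
Proof.
move=> h; elim: t => [|i t IH].
  rewrite big_nil (_ : (fun k => _) = (fun=> 0)); first exact: has_csum0.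
  by apply/funext => k; rewrite big_nil.
rewrite big_cons (_ : (fun k => _) = (fun k => U i k + \sum_(i <- t) U i k)).
  exact: has_csumD.
by apply/funext => k; rewrite big_cons.
Qed.

Lemma has_csum_bound u z (B : R) : has_csum u z ->
  (forall s, uniq s -> \sum_(k <- s) cabs (u k) <= B) -> cabs z <= B.
Proof.
move=> hu hB; apply/ler_addgt0Pr => e e0; have [r ur hr] := hu _ e0.
have h := hr r ur (fun _ => id).
rewrite -(subrK (\sum_(k <- r) u k) z) (le_trans (cabsD _ _))// addrC lerD//.
  by rewrite (le_trans (cabs_sum _ _ _))// hB.
by rewrite -normcN opprB.
Qed.

Lemma esum_approx (a : K -> R) (e : R) : (forall k, 0 <= a k) ->
  (\esum_(k in setT) (a k)%:E < +oo)%E -> 0 < e ->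
  exists2 r, uniq r & forall s, uniq s -> {subset r <= s} ->
    `|\sum_(k <- s) a k - fine (\esum_(k in setT) (a k)%:E)| <= e.
Proof.
move=> a0 afin e0; have [r ur hr] := esum_tail a0 afin e0; exists r => // s us rs.
have S0 : (0 <= \esum_(k in setT) (a k)%:E)%E by apply: esum_ge0 => k _; rewrite lee_fin.
have Sfin : \esum_(k in setT) (a k)%:E \is a fin_num by rewrite ge0_fin_numE.
have h1 := sum_le_esum a0 us; rewrite -(fineK Sfin) lee_fin in h1.
have h2 : fine (\esum_(k in setT) (a k)%:E) <= \sum_(k <- s) a k + e.
  rewrite -lee_fin fineK//; apply: esum_le_sum => t ut _; rewrite lee_fin.
  rewrite (bigID (mem s)) /= lerD//.
    rewrite -big_filter [leRHS](bigID (mem t)) /= -[leLHS]addr0 lerD ?sumr_ge0//.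
    rewrite -[leRHS]big_filter le_eqVlt; apply/orP; left; apply/eqP.
    apply: perm_big; apply: uniq_perm; rewrite ?filter_uniq// => k.
    by rewrite !mem_filter andbC.
  rewrite -big_filter; apply: hr; first by rewrite filter_uniq.
  by move=> k; rewrite mem_filter => /andP[ks _]; apply: contra ks => /rs.
by rewrite ler_norml; apply/andP; split; lra.
Qed.

Lemma has_csum_csum u : csummable u -> has_csum u (csum u).
Proof.
move=> hu.
have usum (w : R[i] -> R) : (forall z, `|w z| <= cabs z) -> forall e : R, 0 < e ->
  exists2 r, uniq r & forall s, uniq s -> {subset r <= s} ->
    `|\sum_(k <- s) w (u k) - rsum (fun k => w (u k))| <= e.
  move=> wle e e0.
  have fin (g : R -> R) : (forall x, 0 <= g x <= `|x|) ->
      (\esum_(k in setT) (g (w (u k)))%:E < +oo)%E.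
    move=> hg; apply: le_lt_trans hu; apply: le_esum => k _.
    have /andP[g0 g1] := hg (w (u k)).
    by rewrite /= lee_fin ger0_norm ?cabs_ge0// (le_trans g1).
  have e20 : 0 < e / 2 by rewrite divr_gt0.
  have p0 (x : R) : 0 <= Num.max x 0 by rewrite le_max lexx orbT.
  have b1 (x : R) : 0 <= Num.max x 0 <= `|x|.
    by rewrite p0 ge_max ler_norm normr_ge0.
  have b2 (x : R) : 0 <= Num.max (- x) 0 <= `|x|.
    by rewrite p0 ge_max -normrN ler_norm normr_ge0.
  have [r1 ur1 h1] := esum_approx (fun k => p0 (w (u k))) (fin (fun x => Num.max x 0) b1) e20.
  have [r2 ur2 h2] := esum_approx (fun k => p0 (- w (u k))) (fin (fun x => Num.max (- x) 0) b2) e20.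
  exists (undup (r1 ++ r2)); first exact: undup_uniq.
  move=> s us rs.
  have := h1 s us; have := h2 s us.
  move=> /(_ _)/wrap[|h2']; first by move=> k kr; apply: rs; rewrite mem_undup mem_cat kr orbT.
  move=> /(_ _)/wrap[|h1']; first by move=> k kr; apply: rs; rewrite mem_undup mem_cat kr.
  rewrite /rsum.
  have -> : \sum_(k <- s) w (u k) = \sum_(k <- s) Num.max (w (u k)) 0 -
      \sum_(k <- s) Num.max (- w (u k)) 0.
    rewrite -sumrB; apply: eq_bigr => k _.
    have E (x : R) : x = Num.max x 0 - Num.max (- x) 0; last exact: E.
    have [x0|x0] := leP x 0.
      by rewrite max_l ?oppr_ge0// sub0r opprK.
    by rewrite max_r ?oppr_le0 ?ltW// subr0.
  rewrite opprD addrACA -opprD (le_trans (ler_normB _ _))// [e]splitr lerD//.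
move=> e e0; have e20 : 0 < e / 2 by rewrite divr_gt0.
have [r1 ur1 h1] := usum _ (@Re_le_cabs _) _ e20.
have [r2 ur2 h2] := usum _ (@Im_le_cabs _) _ e20.
exists (undup (r1 ++ r2)); first exact: undup_uniq.
move=> s us rs.
have := h1 s us; have := h2 s us.
move=> /(_ _)/wrap[|h2']; first by move=> k kr; apply: rs; rewrite mem_undup mem_cat kr orbT.
move=> /(_ _)/wrap[|h1']; first by move=> k kr; apply: rs; rewrite mem_undup mem_cat kr.
by rewrite (le_trans (cabs_le_ReIm _))// ReB ImB Re_sum Im_sum [e]splitr lerD.
Qed.

End UnorderedSums.

(** * Fourier coefficients of the quasi-projection *)

Section QuasiProjectionCoefficients.
Context {R : realType} {d : nat} (M : 'M[int]_d).
Hypothesis detM : \det M != 0.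
Local Open Scope complex_scope.
Local Notation P := (@torus_measure R d).
Implicit Types (f phi : 'cV[R]_d -> R[i]) (T : periodic_distribution R d)
  (k l n : 'cV[int]_d) (j : nat).

Lemma det_expmx j : \det (M ^+ j) = \det M ^+ j.
Proof.
elim: j => [|j IH]; first by rewrite !expr0 det1.
by rewrite !exprS -IH; exact: det_mulmx.
Qed.

Lemma trmx_expmx j : (M ^+ j)^T = M^T ^+ j.
Proof.
elim: j => [|j IH]; first by rewrite !expr0 trmx1.
by rewrite exprS exprSr -IH; exact: trmx_mul.
Qed.

Lemma det_expmx_neq0 j : \det (M ^+ j) != 0.
Proof. by rewrite det_expmx expf_neq0. Qed.

Lemma det_trexpmx_neq0 j : \det (M^T ^+ j) != 0.
Proof. by rewrite -trmx_expmx det_tr det_expmx_neq0. Qed.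

Lemma dotv_mulmx (x y : 'cV[R]_d) : dotv x y = (x^T *m y) 0 0.
Proof. by rewrite mxE; apply: eq_bigr => i _; rewrite mxE. Qed.

Lemma Mstarinv_tr j : Mstarinv R M j = (Minv R M j)^T.
Proof. by rewrite /Mstarinv /Minv trmx_inv -trmx_expmx /mxR map_trmx. Qed.

Lemma dotv_Minv j (x y : 'cV[R]_d) :
  dotv x (Minv R M j *m y) = dotv y (Mstarinv R M j *m x).
Proof.
rewrite !dotv_mulmx Mstarinv_tr.
have -> : (x^T *m (Minv R M j *m y)) 0 0 = (x^T *m (Minv R M j *m y))^T 0 0.
  by rewrite [RHS]mxE.
by rewrite !trmx_mul trmxK -mulmxA.
Qed.

Definition lattice_equiv j l l' : bool :=
  lattice_rem (R := R) (M^T ^+ j) l' == lattice_rem (R := R) (M^T ^+ j) l.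

Lemma digits_char_average j l l' :
  ((absz (\det M))%:R ^+ j)^-1 * \sum_(k \in digits R (M ^+ j))
    expi2pi (dotv (mxR k) (Mstarinv R M j *m mxR (l' - l))) =
  (lattice_equiv j l l')%:R :> R[i].
Proof.
have uA : mxR (M^T ^+ j) \in @unitmx R d := mxR_unit (det_trexpmx_neq0 j).
rewrite /lattice_equiv; case: eqP => E.
  have -> : Mstarinv R M j *m mxR (l' - l) = mxR
      (lattice_quot (R := R) (M^T ^+ j) l' - lattice_quot (R := R) (M^T ^+ j) l).
    rewrite {1}(lattice_divE (R := R) (M^T ^+ j) l') {1}(lattice_divE (R := R) (M^T ^+ j) l) E.
    rewrite opprD addrACA subrr addr0 -mulmxBr mxRM /Mstarinv.
    by rewrite mulKmx.
  rewrite (digits_char_sum_int (det_expmx_neq0 j) erefl) det_expmx abszX.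
  rewrite natrX mulVf// expf_neq0// pnatr_eq0 absz_eq0//.
rewrite digits_char_sum_eq0 ?mulr0// ?det_expmx_neq0//.
  move=> n; rewrite -dotv_Minv mxRM /Minv mulKmx ?dotv_int ?expi2pi_int//.
  exact: mxR_unit (det_expmx_neq0 j).
move=> [z hz]; apply: E.
have : l' - l = M^T ^+ j *m z.
  by apply: (@mxR_inj R); rewrite mxRM -hz /Mstarinv mulKVmx.
move=> /eqP; rewrite subr_eq => /eqP ->.
rewrite {1}(lattice_divE (R := R) (M^T ^+ j) l) addrA -mulmxDr.
by rewrite lattice_rem_eq ?det_trexpmx_neq0//; apply: lattice_rem_digits; exact: det_trexpmx_neq0.
Qed.

Variables (j : nat) (f phi : 'cV[R]_d -> R[i]) (T : periodic_distribution R d).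
Hypothesis phi_per : Zd_periodic phi.
Hypothesis phi_int : torus_integrable phi.

Let t := finmap.enum_fset (fset_set (digits R (M ^+ j))).

Lemma quasi_projectionE x : quasi_projection M j f phi T x =
  (((absz (\det M))%:R) ^+ j)^-1 * \sum_(k <- t)
     (pairing M j f T k * phi (x - Minv R M j *m mxR k)).
Proof.
have [fD _] := digits_count (R := R) (det_expmx_neq0 j).
by rewrite /quasi_projection fsbig_finite.
Qed.

Let quasi_projection_funE : quasi_projection M j f phi T = fun x =>
  (((absz (\det M))%:R) ^+ j)^-1 * \sum_(k <- t)
     (pairing M j f T k * phi (x - Minv R M j *m mxR k)).
Proof. by apply/funext => x; exact: quasi_projectionE. Qed.

Let shift_int k : torus_integrable (fun x => phi (x - Minv R M j *m mxR k)).
Proof. exact: torus_integrable_translation. Qed.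

Lemma quasi_projection_integrable : torus_integrable (quasi_projection M j f phi T).
Proof.
rewrite quasi_projection_funE.
apply: cintegrableZ; apply: cintegrable_sum => k _; apply: cintegrableZ.
exact: shift_int.
Qed.

(** The translate of phi by M^-j k contributes a character value at l. Moving the finite sum over k
    inside the series over l' produces the average of the characters at l' - l, which is the
    indicator of the coset of l. *)
Lemma fourier_quasi_projection l z :
  (forall k, csummable (pairing_term M j f T k)) ->
  has_csum (fun l' => if lattice_equiv j l l' then
    fourier f l' * conjc (dfourier T l') else 0) z ->
  fourier (quasi_projection M j f phi T) l = fourier phi l * z.
Proof.
move=> hs hz; set c := ((absz (\det M))%:R ^+ j)^-1 : R[i].
have -> : fourier (quasi_projection M j f phi T) l =
    fourier phi l * \sum_(k <- t) (c * torus_char (- l) (Minv R M j *m mxR k)) * pairing M j f T k.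
  rewrite quasi_projection_funE.
  rewrite fourierZ; last first.
    by apply: cintegrable_sum => k _; apply: cintegrableZ; exact: shift_int.
  rewrite fourier_sum; last by move=> k; apply: cintegrableZ; exact: shift_int.
  rewrite -/c !mulr_sumr; apply: eq_bigr => k _.
  rewrite fourierZ; last exact: shift_int.
  rewrite fourier_translation//; ring.
congr (_ * _); apply: (has_csum_unique _ hz).
have hP k := has_csum_csum (hs k).
have := has_csum_sum t (fun k => has_csumZ (c * torus_char (- l) (Minv R M j *m mxR k)) (hP k)).
congr has_csum; apply/funext => l'.
have [fD _] := digits_count (R := R) (det_expmx_neq0 j).
have E : \sum_(k <- t) c * torus_char (- l) (Minv R M j *m mxR k) * pairing_term M j f T k l' =
   fourier f l' * conjc (dfourier T l') * (lattice_equiv j l l')%:R.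
  rewrite -digits_char_average fsbig_finite// mulrA mulr_sumr.
  rewrite -/c; apply: eq_bigr => k _.
  rewrite /pairing_term mxRB mulmxBr dotvDr expi2piD.
  have -> : torus_char (- l) (Minv R M j *m mxR k) = expi2pi (dotv (mxR k) (- (Mstarinv R M j *m mxR l))).
    rewrite /torus_char dotv_Minv /mxR map_mxN -mulmxN //.
  ring.
by rewrite E; case: ifP => _; rewrite ?mulr1 ?mulr0.
Qed.

End QuasiProjectionCoefficients.

(** * Convergence of lattice sums and the Hoelder estimate on a coset *)

Section LatticeSums.
Context {R : realType}.

(** Cauchy condensation: the block of terms from 2^K to 2^(K+1) is at most 2^K * 2^(-aK) = rho^K,
    and rho < 1 because a > 1. *)
Lemma pseries_bounded (a : R) : 1 < a -> exists2 C : R, 0 <= C &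
  forall L, \sum_(0 <= m < L) m.+1%:R `^ (- a) <= C.
Proof.
move=> a1; pose rho : R := 2 `^ (1 - a).
have r0 : 0 < rho by rewrite powR_gt0.
have r1 : rho < 1.
  by rewrite /rho /powR pnatr_eq0 /= -[ltRHS]expR0 ltr_expR pmulr_llt0 ?ln_gt0 ?ltr1n// subr_lt0.
have geo n : \sum_(0 <= i < n) rho ^+ i <= (1 - rho)^-1.
  suff : (\sum_(0 <= i < n) rho ^+ i) * (1 - rho) = 1 - rho ^+ n.
    move=> h; rewrite -[leRHS]mul1r ler_pdivlMr ?subr_gt0// h gerBl.
    exact/exprn_ge0/ltW.
  elim: n => [|n IH]; first by rewrite big_geq// mul0r expr0 subrr.
  by rewrite big_nat_recr//= mulrDl IH exprS; ring.
have dy K : \sum_(0 <= m < 2 ^ K) m.+1%:R `^ (- a) <= 1 + \sum_(0 <= k < K) rho ^+ k.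
  elim: K => [|K IH].
    by rewrite expn0 big_nat1 big_geq// addr0 powR1.
  rewrite (@big_cat_nat _ _ _ (2 ^ K)%N)//=; last by rewrite leq_exp2l.
  rewrite [X in _ <= _ + X]big_nat_recr//= addrA lerD//.
  apply: (@le_trans _ _ (\sum_(2 ^ K <= m < 2 ^ K.+1) ((2 ^ K)%:R `^ (- a)))).
    rewrite big_nat_cond [leRHS]big_nat_cond; apply: ler_sum => m /andP[/andP[Km _] _].
    rewrite !powRN lef_pV2 ?posrE ?powR_gt0 ?ltr0n ?expn_gt0//.
    rewrite ge0_ler_powR ?nnegrE//; first lra.
    by rewrite ler_nat leqW.
  rewrite big_const_nat iter_addr addr0 expnS mul2n -addnn addnK.
  have twoK : (2 ^ K)%:R = 2 `^ K%:R :> R by rewrite natrX powR_mulrn.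
  rewrite -[leLHS]mulr_natl twoK -powRrM -powRD ?pnatr_eq0 ?implybT//.
  rewrite /rho -powR_mulrn ?powR_ge0// -powRrM le_eqVlt; apply/orP; left.
  by apply/eqP; congr (_ `^ _); ring.
exists (1 + (1 - rho)^-1); first by rewrite addr_ge0// invr_ge0 subr_ge0 ltW.
move=> L; apply: (@le_trans _ _ (\sum_(0 <= m < 2 ^ L) m.+1%:R `^ (- a))).
  rewrite [leRHS](@big_cat_nat _ _ _ L)//=; last by rewrite ltnW// ltn_expl.
  by rewrite lerDl sumr_ge0// => m _; rewrite powR_ge0.
by rewrite (le_trans (dy L))// lerD2l.
Qed.

Context {d : nat}.
Implicit Types (n : 'cV[int]_d) (y : 'cV[R]_d) (s : seq 'cV[int]_d).

(** Recording the sign and the absolute value of each coordinate injects s into a finite box of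
    functions, over which the sum of products factors into a d-th power. The two signs turn C into
    [C + C]. *)
Lemma sum_prod_bounded (a : R) : 1 < a -> exists2 C : R, 0 <= C &
  forall s, uniq s ->
    \sum_(n <- s) \prod_(i < d) (absz (n i 0)).+1%:R `^ (- a) <= C.
Proof.
move=> a1; have [C C0 hC] := pseries_bounded a1.
exists ((C + C) ^+ d); first by rewrite exprn_ge0// addr_ge0.
move=> s us; pose ab (n : 'cV[int]_d) (i : 'I_d) : nat := absz (n i 0).
pose L := (\max_(n <- s) \max_(i < d) ab n i)%N.
have hL n i : n \in s -> (ab n i < L.+1)%N.
  move=> ns; rewrite ltnS; apply: leq_trans (leq_bigmax_seq _ ns isT).
  exact: (leq_bigmax (F := ab n) i).
pose h n : {ffun 'I_d -> bool * 'I_L.+1} :=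
  [ffun i => (n i 0 < 0, inord (ab n i))].
have h_inj : {in s &, injective h}.
  move=> n n' ns n's /ffunP E; apply/colP => i; have := E i; rewrite !ffunE => -[Es Ea].
  have := congr1 (@nat_of_ord _) Ea; rewrite !inordK ?hL// => Eab.
  have Eabs : absz (n i 0) = absz (n' i 0) := Eab.
  move: Es; case: (ltrP (n i 0) 0); case: (ltrP (n' i 0) 0) => //.
    by move=> h1 h2 _; apply: oppr_inj; rewrite -!ltz0_abs// Eabs.
  by move=> h1 h2 _; rewrite -(gez0_abs h1) -(gez0_abs h2) Eabs.
pose F (bj : bool * 'I_L.+1) : R := (bj.2 : nat).+1%:R `^ (- a).
apply: (@le_trans _ _ (\sum_(g : {ffun 'I_d -> bool * 'I_L.+1}) \prod_i F (g i))).
  rewrite (eq_big_seq (fun n => \prod_i F (h n i))); last first.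
    by move=> n ns; apply: eq_bigr => i _; rewrite /F ffunE /= inordK// hL.
  rewrite -(big_map h xpredT (fun g => \prod_i F (g i))) big_uniq /=; last first.
    by rewrite map_inj_in_uniq.
  rewrite [leRHS](bigID (mem (map h s))) /= lerDl sumr_ge0// => g _.
  by rewrite prodr_ge0// => i _; rewrite powR_ge0.
have -> : \sum_(g : {ffun 'I_d -> bool * 'I_L.+1}) \prod_i F (g i) =
    \prod_(i < d) \sum_bj F bj by rewrite (bigA_distr_bigA (fun=> F)).
rewrite prodr_const card_ord lerXn2r ?nnegrE ?addr_ge0//.
  by rewrite sumr_ge0// => i _; rewrite powR_ge0.
rewrite -(pair_bigA _ (fun b j => F (b, j))) /= big_bool.
by rewrite /F /= -(big_mkord xpredT (fun m => m.+1%:R `^ (- a))) lerD.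
Qed.

Lemma enorm_ge0 y : 0 <= enorm y.
Proof. exact: sqrtr_ge0. Qed.

Lemma coord_le_enorm y i : `|y i 0| <= enorm y.
Proof.
rewrite -sqrtr_sqr /enorm /dotv ler_wsqrtr// (bigD1 i)//= -expr2 lerDl.
by rewrite sumr_ge0// => k _; rewrite -expr2 sqr_ge0.
Qed.

Definition in_unit_cube y : Prop := forall i, `|y i 0| <= 2^-1.

(** A nonzero n_k gives |n_k + y_k| >= |n_k| - 1/2 >= |n_k|/2. Since some coordinate of n is
    nonzero, the norm is at least 1/2 as well as at least |n_i|/2; the bound is the mean of these
    two. *)
Lemma enorm_shift_lower n y i : in_unit_cube y -> n != 0 ->
  (absz (n i 0)).+1%:R / 4 <= enorm (mxR n + y).
Proof.
move=> hy n0.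
have low k : (absz (n k 0))%:R / 2 <= `|(mxR n + y) k 0| \/ n k 0 = 0.
  have [->|nk] := eqVneq (n k 0) 0; [by right|left].
  have : (1 : R) <= (absz (n k 0))%:R by rewrite ler1n absz_gt0.
  have := ler_normB ((mxR n + y) k 0) (y k 0); rewrite !mxE addrK => h1 h2.
  have h3 := hy k; have h4 : `|(n k 0)%:~R| = (absz (n k 0))%:R :> R.
    by rewrite -intr_norm -abszE.
  rewrite h4 in h1; lra.
have [k nk] : exists k, n k 0 != 0.
  apply/existsP; apply: contra_neqT n0 => /existsPn h.
  by apply/colP => k; rewrite mxE; apply/eqP; have := h k; rewrite negbK.
have e2 : 2^-1 <= enorm (mxR n + y).
  apply: le_trans (coord_le_enorm _ k); have [|/eqP h] := low k; last by rewrite h in nk.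
  have : (1 : R) <= (absz (n k 0))%:R by rewrite ler1n absz_gt0.
  lra.
have ei : (absz (n i 0))%:R / 2 <= enorm (mxR n + y).
  have [h|->] := low i; first by rewrite (le_trans h)// coord_le_enorm.
  by rewrite absz0 mul0r enorm_ge0.
rewrite -natr1; lra.
Qed.

Lemma enorm_shift_ge n y : (0 < d)%N -> in_unit_cube y -> n != 0 -> 2^-1 <= enorm (mxR n + y).
Proof.
move=> d0 hy n0.
have [k nk] : exists k, n k 0 != 0.
  apply/existsP; apply: contra_neqT n0 => /existsPn h.
  by apply/colP => k; rewrite mxE; apply/eqP; have := h k; rewrite negbK.
apply: le_trans (enorm_shift_lower k hy n0).
have : (2 : R) <= (absz (n k 0)).+1%:R by rewrite ler_nat ltnS absz_gt0.
lra.
Qed.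

(** The exponent is shared equally among the coordinates: |n + y|^-beta is a product of d factors |n
    + y|^(-beta/d), each at most ((|n_i| + 1)/4)^(-beta/d), and beta/d > 1 makes the product sum
    converge. *)
Lemma lattice_sum_bounded (beta : R) : (0 < d)%N -> d%:R < beta ->
  exists2 C : R, 0 <= C & forall y s, in_unit_cube y -> uniq s -> 0 \notin s ->
    \sum_(n <- s) enorm (mxR n + y) `^ (- beta) <= C.
Proof.
move=> d0 db; have dr : 0 < d%:R :> R by rewrite ltr0n.
have a1 : 1 < beta / d%:R by rewrite ltr_pdivlMr// mul1r.
have b0 : 0 <= beta / d%:R by rewrite ltW// (lt_trans _ a1).
have [C C0 hC] := sum_prod_bounded a1.
exists (4 `^ beta * C); first by rewrite mulr_ge0 ?powR_ge0.
move=> y s hy us s0.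
apply: (@le_trans _ _ (\sum_(n <- s) 4 `^ beta *
    \prod_(i < d) (absz (n i 0)).+1%:R `^ (- (beta / d%:R)))); last first.
  by rewrite -mulr_sumr ler_wpM2l ?powR_ge0// hC.
rewrite big_seq [leRHS]big_seq; apply: ler_sum => n ns.
have n0 : n != 0 by apply: contraNneq s0 => <-.
have e0 : 0 < enorm (mxR n + y) by rewrite (lt_le_trans _ (enorm_shift_ge d0 hy n0)).
have prodc (c : R) : 0 <= c -> \prod_(i < d) c `^ (beta / d%:R) = c `^ beta.
  move=> c0; rewrite prodr_const card_ord -powR_mulrn ?powR_ge0// -powRrM.
  by rewrite divfK// gt_eqF.
rewrite powRN -(prodc _ (ltW e0)) -(prodc 4)// -prodfV -big_split /=.
apply: ler_prod => i _; rewrite invr_ge0 powR_ge0/=.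
have hm := enorm_shift_lower i hy n0.
set m : R := (absz (n i 0)).+1%:R in hm *.
have m0 : 0 < m by rewrite ltr0n.
have -> : 4 `^ (beta / d%:R) * m `^ (- (beta / d%:R)) = ((m / 4) `^ (beta / d%:R))^-1.
  rewrite powRM ?(ltW m0) ?invr_ge0// invfM mulrC powRN; congr (_ * _).
  by rewrite -[4^-1]powR_inv1// -powRrM mulN1r powRN invrK.
rewrite lef_pV2 ?posrE ?powR_gt0 ?divr_gt0//.
by apply: ge0_ler_powR => //; rewrite nnegrE; [apply: divr_ge0 => //|]; exact: ltW.
Qed.

(** The case q = 1: off the origin 2 |n + y| >= 1, so the exponent N may be raised to gamma at the
    cost of 2^(gamma - N). *)
Lemma tail_sum_bounded1 (N gamma : R) : (0 < d)%N -> N <= gamma ->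
  exists2 C : R, 0 <= C & forall y s (u : 'cV[int]_d -> R) (tau : R),
    in_unit_cube y -> uniq s -> 0 \notin s -> (forall n, 0 <= u n) ->
    \sum_(n <- s) enorm (mxR n + y) `^ gamma * u n <= tau ->
    \sum_(n <- s) enorm (mxR n + y) `^ N * u n <= C * tau.
Proof.
move=> d0 Ng; exists (2 `^ (gamma - N)); first exact: powR_ge0.
move=> y s u tau hy us s0 u0 htau.
apply: (@le_trans _ _ (\sum_(n <- s) 2 `^ (gamma - N) * (enorm (mxR n + y) `^ gamma * u n))).
  rewrite big_seq [leRHS]big_seq; apply: ler_sum => n ns; rewrite mulrA ler_wpM2r//.
  have n0 : n != 0 by apply: contraNneq s0 => <-.
  have e2 := enorm_shift_ge d0 hy n0; set e := enorm _ in e2 *.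
  have e0 : 0 < e by lra.
  have -> : e `^ gamma = e `^ (gamma - N) * e `^ N.
    by rewrite -powRD ?(gt_eqF e0) ?implybT// subrK.
  rewrite mulrA ler_peMl ?powR_ge0//.
  rewrite -powRM ?(ltW e0)//; apply: (@le_trans _ _ (1 `^ (gamma - N))); first by rewrite powR1.
  apply: ge0_ler_powR; rewrite ?nnegrE ?subr_ge0//; first by rewrite mulr_ge0// ltW.
  lra.
by rewrite -mulr_sumr ler_wpM2l ?powR_ge0.
Qed.

(** Hoelder through Young's inequality, term by term after division by tau. The powers |n +
    y|^(-(gamma - N)p) are summable because (gamma - N)p > d and account for C; the normalised q-th
    powers account for the 1 in [C + 1]. *)
Lemma tail_sum_bounded (p q N gamma : R) : (0 < d)%N -> 2 <= p -> p^-1 + q^-1 = 1 ->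
  N + d%:R / p < gamma ->
  exists2 C : R, 0 <= C & forall y s (u : 'cV[int]_d -> R) (tau : R),
    in_unit_cube y -> uniq s -> 0 \notin s -> (forall n, 0 <= u n) -> 0 < tau ->
    \sum_(n <- s) (enorm (mxR n + y) `^ gamma * u n) `^ q <= tau `^ q ->
    \sum_(n <- s) enorm (mxR n + y) `^ N * u n <= C * tau.
Proof.
move=> d0 p2 pq Ng; have p0 : 0 < p by lra.
have pi2 : 0 < p^-1 <= 2^-1 by rewrite invr_gt0 p0 lef_pV2 ?posrE.
have q0 : 0 < q by rewrite -invr_gt0; lra.
have db : d%:R < (gamma - N) * p by rewrite -ltr_pdivrMr//; lra.
have [C C0 hC] := lattice_sum_bounded d0 db.
exists (C + 1); first by rewrite addr_ge0.
move=> y s u tau hy us s0 u0 tau0 htau.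
apply: (@le_trans _ _ (\sum_(n <- s) tau * (enorm (mxR n + y) `^ (- ((gamma - N) * p)) / p +
   (tau^-1 * (enorm (mxR n + y) `^ gamma * u n)) `^ q / q))).
  rewrite big_seq [leRHS]big_seq; apply: ler_sum => n ns.
  have n0 : n != 0 by apply: contraNneq s0 => <-.
  have e2 := enorm_shift_ge d0 hy n0; set e := enorm _ in e2 *.
  have e0 : 0 < e by lra.
  have := @conjugate_powR _ (e `^ (N - gamma)) (tau^-1 * (e `^ gamma * u n)) p q
    (powR_ge0 _ _).
  rewrite !mulr_ge0 ?invr_ge0 ?powR_ge0 ?(ltW tau0)// => /(_ isT p0 q0 pq).
  rewrite -powRrM (_ : (N - gamma) * p = - ((gamma - N) * p)); last by ring.
  have -> : e `^ (N - gamma) * (tau^-1 * (e `^ gamma * u n)) = tau^-1 * (e `^ N * u n).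
    rewrite mulrCA; congr (_ * _); rewrite mulrA -powRD ?(gt_eqF e0) ?implybT//.
    by rewrite subrK.
  by rewrite ler_pdivrMl.
rewrite -mulr_sumr mulrC ler_wpM2r ?(ltW tau0)// big_split /= lerD//.
  rewrite -mulr_suml ler_pdivrMr//; apply: le_trans (hC y s hy us s0) _.
  by rewrite ler_peMr//; lra.
rewrite -mulr_suml ler_pdivrMr// mul1r.
have q1 : 1 <= q.
  by rewrite -[q]invrK invf_ge1 ?invr_gt0//; lra.
apply: le_trans q1.
apply: (@le_trans _ _ (\sum_(n <- s) (tau `^ q)^-1 * (enorm (mxR n + y) `^ gamma * u n) `^ q)).
  apply: ler_sum => n _; set x := _ * u n.
  have x0 : 0 <= x by rewrite mulr_ge0// powR_ge0.
  rewrite (powRM _ _ x0) ?invr_ge0 ?(ltW tau0)// le_eqVlt; apply/orP; left.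
  by apply/eqP; congr (_ * _); rewrite -[tau^-1]powR_inv1 ?(ltW tau0)// -powRrM mulN1r powRN.
by rewrite -mulr_sumr ler_pdivrMl ?powR_gt0// mulr1.
Qed.

End LatticeSums.

(** * Operator norms and powers of the inverse matrix *)

Section OperatorNorm.
Context {R : realType} {d : nat}.
Implicit Types (A : 'M[R]_d) (x : 'cV[R]_d).

Definition entry_sum A : R := \sum_i \sum_j `|A i j|.

Lemma enorm_le_sum x : enorm x <= \sum_i `|x i 0|.
Proof.
have S0 : 0 <= \sum_i `|x i 0| by rewrite sumr_ge0.
rewrite -[leRHS]ger0_norm// -sqrtr_sqr /enorm ler_wsqrtr// /dotv expr2 mulr_suml.
apply: ler_sum => i _; rewrite mulr_sumr (bigD1 i)//= -[leLHS]addr0.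
by rewrite lerD ?sumr_ge0// -normrM ler_norm.
Qed.

Lemma enorm_mulmx_entry A x : enorm x <= 1 -> enorm (A *m x) <= entry_sum A.
Proof.
move=> x1; rewrite (le_trans (enorm_le_sum _))//; apply: ler_sum => i _.
rewrite mxE (le_trans (ler_norm_sum _ _ _))//; apply: ler_sum => j _.
by rewrite normrM ler_piMr// (le_trans (coord_le_enorm _ _)).
Qed.

Lemma enorm0 : enorm (0 : 'cV[R]_d) = 0.
Proof.
rewrite /enorm /dotv big1 ?sqrtr0// => i _.
by rewrite mxE mul0r.
Qed.

Lemma opnorm_le_entry A : opnorm A <= entry_sum A.
Proof.
apply: ge_sup; first by exists (enorm (A *m 0)), 0 => //=; rewrite enorm0.
by move=> _ [x /= x1 <-]; exact: enorm_mulmx_entry.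
Qed.

Lemma le_opnorm A x : enorm x <= 1 -> enorm (A *m x) <= opnorm A.
Proof.
move=> x1; apply: ub_le_sup; last by exists x.
by exists (entry_sum A) => _ [y /= y1 <-]; exact: enorm_mulmx_entry.
Qed.

Lemma opnorm_ge0 A : 0 <= opnorm A.
Proof. by apply: le_trans (enorm_ge0 _) (@le_opnorm A 0 _); rewrite enorm0. Qed.

Lemma enormZ (c : R) x : enorm (c *: x) = `|c| * enorm x.
Proof.
rewrite /enorm -sqrtr_sqr -sqrtrM ?sqr_ge0//; congr Num.sqrt.
by rewrite /dotv mulr_sumr; apply: eq_bigr => i _; rewrite !mxE; ring.
Qed.

Lemma enorm_mulmx A x : enorm (A *m x) <= opnorm A * enorm x.
Proof.
have := enorm_ge0 x; rewrite le_eqVlt => /predU1P[x0|x0].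
  have -> : x = 0.
    apply/colP => i; apply/eqP; rewrite mxE -normr_le0 x0; exact: coord_le_enorm.
  by rewrite mulmx0 enorm0 mulr0.
have := @le_opnorm A ((enorm x)^-1 *: x).
rewrite -scalemxAr !enormZ ger0_norm ?invr_ge0 ?enorm_ge0// mulVf ?gt_eqF// => /(_ (lexx _)).
by rewrite ler_pdivrMl// mulrC.
Qed.

End OperatorNorm.

Section InversePowers.
Context {R : realType}.
Local Open Scope complex_scope.

(** The entrywise l_1 norm. It is submultiplicative and dominates the operator norm of real
    matrices, and neither transposition nor passage to complex entries changes it. *)
Definition centry_sum {d} (Y : 'M[R[i]]_d) : R := \sum_i \sum_j cabs (Y i j).

Lemma centry_sum_ge0 d (Y : 'M[R[i]]_d) : 0 <= centry_sum Y.
Proof. by apply: sumr_ge0 => i _; apply: sumr_ge0 => j _; exact: cabs_ge0. Qed.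

Lemma centry_sumD d (Y Z : 'M[R[i]]_d) :
  centry_sum (Y + Z) <= centry_sum Y + centry_sum Z.
Proof.
rewrite -big_split; apply: ler_sum => i _; rewrite -big_split; apply: ler_sum => j _.
by rewrite mxE cabsD.
Qed.

Lemma centry_sumZ d (c : R[i]) (Y : 'M[R[i]]_d) :
  centry_sum (c *: Y) = cabs c * centry_sum Y.
Proof.
rewrite mulr_sumr; apply: eq_bigr => i _; rewrite mulr_sumr; apply: eq_bigr => j _.
by rewrite mxE Normc.normcM.
Qed.

Lemma centry_sumM d (Y Z : 'M[R[i]]_d) :
  centry_sum (Y *m Z) <= centry_sum Y * centry_sum Z.
Proof.
rewrite mulr_suml; apply: ler_sum => i _.
apply: (@le_trans _ _ (\sum_j \sum_k cabs (Y i k) * cabs (Z k j))).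
  apply: ler_sum => j _; rewrite mxE (le_trans (cabs_sum _ _ _))//.
  by apply: ler_sum => k _; rewrite Normc.normcM.
rewrite exchange_big /= mulr_suml; apply: ler_sum => k _.
rewrite -mulr_sumr ler_wpM2l ?cabs_ge0// /centry_sum [leRHS](bigD1 k)//= lerDl.
by apply: sumr_ge0 => l _; apply: sumr_ge0 => j _; exact: cabs_ge0.
Qed.

Definition decays {d} (B : 'M[R[i]]_d.+1) (theta : R) (Y : 'M[R[i]]_d.+1) : Prop :=
  exists C, forall j, centry_sum (B ^+ j *m Y) <= C * theta ^- j.

(* Peels one factor off the product of the A - z over the eigenvalues z, which
   vanishes by Cayley-Hamilton. *)
Lemma decays_step d (A B Y : 'M[R[i]]_d.+1) (theta : R) (z : R[i]) :
  0 < theta -> theta < cabs z -> B *m A = 1%:M ->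
  decays B theta ((A - z%:M) *m Y) -> decays B theta Y.
Proof.
move=> t0 tz BA [C hC]; have z0 : 0 < cabs z by exact: lt_trans tz.
have zn0 : z != 0 by rewrite -cabs0_eq gt_eqF.
(* The first summand settles j = 0. The second gives C' theta + |C| <= C' |z|, which is what the
   induction step needs. *)
set C' := centry_sum Y + `|C| / (cabs z - theta).
have tz0 : 0 < cabs z - theta by rewrite subr_gt0.
have C'C : `|C| <= C' * (cabs z - theta).
  rewrite -ler_pdivrMr// lerDr; exact: centry_sum_ge0.
exists C'; elim=> [|j IH].
  rewrite expr0 mul1mx expr0 invr1 mulr1 lerDl divr_ge0// ltW//.
set W := (A - z%:M) *m Y in hC.
(* From B A = 1, B^(j+1) (A - z) Y = B^j Y - z B^(j+1) Y; this is solved for the last term, and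
   dividing by z provides the gain. *)
have E : B ^+ j.+1 *m Y = z^-1 *: (B ^+ j *m Y - B ^+ j.+1 *m W).
  have -> : B ^+ j.+1 *m W = B ^+ j *m Y - z *: (B ^+ j.+1 *m Y).
    rewrite /W mulmxBl mulmxBr mul_scalar_mx -scalemxAr; congr (_ - _).
    rewrite exprSr -mulmxE -[_ *m B *m _]mulmxA; congr (_ *m _).
    by rewrite mulmxA BA mul1mx.
  by rewrite opprB addrCA subrr addr0 scalerA mulVf// scale1r.
rewrite E centry_sumZ Normc.normcV ler_pdivrMl//.
rewrite (le_trans (centry_sumD _ _))//.
have -> : centry_sum (- (B ^+ j.+1 *m W)) = centry_sum (B ^+ j.+1 *m W).
  by rewrite -scaleN1r centry_sumZ normcN Normc.normc1 mul1r.
have tj : 0 < theta ^- j.+1 by rewrite invr_gt0 exprn_gt0.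
have E2 : theta ^- j = theta * theta ^- j.+1.
  by rewrite exprS invfM mulrA divff ?mul1r// gt_eqF.
rewrite E2 in IH.
have h1 := hC j.+1.
have h2 : C * theta ^- j.+1 <= (C' * (cabs z - theta)) * theta ^- j.+1.
  by rewrite ler_wpM2r ?(ltW tj)// (le_trans (ler_norm _)).
move: IH h1 h2; set a := centry_sum _; set b := centry_sum _; set t := theta ^- j.+1.
move=> IH h1 h2; apply: (le_trans (lerD IH (le_trans h1 h2))).
rewrite le_eqVlt; apply/orP; left; apply/eqP; ring.
Qed.

(** The product of all factors A - z is 0, which decays trivially; removing the factors one at a
    time ends at the empty product, the identity. Repeated eigenvalues do no harm because theta lies
    strictly below every |z|. *)
Lemma decays_one d (A B : 'M[R[i]]_d.+1) (theta : R) : 0 < theta ->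
  B *m A = 1%:M -> (forall z, eigenvalue A z -> theta < cabs z) ->
  decays B theta 1%:M.
Proof.
move=> t0 BA hA; have [r hr] := closed_field_poly_normal (char_poly A).
have lead1 : lead_coef (char_poly A) = 1 by exact: (monicP (char_poly_monic A)).
rewrite lead1 scale1r in hr.
have rz z : z \in r -> theta < cabs z.
  move=> zr; apply: hA; rewrite eigenvalue_root_char hr root_prod_XsubC//.
have : \prod_(z <- r) (A - z%:M) = 0.
  have := Cayley_Hamilton A; rewrite hr rmorph_prod => h; rewrite -[RHS]h.
  by apply: eq_bigr => z _; rewrite rmorphB /= horner_mx_X horner_mx_C.
suff H (s : seq R[i]) : (forall z, z \in s -> theta < cabs z) ->
    decays B theta (\prod_(z <- s) (A - z%:M)) -> decays B theta 1%:M.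
  move=> h; apply: (H r) => //; rewrite h; exists 0 => j.
  rewrite mulmx0 mul0r -(scale0r (0 : 'M[R[i]]_d.+1)) centry_sumZ.
  by rewrite Normc.normc0 mul0r.
elim: s => [|z s IH] hs; first by rewrite big_nil.
rewrite big_cons => h; apply: IH.
  by move=> w ws; apply: hs; rewrite inE ws orbT.
by apply: (decays_step t0 (hs z _) BA h); rewrite inE eqxx.
Qed.

(** At the critical rate the peeling argument breaks down, as it divides by |z| - theta.
    Diagonalisation gives B^j as a conjugate of a diagonal matrix whose entries all have modulus
    rho^-j. *)
Lemma decays_diag d (A B : 'M[R[i]]_d.+1) (rho : R) (l : 'rV[R[i]]_d.+1)
    (V : 'M[R[i]]_d.+1) : 0 < rho -> B *m A = 1%:M -> V \in unitmx ->
  (forall i, cabs (l 0 i) = rho) -> V *m A = diag_mx l *m V ->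
  decays B rho 1%:M.
Proof.
move=> r0 BA uV hl VA; have l0 i : l 0 i != 0.
  by rewrite -cabs0_eq hl gt_eqF.
pose li : 'rV[R[i]]_d.+1 := \row_i (l 0 i)^-1.
have ll : diag_mx li *m diag_mx l = 1%:M.
  apply/matrixP => i k; rewrite mul_diag_mx !mxE.
  by case: eqP => _; rewrite ?mulr1n ?mulr0n ?mulr0// mulVf.
have AB : A *m B = 1%:M by exact: mulmx1C.
have VB : V *m B = diag_mx li *m V.
  have h : diag_mx l *m (V *m B) = V by rewrite mulmxA -VA -mulmxA AB mulmx1.
  by rewrite -{2}h mulmxA ll mul1mx.
have VBj j : V *m B ^+ j = (diag_mx li) ^+ j *m V.
  elim: j => [|j IH]; first by rewrite !expr0 mulmx1 mul1mx.
  by rewrite exprSr -mulmxE mulmxA IH -mulmxA VB mulmxA exprSr.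
have lij j : (diag_mx li) ^+ j = diag_mx (\row_i (li 0 i) ^+ j).
  elim: j => [|j IH].
    by rewrite expr0; apply/matrixP => i k; rewrite !mxE expr0.
  rewrite exprS IH; apply/matrixP => i k; rewrite -mulmxE mul_diag_mx !mxE.
  by case: eqP => _; rewrite ?mulr1n ?mulr0n ?mulr0// exprS.
exists (centry_sum (invmx V) * d.+1%:R * centry_sum V) => j; rewrite mulmx1.
have -> : B ^+ j = invmx V *m (diag_mx (\row_i (li 0 i) ^+ j) *m V).
  by rewrite -lij -VBj mulKmx.
rewrite (le_trans (centry_sumM _ _))// -!mulrA ler_wpM2l ?centry_sum_ge0//.
rewrite (le_trans (centry_sumM _ _))// mulrCA mulrC ler_wpM2l ?centry_sum_ge0//.
rewrite /centry_sum (eq_bigr (fun=> rho ^- j)); last first.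
  move=> i _; rewrite (bigD1 i)//= big1 ?addr0.
    by rewrite !mxE eqxx mulr1n cabsX Normc.normcV hl exprVn.
  by move=> k ki; rewrite !mxE eq_sym (negbTE ki) mulr0n Normc.normc0.
by rewrite sumr_const card_ord mulr_natl.
Qed.

End InversePowers.

Section DilationDecay.
Context {R : realType} {d : nat} (M : 'M[int]_d).
Local Open Scope complex_scope.

Lemma dilation_det_neq0 : dilation_matrix R M -> \det M != 0.
Proof.
move=> dM; apply/eqP => h.
have : \det (mxC R M) == 0 by rewrite det_map_mx h rmorph0.
case/det0P => v v0 vM; have := dM 0; rewrite Normc.normc0 ltr10 => /(_ _)/negP; apply => //.
by apply/eigenvalueP; exists v => //; rewrite vM scale0r.
Qed.

Lemma map_mx_real_int : map_mx (real_complex R) (mxR M) = mxC R M.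
Proof. by apply/matrixP => i j; rewrite !mxE rmorph_int. Qed.

End DilationDecay.

Lemma opnorm_decay (R : realType) (d : nat) (M : 'M[int]_d.+1) (theta : R) :
  \det M != 0 -> decays (invmx (mxC R M)) theta 1%:M ->
  exists2 C : R, 0 <= C & forall j, opnorm (Mstarinv R M j) <= C * theta ^- j.
Proof.
move=> detM [C hC].
have uM : mxR M \in @unitmx R d.+1 := mxR_unit detM.
have C0 : 0 <= C by have := hC 0%N; rewrite [theta ^- 0]invr1 mulr1; apply: le_trans; exact: centry_sum_ge0.
exists C => // j; apply: le_trans (opnorm_le_entry _) _; apply: le_trans (hC j).
have mxRX i : mxR (M ^+ i) = mxR M ^+ i :> 'M[R]_d.+1 by rewrite /mxR rmorphXn.
have E : map_mx (real_complex R) (Minv R M j) = (invmx (mxC R M)) ^+ j.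
  rewrite /Minv mxRX map_invmx rmorphXn /= map_mx_real_int.
  by rewrite -[invmx (mxC R M ^+ j)]/((mxC R M ^+ j)^-1) exprVn.
rewrite mulmx1 -E Mstarinv_tr /entry_sum exchange_big /=.
apply: ler_sum => i _; apply: ler_sum => k _; rewrite !mxE cabs_real//.
Qed.

(** * Weighted l_q sums and summation over cosets *)

Section WeightedSums.
Context {R : realType} {d : nat}.
Implicit Types (D : set 'cV[int]_d) (u v : 'cV[int]_d -> R) (q : R).

Lemma sum_le_esum_on (K : choiceType) (a : K -> R) (D : set K) s :
  uniq s -> (forall k, k \in s -> D k) ->
  ((\sum_(k <- s) a k)%:E <= \esum_(k in D) (a k)%:E)%E.
Proof.
move=> us sD; apply: esum_ge; exists [set` s].
  by split => // k /= ks; exact: sD.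
by rewrite -fsbig_seq// sumEFin.
Qed.

Lemma lq_norm_fin q D u : 0 < q -> (lq_norm q D u < +oo)%E ->
  exists2 e : R, 0 <= e & \esum_(k in D) (`|u k| `^ q)%:E = e%:E.
Proof.
move=> q0 /lty_poweRy h; have {}h := h (lt0r_neq0 _).
have e0 : (0 <= \esum_(k in D) (`|u k| `^ q)%:E)%E.
  by apply: esum_ge0 => k _; rewrite lee_fin powR_ge0.
have fe : \esum_(k in D) (`|u k| `^ q)%:E \is a fin_num.
  by rewrite ge0_fin_numE// h// invr_gt0.
by exists (fine (\esum_(k in D) (`|u k| `^ q)%:E)); rewrite ?fine_ge0// fineK.
Qed.

Lemma lq_norm_le q (c : R) D D' u v : 0 < q -> 0 <= c -> D `<=` D' ->
  (forall k, D k -> `|u k| <= c * `|v k|) -> (lq_norm q D' v < +oo)%E ->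
  (lq_norm q D u <= c%:E * lq_norm q D' v)%E.
Proof.
move=> q0 c0 DD uv /(lq_norm_fin q0)[e e0 he].
rewrite /lq_norm he poweR_EFin -EFinM.
apply: (@le_trans _ _ ((c `^ q * e)%:E `^ q^-1)%E).
  apply: gt0_ler_poweR; first by rewrite invr_ge0 ltW.
  - by rewrite in_itv/= leey andbT; apply: esum_ge0 => k _; rewrite lee_fin powR_ge0.
  - by rewrite in_itv/= leey andbT lee_fin mulr_ge0// powR_ge0.
  apply: esum_le_sum => s us sD.
  apply: (@le_trans _ _ (c `^ q * \sum_(k <- s) `|v k| `^ q)%:E).
    rewrite lee_fin mulr_sumr big_seq [leRHS]big_seq; apply: ler_sum => k ks.
    rewrite -powRM ?normr_ge0//; apply: ge0_ler_powR; rewrite ?nnegrE ?mulr_ge0 ?(ltW q0)//.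
    exact: uv (sD _ ks).
  rewrite lee_fin ler_wpM2l ?powR_ge0// -lee_fin -he sum_le_esum_on// => k ks.
  exact: DD (sD _ ks).
by rewrite poweR_EFin powRM ?powR_ge0// -powRrM divff ?gt_eqF// powRr1.
Qed.

Lemma conjugate_exponent_ge1 (p : \bar R) q : (2%:E <= p)%E ->
  (p^-1 + q%:E^-1 = 1)%E -> 1 <= q.
Proof.
case: p => [p| |//] p2 pq.
  have {}p2 : 2 <= p by [].
  have p0 : 0 < p by lra.
  have q0 : q != 0.
    by apply/eqP => h; move: pq; rewrite !inver (gt_eqF p0) h eqxx.
  have {}pq : p^-1 + q^-1 = 1.
    by move: pq; rewrite !inver (gt_eqF p0) (negbTE q0) => -[].
  have pi0 : 0 < p^-1 <= 2^-1 by rewrite invr_gt0 p0 lef_pV2 ?posrE.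
  have qi : 0 < q^-1 <= 1 by lra.
  have q0' : 0 < q by rewrite -invr_gt0; lra.
  rewrite -[q]invrK -[leLHS]invr1 lef_pV2 ?posrE ?invr_gt0//; lra.
move: pq; rewrite invey add0e inver; case: eqP => // _ [] h.
by rewrite -[q]invrK h invr1.
Qed.

(** Joins the cases q = 1 and q > 1; for q > 1 the exponent p is finite, since an infinite p forces
    q = 1. *)
Lemma tail_sum (p : \bar R) q (N gamma : R) : (0 < d)%N ->
  (2%:E <= p)%E -> (p^-1 + q%:E^-1 = 1)%E ->
  (q != 1 -> (N%:E + d%:R%:E / p < gamma%:E)%E) -> (q = 1 -> N <= gamma) ->
  exists2 C : R, 0 <= C & forall y s u (e : R),
    in_unit_cube y -> uniq s -> 0 \notin s -> (forall n, 0 <= u n) -> 0 <= e ->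
    \sum_(n <- s) (enorm (mxR n + y) `^ gamma * u n) `^ q <= e ->
    \sum_(n <- s) enorm (mxR n + y) `^ N * u n <= C * e `^ q^-1.
Proof.
move=> d0 p2 pq g g1; have q1 := conjugate_exponent_ge1 p2 pq.
have q0 : 0 < q by lra.
have [qE|qn] := eqVneq q 1.
  have [C C0 HC] := tail_sum_bounded1 d0 (g1 qE).
  exists C => // y s u e hy us s0 u0 e0.
  rewrite qE invr1 powRr1// => he; apply: HC => //.
  apply: le_trans he; apply: ler_sum => n _.
  by rewrite powRr1// mulr_ge0 ?powR_ge0.
have {}g := g qn; case: p p2 pq g => [p| |//] p2 pq g; last first.
  move: pq; rewrite invey add0e inver; case: eqP => // _ [] h.
  by move: qn; rewrite -[q]invrK h invr1 eqxx.
have {}p2 : 2 <= p by [].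
have p0 : 0 < p by lra.
have {}pq : p^-1 + q^-1 = 1.
  by move: pq; rewrite !inver (gt_eqF p0) (gt_eqF q0) => -[].
have {}g : N + d%:R / p < gamma by move: g; rewrite inver (gt_eqF p0).
have [C C0 HC] := tail_sum_bounded d0 p2 pq g.
exists C => // y s u e hy us s0 u0 e0 he; apply/ler_addgt0Pr => eps eps0.
(* [tail_sum_bounded] wants a positive bound while e may be 0; the increment is small enough to cost
   at most eps after multiplication by C. *)
pose t := e `^ q^-1 + eps / (C + 1).
have C1 : 0 < C + 1 by lra.
have t0 : 0 < t by rewrite ltr_wpDl ?powR_ge0// divr_gt0.
have /le_trans : \sum_(n <- s) enorm (mxR n + y) `^ N * u n <= C * t.
  apply: HC => //; apply: (le_trans he).
  have {1}-> : e = (e `^ q^-1) `^ q by rewrite -powRrM mulVf ?gt_eqF// powRr1.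
  apply: ge0_ler_powR; rewrite ?nnegrE ?powR_ge0 ?(ltW q0) ?(ltW t0)//.
  by rewrite lerDl divr_ge0 ?ltW.
apply; rewrite /t mulrDr lerD2l mulrA ler_pdivrMr// mulrC ler_pM2l//; lra.
Qed.

End WeightedSums.

Section CosetSums.
Context {R : realType} {d : nat} (A : 'M[int]_d).
Hypothesis detA : \det A != 0.
Implicit Types (t : 'cV[int]_d -> R) (r n l : 'cV[int]_d).

Lemma coset_sum_le t r (B : R) : digits R A r ->
  (forall s, uniq s -> 0 \notin s -> \sum_(n <- s) t (A *m n + r) <= B) ->
  forall s, uniq s ->
    \sum_(l <- s | (l != r) && (lattice_rem (R := R) A l == r)) t l <= B.
Proof.
move=> hr hB s us; rewrite -big_filter.
set s' := [seq l <- s | _].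
have s'P l : l \in s' -> l != r /\ l = A *m lattice_quot (R := R) A l + r.
  rewrite mem_filter => /andP[/andP[lr /eqP h] _]; split=> //.
  by rewrite -{1}h -lattice_divE.
have := hB (map (lattice_quot (R := R) A) s').
rewrite big_map.
have -> : \sum_(l <- s') t (A *m lattice_quot (R := R) A l + r) = \sum_(l <- s') t l.
  by apply: eq_big_seq => l /s'P[_ <-].
apply.
  rewrite map_inj_in_uniq ?filter_uniq// => l l' /s'P[_ h] /s'P[_ h'] E.
  by rewrite h h' E.
apply/mapP => -[l /s'P[lr h] h0].
by move: lr; rewrite h -h0 mulmx0 add0r eqxx.
Qed.

(** There are finitely many cosets, and each contributes its representative, the term n = 0, plus at
    most [B r]. *)
Lemma summable_cosets t (B : 'cV[int]_d -> R) : (forall l, 0 <= t l) ->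
  (forall r, digits R A r -> forall s, uniq s -> 0 \notin s ->
     \sum_(n <- s) t (A *m n + r) <= B r) ->
  (\esum_(l in setT) (t l)%:E < +oo)%E.
Proof.
move=> t0 hB; have [fD _] := digits_count (R := R) detA.
rewrite (@esum_lattice _ _ A detA (fun l => (t l)%:E)); last by move=> l; rewrite lee_fin.
have B0 r : digits R A r -> 0 <= B r by move=> hr; have := hB r hr [::]; rewrite big_nil; apply.
apply: (@le_lt_trans _ _ (\esum_(r in digits R A) (t r + B r)%:E)%E).
  apply: le_esum => r hr; apply: esum_le_sum => s us _.
  rewrite (bigID (fun n => n == 0)) /= lee_fin lerD//.
    have [s0|s0] := boolP (0 \in s).
      by rewrite -big_filter (filter_pred1_uniq us s0) big_seq1 mulmx0 add0r.
    rewrite big_seq_cond big1// => i /andP[ins /eqP i0].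
    by move: ins; rewrite i0 (negbTE s0).
  rewrite -big_filter; apply: (hB r hr).
    by rewrite filter_uniq.
  by rewrite mem_filter eqxx.
rewrite esum_fset//; last first.
  by move=> r /set_mem hr; rewrite lee_fin addr_ge0 ?B0.
by rewrite fsbig_finite// sumEFin ltry.
Qed.

End CosetSums.

(** * The pairing series restricted to one coset *)

Section CosetError.
Context {R : realType} {d : nat} (M : 'M[int]_d).
Hypothesis detM : \det M != 0.
Context (j : nat).
Local Notation A := (M^T ^+ j).
Let detA : \det A != 0 := det_trexpmx_neq0 detM j.
Let w (l : 'cV[int]_d) : R := enorm (Mstarinv R M j *m mxR l).
Local Open Scope complex_scope.
Implicit Types (r n l : 'cV[int]_d).

Lemma Mstarinv_coset n r :
  Mstarinv R M j *m mxR (A *m n + r) = mxR n + Mstarinv R M j *m mxR r.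
Proof.
have uA := mxR_unit (R := R) detA.
by rewrite mxRD mxRM mulmxDr /Mstarinv mulKmx.
Qed.

Lemma Dstar_unit_cube r : Dstar R M j r -> in_unit_cube (Mstarinv R M j *m mxR r).
Proof.
move=> /(digitsP detA) h i; have /andP[h1 h2] := h i.
by rewrite ler_norml h1 ltW.
Qed.

Lemma Dstar_coset n r : Dstar R M j r -> Dstar R M j (A *m n + r) -> n = 0.
Proof. by move=> hr hl; have [] := digits_unique detA hl hr erefl. Qed.

Lemma lattice_rem_Dstar r : Dstar R M j r -> lattice_rem (R := R) A r = r.
Proof. by move=> hr; have := lattice_rem_eq detA 0 hr; rewrite mulmx0 add0r. Qed.

Context (f : 'cV[R]_d -> R[i]) (T : periodic_distribution R d) (q N gamma CT K : R).
Let a l : R := cabs (fourier f l).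
Let t l : R := a l * cabs (dfourier T l).

(** The l-th term of the q-th power of the rescaled outer norm, extended by 0 over the digits so
    that it can be summed over entire cosets. *)
Definition outer_mass l : R :=
  if `[< Dstar R M j l >] then 0 else (w l `^ gamma * a l) `^ q.

Lemma outer_mass_ge0 l : 0 <= outer_mass l.
Proof. by rewrite /outer_mass; case: ifP => // _; exact: powR_ge0. Qed.

Lemma outer_mass_coset n r : n != 0 -> Dstar R M j r ->
  outer_mass (A *m n + r) = (w (A *m n + r) `^ gamma * a (A *m n + r)) `^ q.
Proof.
move=> n0 hr; rewrite /outer_mass; case: asboolP => // /(Dstar_coset hr) h.
by rewrite h eqxx in n0.
Qed.

Hypothesis CT0 : 0 <= CT.
Hypothesis T_out : forall l, ~ Dstar R M j l -> cabs (dfourier T l) <= CT * w l `^ N.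
Hypothesis T_in : forall l, Dstar R M j l -> cabs (dfourier T l) <= CT.
Hypothesis tail : forall y s u (e : R),
  in_unit_cube y -> uniq s -> 0 \notin s -> (forall n, 0 <= u n) -> 0 <= e ->
  \sum_(n <- s) (enorm (mxR n + y) `^ gamma * u n) `^ q <= e ->
  \sum_(n <- s) enorm (mxR n + y) `^ N * u n <= K * e `^ q^-1.

Context (E : R).
Hypothesis outE : (\esum_(l in setT) (outer_mass l)%:E <= E%:E)%E.

Definition coset_mass r : R := fine (\esum_(n in setT) (outer_mass (A *m n + r))%:E).

Lemma coset_massE r : Dstar R M j r ->
  \esum_(n in setT) (outer_mass (A *m n + r))%:E = (coset_mass r)%:E.
Proof.
move=> hr; rewrite fineK// ge0_fin_numE; last first.
  by apply: esum_ge0 => n _; rewrite lee_fin outer_mass_ge0.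
apply: le_lt_trans (ltry E); apply: le_trans outE; apply: esum_le_sum => s us _.
rewrite -(big_map (fun n => A *m n + r) predT outer_mass); apply: sum_le_esum_on => //.
rewrite map_inj_uniq// => n n' /addIr E1; apply/eqP; rewrite -subr_eq0; apply/eqP.
have h : r = A *m (n - n') + r by rewrite mulmxBr E1 subrr add0r.
by have [] := digits_unique detA hr hr h.
Qed.

Lemma coset_mass_ge0 r : 0 <= coset_mass r.
Proof. by apply/fine_ge0/esum_ge0 => n _; rewrite lee_fin outer_mass_ge0. Qed.

Lemma coset_mass_sum s : uniq s -> (forall r, r \in s -> Dstar R M j r) ->
  \sum_(r <- s) coset_mass r <= E.
Proof.
move=> us sD; rewrite -lee_fin; apply: le_trans outE.
rewrite (@esum_lattice _ _ A detA (fun l => (outer_mass l)%:E)); last first.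
  by move=> l; rewrite lee_fin outer_mass_ge0.
by rewrite (eq_esum coset_massE); apply: sum_le_esum_on.
Qed.

Lemma coset_mass_ge r s : Dstar R M j r -> uniq s ->
  \sum_(n <- s) outer_mass (A *m n + r) <= coset_mass r.
Proof.
move=> hr us; rewrite -lee_fin -coset_massE//; exact: sum_le_esum_on.
Qed.

(** Points of the coset other than r lie outside the digit set, so the growth condition applies to
    them. With M^{*-j} l = n + y it produces the weight |n + y|^N, to which [tail] applies. *)
Lemma coset_pairing_le r s : Dstar R M j r -> uniq s -> 0 \notin s ->
  \sum_(n <- s) t (A *m n + r) <= CT * K * coset_mass r `^ q^-1.
Proof.
move=> hr us s0; have n0 n : n \in s -> n != 0 by apply: contraTneq => ->.
rewrite -mulrA; apply: (@le_trans _ _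
    (CT * \sum_(n <- s) enorm (mxR n + Mstarinv R M j *m mxR r) `^ N * a (A *m n + r))).
  rewrite mulr_sumr big_seq [leRHS]big_seq; apply: ler_sum => n /n0 ns.
  rewrite -Mstarinv_coset mulrA [t _]mulrC ler_wpM2r ?cabs_ge0//; apply: T_out.
  by move=> /(Dstar_coset hr) h; rewrite h eqxx in ns.
rewrite ler_wpM2l//; apply: tail => //; first exact: Dstar_unit_cube.
- by move=> n; exact: cabs_ge0.
- exact: coset_mass_ge0.
apply: le_trans (coset_mass_ge hr us).
rewrite big_seq [leRHS]big_seq; apply: ler_sum => n /n0 ns.
by rewrite (outer_mass_coset ns hr) /w Mstarinv_coset; exact: lexx.
Qed.

Lemma cabs_pairing_term k l : cabs (pairing_term M j f T k l) = t l.
Proof. by rewrite /pairing_term !Normc.normcM cabs_expi2pi mulr1 cabs_conj. Qed.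

Lemma summable_pairing_majorant : (\esum_(l in setT) (t l)%:E < +oo)%E.
Proof.
apply: (summable_cosets detA (B := fun r => CT * K * coset_mass r `^ q^-1)).
  by move=> l; rewrite mulr_ge0 ?cabs_ge0.
by move=> r hr s us s0; exact: coset_pairing_le.
Qed.

Lemma csummable_pairing k : csummable (pairing_term M j f T k).
Proof.
apply: le_lt_trans summable_pairing_majorant; apply: le_esum => l _.
by rewrite gee0_abs ?lee_fin ?cabs_ge0// cabs_pairing_term.
Qed.

Definition coset_pairing l : R[i] :=
  csum (fun l' => if lattice_equiv (R := R) M j l l' then
    fourier f l' * conjc (dfourier T l') else 0).

Lemma has_csum_coset l : has_csum (fun l' =>
    if lattice_equiv (R := R) M j l l' then fourier f l' * conjc (dfourier T l') else 0)
  (coset_pairing l).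
Proof.
apply: has_csum_csum; apply: le_lt_trans summable_pairing_majorant.
apply: le_esum => l' _; rewrite gee0_abs ?lee_fin ?cabs_ge0//.
case: ifP => _; first by rewrite Normc.normcM cabs_conj.
by rewrite Normc.normc0 mulr_ge0 ?cabs_ge0.
Qed.

Lemma coset_pairing_eq n r : Dstar R M j r ->
  coset_pairing (A *m n + r) = coset_pairing r.
Proof.
move=> hr; rewrite /coset_pairing; congr csum; apply/funext => l'.
by rewrite /lattice_equiv (lattice_rem_eq detA n hr) (lattice_rem_Dstar hr).
Qed.

Lemma coset_pairing_approx r : Dstar R M j r ->
  cabs (coset_pairing r - fourier f r * conjc (dfourier T r))
  <= CT * K * coset_mass r `^ q^-1.
Proof.
move=> hr; set z1 := fourier f r * _.
have remr := lattice_rem_Dstar hr.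
(* The term at r is removed by adding a family supported at r alone, so the difference is again an
   unordered sum and can be bounded termwise. *)
pose u1 l := if l == r then - z1 else 0.
have h1 : has_csum u1 (- z1).
  have := @has_csum_finite _ _ u1 [:: r] isT.
  rewrite big_seq1 /u1 eqxx; apply=> k; rewrite inE => /negbTE-> //.
apply: (has_csum_bound (has_csumD (has_csum_coset r) h1)) => s us.
have h := @coset_sum_le _ _ A t r _ hr (fun s us s0 => coset_pairing_le hr us s0) s us.
apply: (le_trans _ h).
rewrite [leRHS]big_mkcond; apply: ler_sum => l _; rewrite /u1 /lattice_equiv remr.
have [->|lr] /= := eqVneq l r.
  by rewrite remr eqxx subrr Normc.normc0.
by case: ifP => _; rewrite addr0 ?Normc.normc0// Normc.normcM cabs_conj.
Qed.

End CosetError.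

Section CoefficientSums.
Context {R : realType} {d : nat}.
Implicit Types (r n l : 'cV[int]_d) (q : R).

(** The sum of three numbers is at most three times the largest, and the q-th power of the largest
    is one of the summands on the right. *)
Lemma powR_add3_le q (x y z : R) : 1 <= q -> 0 <= x -> 0 <= y -> 0 <= z ->
  (x + y + z) `^ q <= 3 `^ q * (x `^ q + y `^ q + z `^ q).
Proof.
move=> q1 x0 y0 z0; have q0 : 0 <= q by lra.
have x' := powR_ge0 x q; have y' := powR_ge0 y q; have z' := powR_ge0 z q.
have step u : 0 <= u -> u `^ q <= x `^ q + y `^ q + z `^ q -> x + y + z <= 3 * u ->
    (x + y + z) `^ q <= 3 `^ q * (x `^ q + y `^ q + z `^ q).
  move=> u0 hu hs; apply: (@le_trans _ _ ((3 * u) `^ q)).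
    by apply: ge0_ler_powR; rewrite ?nnegrE ?addr_ge0 ?mulr_ge0.
  by rewrite powRM// ler_wpM2l// powR_ge0.
have [xy|yx] := leP x y; have [xz|zx] := leP x z; have [yz|zy] := leP y z.
- by apply: (step z); lra.
- by apply: (step y); lra.
- by apply: (step z); lra.
- by apply: (step y); lra.
- by apply: (step z); lra.
- by apply: (step z); lra.
- by apply: (step x); lra.
- by apply: (step x); lra.
Qed.

Context (A : 'M[int]_d).
Hypothesis detA : \det A != 0.

(** Isolates the double summation. The part of the error depending on n only through [beta] is
    summed over n first, the l_q bound on [beta] coming out as B; the remaining part Y is a full sum
    over Z^d split into cosets. *)
Lemma coset_powR_sum q (G Y X e beta : 'cV[int]_d -> R) (c B EX EY : R) : 1 <= q ->
  (forall l, 0 <= Y l) -> (forall r, 0 <= X r) -> (forall r, 0 <= e r) ->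
  (forall n, 0 <= beta n) -> 0 <= c -> (forall l, 0 <= G l) ->
  (forall n r, digits R A r ->
     G (A *m n + r) <= beta n * (X r + e r `^ q^-1) + c * Y (A *m n + r) `^ q^-1) ->
  (forall s, uniq s -> \sum_(n <- s) beta n `^ q <= B) ->
  (forall r s, digits R A r -> uniq s -> \sum_(n <- s) Y (A *m n + r) <= e r) ->
  (forall s, uniq s -> (forall r, r \in s -> digits R A r) ->
     \sum_(r <- s) X r `^ q <= EX) ->
  (forall s, uniq s -> (forall r, r \in s -> digits R A r) ->
     \sum_(r <- s) e r <= EY) ->
  (\esum_(l in setT) (G l `^ q)%:E <=
    (3 `^ q * (B * (EX + EY) + c `^ q * EY))%:E)%E.
Proof.
move=> q1 Y0 X0 e0 b0 c0 G0 hG hB hY hX hE; have q0 : 0 < q by lra.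
have B0 : 0 <= B by have := hB [::]; rewrite big_nil; apply.
have powK x : 0 <= x -> (x `^ q^-1) `^ q = x.
  by move=> x0; rewrite -powRrM mulVf ?gt_eqF// powRr1.
rewrite (@esum_lattice _ _ A detA (fun l => (G l `^ q)%:E)); last first.
  by move=> l; rewrite lee_fin powR_ge0.
pose H r := 3 `^ q * (B * (X r `^ q + e r) + c `^ q * e r).
apply: (@le_trans _ _ (\esum_(r in digits R A) (H r)%:E)%E).
  apply: le_esum => r hr; apply: esum_le_sum => s us _; rewrite lee_fin.
  apply: (@le_trans _ _ (\sum_(n <- s) 3 `^ q *
      (beta n `^ q * (X r `^ q + e r) + c `^ q * Y (A *m n + r)))).
    apply: ler_sum => n _.
    have G1 : G (A *m n + r) <=
        beta n * X r + beta n * e r `^ q^-1 + c * Y (A *m n + r) `^ q^-1.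
      by rewrite -mulrDr; exact: hG.
    have bX : 0 <= beta n * X r by rewrite mulr_ge0.
    have be : 0 <= beta n * e r `^ q^-1 by rewrite mulr_ge0 ?powR_ge0.
    have cY : 0 <= c * Y (A *m n + r) `^ q^-1 by rewrite mulr_ge0 ?powR_ge0.
    apply: (@le_trans _ _
        ((beta n * X r + beta n * e r `^ q^-1 + c * Y (A *m n + r) `^ q^-1) `^ q)).
      by apply: ge0_ler_powR; rewrite ?nnegrE ?addr_ge0 ?(ltW q0).
    apply: (le_trans (powR_add3_le q1 bX be cY)).
    by rewrite !powRM ?powR_ge0// !powK// -(mulrDr (beta n `^ q)).
  rewrite -mulr_sumr ler_wpM2l ?powR_ge0// big_split /= -mulr_suml -mulr_sumr.
  apply: lerD; first by rewrite ler_wpM2r ?addr_ge0 ?powR_ge0 ?hB.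
  by rewrite ler_wpM2l ?powR_ge0// hY.
apply: esum_le_sum => s us sD; rewrite lee_fin -mulr_sumr ler_wpM2l ?powR_ge0//.
rewrite big_split /= -!mulr_sumr big_split /= lerD// ler_wpM2l ?powR_ge0//.
  by rewrite lerD ?hX ?hE.
exact: hE.
Qed.

End CoefficientSums.

(** * The error at a single Fourier coefficient *)

Section CoefficientError.
Context {R : realType} {d : nat} (M : 'M[int]_d).
Hypothesis d_gt0 : (0 < d)%N.
Hypothesis detM : \det M != 0.
Context (j : nat).
Local Notation A := (M^T ^+ j).
Local Notation w l := (enorm (Mstarinv R M j *m mxR l) : R).
Local Open Scope complex_scope.
Implicit Types (r n l : 'cV[int]_d).

Lemma enorm_unit_cube (y : 'cV[R]_d) : in_unit_cube y -> enorm y <= d%:R.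
Proof.
move=> hy; apply: (le_trans (enorm_le_sum _)).
apply: (@le_trans _ _ (\sum_(i < d) 1)); last by rewrite sumr_const card_ord.
by apply: ler_sum => i _; apply: (le_trans (hy i)); lra.
Qed.

(** The rescaled digit lies in the unit cube, so its norm is at most d and the surplus exponent s -
    s' costs only a power of d. *)
Lemma Dstar_powR_le r (s s' : R) : Dstar R M j r -> 0 < s' -> s' <= s ->
  w r `^ s <= d%:R `^ (s - s') * w r `^ s'.
Proof.
move=> hr s0 ss; have {1}-> : s = (s - s') + s' by ring.
have h := enorm_unit_cube (Dstar_unit_cube detM hr).
rewrite powRD ?subrK; last by rewrite gt_eqF//; lra.
rewrite ler_wpM2r ?powR_ge0//; apply: ge0_ler_powR; rewrite ?nnegrE ?enorm_ge0//; lra.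
Qed.

Context (f phi : 'cV[R]_d -> R[i]) (T : periodic_distribution R d).
Context (q N gamma s s' CT K Cphi E : R) (b : 'cV[int]_d -> R).
Let a l : R := cabs (fourier f l).
Hypothesis q1 : 1 <= q.
Hypothesis gamma0 : 0 < gamma.
Hypothesis s'0 : 0 < s'.
Hypothesis s's : s' <= s.
Hypothesis b0 : forall n, 0 <= b n.
Hypothesis K0 : 0 <= K.
Hypothesis CT0 : 0 <= CT.
Hypothesis Cphi0 : 0 <= Cphi.
Hypothesis f_int : torus_integrable f.
Hypothesis phi_int : torus_integrable phi.
Hypothesis phi_per : Zd_periodic phi.
Hypothesis T_out : forall l, ~ Dstar R M j l -> cabs (dfourier T l) <= CT * w l `^ N.
Hypothesis T_in : forall l, Dstar R M j l -> cabs (dfourier T l) <= CT.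
Hypothesis phi_sf : forall n r, n != 0 -> Dstar R M j r ->
  cabs (fourier phi (A *m n + r)) <= b n * w r `^ s.
Hypothesis compat : forall r, Dstar R M j r ->
  cabs (1 - fourier phi r * conjc (dfourier T r)) <= b 0 * w r `^ s.
Hypothesis phi_bdd : forall r, Dstar R M j r -> cabs (fourier phi r) <= Cphi.
Hypothesis tail : forall y s u (e : R),
  in_unit_cube y -> uniq s -> 0 \notin s -> (forall n, 0 <= u n) -> 0 <= e ->
  \sum_(n <- s) (enorm (mxR n + y) `^ gamma * u n) `^ q <= e ->
  \sum_(n <- s) enorm (mxR n + y) `^ N * u n <= K * e `^ q^-1.
Hypothesis outE :
  (\esum_(l in setT) (outer_mass M j f q gamma l)%:E <= E%:E)%E.

(** The first summand pays for lowering s to s', with 1 from compatibility at n = 0 and CT from the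
    digit term of z at n <> 0. The others bound the rest of z, multiplied by |y|^s <= d^s at n <> 0
    and by Cphi at n = 0. *)
Definition error_const : R :=
  d%:R `^ (s - s') * (1 + CT) + d%:R `^ s * (CT * K) + Cphi * (CT * K).

Lemma error_const_ge0 : 0 <= error_const.
Proof.
have := powR_ge0 (d%:R : R) (s - s'); have := powR_ge0 (d%:R : R) s => h1 h2.
by rewrite /error_const !addr_ge0 ?mulr_ge0 ?addr_ge0.
Qed.

(** At n = 0 the rest of z is multiplied by a coefficient of phi that is merely bounded, without a
    factor [b 0]; this is why 1 is added to b at the origin. *)
Lemma coefficient_error n r : Dstar R M j r ->
  cabs (fourier (f \- quasi_projection M j f phi T) (A *m n + r)) <=
    error_const * (b n + (n == 0)%:R) *
      (w r `^ s' * a r + coset_mass M j f q gamma r `^ q^-1)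
    + 2 `^ gamma * outer_mass M j f q gamma (A *m n + r) `^ q^-1.
Proof.
move=> hr; set l := A *m n + r; set tau := coset_mass _ _ _ _ _ _ `^ _.
have tau0 : 0 <= tau by exact: powR_ge0.
have cs := csummable_pairing detM CT0 T_out tail outE.
have qi := quasi_projection_integrable detM j f T phi_per phi_int.
rewrite (fourierB l f_int qi).
rewrite (fourier_quasi_projection detM phi_per phi_int cs
  (has_csum_coset detM CT0 T_out tail outE l)).
rewrite /l coset_pairing_eq// -/l; set z := coset_pairing _ _ _ _ r.
have hz := coset_pairing_approx detM CT0 T_out tail outE hr; rewrite -/z -/tau in hz.
have a0 : 0 <= a r by exact: cabs_ge0.
set X := w r `^ s'; have X0 : 0 <= X by exact: powR_ge0.
set D1 := d%:R `^ (s - s') : R; have D10 : 0 <= D1 by exact: powR_ge0.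
have ws : w r `^ s <= D1 * X by exact: Dstar_powR_le.
have ws0 : 0 <= w r `^ s by exact: powR_ge0.
have wds : w r `^ s <= d%:R `^ s.
  apply: ge0_ler_powR; rewrite ?nnegrE ?enorm_ge0//; first by have := s'0; have := s's; lra.
  exact: enorm_unit_cube (Dstar_unit_cube detM hr).
have ct := T_in hr; have bn := b0 n; have CTK : 0 <= CT * K by rewrite mulr_ge0.
have ds0 : 0 <= d%:R `^ s :> R by exact: powR_ge0.
have o0 : 0 <= outer_mass M j f q gamma l `^ q^-1 by exact: powR_ge0.
have [n0|n0] := eqVneq n 0.
  have lr : l = r by rewrite /l n0 mulmx0 add0r.
  rewrite lr -[leLHS]addr0 lerD//; last by rewrite mulr_ge0 ?powR_ge0.
  have -> : fourier f r - fourier phi r * z =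
      fourier f r * (1 - fourier phi r * conjc (dfourier T r)) -
      fourier phi r * (z - fourier f r * conjc (dfourier T r)) by ring.
  rewrite (le_trans (cabsB _ _))// !Normc.normcM -/(a r) n0 /=.
  have h1 : a r * cabs (1 - fourier phi r * conjc (dfourier T r)) <= b 0 * D1 * (X * a r).
    apply: (le_trans (ler_wpM2l a0 (compat hr))).
    apply: (@le_trans _ _ (a r * (b 0 * (D1 * X)))); last by rewrite le_eqVlt; apply/orP; left; apply/eqP; ring.
    by rewrite ler_wpM2l// ler_wpM2l.
  have h2 : cabs (fourier phi r) * cabs (z - fourier f r * conjc (dfourier T r))
      <= Cphi * (CT * K) * tau.
    by rewrite -mulrA ler_pM ?cabs_ge0// phi_bdd.
  apply: (le_trans (lerD h1 h2)); rewrite mulrDr lerD//.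
    rewrite ler_wpM2r ?mulr_ge0//.
    have h3 : D1 <= error_const.
      rewrite /error_const -/D1 -addrA mulrDr mulr1 -addrA lerDl !addr_ge0 ?mulr_ge0//.
    apply: (@le_trans _ _ (b 0 * error_const)); first by rewrite ler_wpM2l.
    by rewrite mulrC ler_wpM2l ?error_const_ge0// lerDl.
  rewrite ler_wpM2r//; apply: (@le_trans _ _ (error_const * 1)).
    by rewrite mulr1 /error_const lerDr addr_ge0 ?mulr_ge0 ?addr_ge0.
  by rewrite ler_wpM2l ?error_const_ge0// lerDr.
rewrite addr0 (le_trans (cabsB _ _))// addrC lerD//.
  rewrite Normc.normcM.
  have hz2 : cabs z <= a r * CT + CT * K * tau.
    have -> : z = fourier f r * conjc (dfourier T r) + (z - fourier f r * conjc (dfourier T r)) by ring.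
    by rewrite (le_trans (cabsD _ _))// lerD// Normc.normcM cabs_conj ler_wpM2l.
  apply: (@le_trans _ _ (b n * w r `^ s * (a r * CT + CT * K * tau))).
    by rewrite ler_pM ?cabs_ge0// phi_sf.
  have -> : b n * w r `^ s * (a r * CT + CT * K * tau) =
    b n * (w r `^ s * a r * CT) + b n * (w r `^ s * (CT * K) * tau) by ring.
  have h1 : w r `^ s * a r * CT <= error_const * (X * a r).
    apply: (@le_trans _ _ (D1 * CT * (X * a r))).
      have -> : D1 * CT * (X * a r) = D1 * X * a r * CT by ring.
      by rewrite ler_wpM2r// ler_wpM2r.
    rewrite ler_wpM2r ?mulr_ge0// /error_const -/D1 mulrDr mulr1 -!addrA.
    by rewrite [leRHS]addrCA lerDl !addr_ge0 ?mulr_ge0.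
  have h2 : w r `^ s * (CT * K) * tau <= error_const * tau.
    rewrite ler_wpM2r//; apply: (@le_trans _ _ (d%:R `^ s * (CT * K))); first by rewrite ler_wpM2r.
    by rewrite /error_const addrAC lerDr !addr_ge0 ?mulr_ge0 ?addr_ge0.
  have -> : error_const * b n * (X * a r + tau) =
    b n * (error_const * (X * a r)) + b n * (error_const * tau) by ring.
  by rewrite lerD// ler_wpM2l.
(* For n <> 0 the coefficient of f itself is part of the error. Since 2 |M^{*-j} l| >= 1, inserting
   the factor (2 |M^{*-j} l|)^gamma bounds it by the outer mass. *)
have wl : 2^-1 <= w l.
  have := enorm_shift_ge d_gt0 (Dstar_unit_cube detM hr) n0.
  by rewrite -(Mstarinv_coset detM).
rewrite (outer_mass_coset detM f q gamma n0 hr) -/l -/(a l).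
move: (a l) (w l) wl (cabs_ge0 (fourier f l) : 0 <= a l) => al W wl al0.
have W0 : 0 <= W by lra.
have q0 : 0 < q by have := q1; lra.
rewrite -powRrM divff ?gt_eqF// powRr1; last by rewrite mulr_ge0 ?powR_ge0.
rewrite mulrA -[leLHS]mul1r ler_wpM2r// -powRM//.
have W1 : 1 <= 2 * W by lra.
by have := ler_powR W1 (ltW gamma0); rewrite powRr0.
Qed.

End CoefficientError.

Section ThetaBounds.
Context {R : realType} {d : nat}.
Implicit Types (x : 'cV[R]_d).

Lemma theta_le (alpha beta : R) x : alpha <= beta -> theta alpha x <= theta beta x.
Proof.
move=> ab; apply: ler_powR; first by rewrite lerDl sqr_ge0.
by rewrite ler_pM2r// invr_gt0.
Qed.

Lemma enorm_powR_le_theta (alpha : R) x : 0 <= alpha -> enorm x `^ alpha <= theta alpha x.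
Proof.
move=> a0; have -> : enorm x `^ alpha = (enorm x ^+ 2) `^ (alpha / 2).
  rewrite -powR_mulrn ?enorm_ge0// -powRrM; congr (_ `^ _).
  by rewrite mulrCA divff ?mulr1// pnatr_eq0.
apply: ge0_ler_powR; first by rewrite divr_ge0.
- by rewrite nnegrE sqr_ge0.
- by rewrite nnegrE addr_ge0 ?sqr_ge0.
by rewrite lerDr.
Qed.

Lemma enorm_mulmx_powR_le (B : 'M[R]_d) (alpha : R) x : 0 <= alpha ->
  enorm (B *m x) `^ alpha <= opnorm B `^ alpha * theta alpha x.
Proof.
move=> a0; apply: (@le_trans _ _ ((opnorm B * enorm x) `^ alpha)).
  apply: ge0_ler_powR; rewrite ?nnegrE ?mulr_ge0 ?enorm_ge0 ?opnorm_ge0//.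
  exact: enorm_mulmx.
rewrite powRM ?opnorm_ge0 ?enorm_ge0// ler_wpM2l ?powR_ge0//.
exact: enorm_powR_le_theta.
Qed.

Lemma lq_norm_finite_set (D : set 'cV[int]_d) (q : R) (u : 'cV[int]_d -> R) :
  finite_set D -> (lq_norm q D u < +oo)%E.
Proof.
move=> fD; rewrite /lq_norm esum_fset//.
by rewrite fsbig_finite// sumEFin poweR_EFin ltry.
Qed.

End ThetaBounds.

(** * From coefficient errors to the L_p error *)

Section ErrorEstimate.
Context (R : realType) (d : nat) (d_gt0 : (0 < d)%N) (M : 'M[int]_d)
  (p : \bar R) (q N s gamma : R) (b : 'cV[int]_d -> R)
  (phi : nat -> 'cV[R]_d -> R[i]) (phit : nat -> periodic_distribution R d).
Hypothesis detM : \det M != 0.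
Hypothesis p_ge2 : (2%:E <= p)%E.
Hypothesis pq : (p^-1 + q%:E^-1 = 1)%E.
Hypothesis phi_Lp : forall j, (0 < j)%N -> Lp_torus p (phi j).
Hypothesis b_ge0 : forall n, 0 <= b n.
Hypothesis b_lq : (lq_norm q setT b < +oo)%E.
Hypothesis phit_growth : growth_condition M N phit.
Hypothesis phi_sf : strang_fix M s b phi.
Hypothesis phi_compat : weak_compatibility M s b phi phit.
Hypothesis phi_bounded : uniformly_bounded M phi.
Hypothesis gamma_gt0 : 0 < gamma.
Hypothesis gamma_big : q != 1 -> (N%:E + d%:R%:E / p < gamma%:E)%E.
Hypothesis gamma_big1 : q = 1 -> N <= gamma.

Let q1 : 1 <= q := conjugate_exponent_ge1 p_ge2 pq.
Let q0 : 0 < q. Proof. by have := q1; lra. Qed.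

Definition inner_part (alpha : R) j (f : 'cV[R]_d -> R[i]) : \bar R :=
  lq_norm q (Dstar R M j)
    (fun l => enorm (Mstarinv R M j *m mxR l) `^ alpha * cabs (fourier f l)).

Definition outer_part j (f : 'cV[R]_d -> R[i]) : \bar R :=
  lq_norm q (~` Dstar R M j)
    (fun l => enorm (Mstarinv R M j *m mxR l) `^ gamma * cabs (fourier f l)).

Lemma inner_part_le (alpha beta : R) j f D : 0 <= alpha -> alpha <= beta ->
  Dstar R M j `<=` D -> (A_norm_on D q beta f < +oo)%E ->
  (inner_part alpha j f <=
    (opnorm (Mstarinv R M j) `^ alpha)%:E * A_norm_on D q beta f)%E.
Proof.
move=> a0 ab DD fin; apply: lq_norm_le => // [|l _]; first exact: powR_ge0.
rewrite !ger0_norm ?mulr_ge0 ?powR_ge0 ?cabs_ge0// mulrA ler_wpM2r ?cabs_ge0//.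
apply: (le_trans (enorm_mulmx_powR_le _ _ a0)).
by rewrite ler_wpM2l ?powR_ge0// theta_le.
Qed.

Lemma outer_part_le j f D : ~` Dstar R M j `<=` D -> (A_norm_on D q gamma f < +oo)%E ->
  (outer_part j f <=
    (opnorm (Mstarinv R M j) `^ gamma)%:E * A_norm_on D q gamma f)%E.
Proof.
move=> DD fin; apply: lq_norm_le => // [|l _]; first exact: powR_ge0.
rewrite !ger0_norm ?mulr_ge0 ?powR_ge0 ?cabs_ge0// mulrA ler_wpM2r ?cabs_ge0//.
exact: enorm_mulmx_powR_le (ltW gamma_gt0).
Qed.

Lemma outer_mass_fin f j : A_space q gamma f -> exists E : R,
  [/\ 0 <= E, (\esum_(l in setT) (outer_mass M j f q gamma l)%:E <= E%:E)%E
    & outer_part j f = (E `^ q^-1)%:E].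
Proof.
move=> [_ fA]; have h : (outer_part j f < +oo)%E.
  apply: le_lt_trans (outer_part_le (@subsetT _ _) fA) _.
  have A0 : (0 <= A_norm q gamma f)%E by exact: poweR_ge0.
  rewrite -[A_norm_on _ _ _ _]/(A_norm q gamma f).
  by rewrite -(@fineK _ (A_norm q gamma f)) ?ge0_fin_numE// -EFinM ltry.
have [E E0 hE] := lq_norm_fin q0 h; exists E; split => //; last first.
  by rewrite /outer_part /lq_norm hE poweR_EFin.
rewrite -hE [leRHS]esum_mkcond le_eqVlt; apply/orP; left; apply/eqP.
apply: eq_esum => l _; rewrite /outer_mass in_setC; case: asboolP => hl.
  by rewrite mem_set.
by rewrite memNset//= ger0_norm// mulr_ge0 ?powR_ge0 ?cabs_ge0.
Qed.

Lemma pairing_summable f j k : A_space q gamma f -> (0 < j)%N ->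
  csummable (pairing_term M j f (phit j) k).
Proof.
move=> fA j0; have [C hC] := phit_growth; have [Ho _] := hC _ j0.
have [K K0 hK] := tail_sum d_gt0 p_ge2 pq gamma_big gamma_big1.
have [E [E0 hE _]] := outer_mass_fin j fA.
apply: (csummable_pairing detM (normr_ge0 C) _ hK hE) => l hl.
apply: (le_trans (Ho _ hl)); rewrite ler_wpM2r ?powR_ge0 ?ler_norm//.
Qed.

(** The exponent s' is left free so that the inner weight can later be lowered to gamma when gamma <
    s. K is chosen before f and j. *)
Lemma quasi_projection_error (s' : R) : 0 < s' -> s' <= s ->
  exists2 K : R, 0 <= K & forall f, A_space q gamma f -> forall j, (0 < j)%N ->
    (Lp_norm p (f \- quasi_projection M j f (phi j) (phit j))%R
     <= K%:E * (inner_part s' j f + outer_part j f))%E.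
Proof.
move=> s'0 s's; have [HY HY0 hHY] := hausdorff_young (d := d) p_ge2 pq.
have [CT hCT] := phit_growth; have [Cp hCp] := phi_bounded.
have [K K0 hK] := tail_sum d_gt0 p_ge2 pq gamma_big gamma_big1.
have [Bb Bb0 hBb] := lq_norm_fin q0 b_lq.
set ec := @error_const R d s s' `|CT| K `|Cp|.
have ec0 : 0 <= ec by exact: error_const_ge0.
pose beta n := ec * (b n + (n == 0)%:R).
(* The 1 beside [Bb] is the contribution of the extra summand at n = 0, and 3^q the price of raising
   a sum to the power q. *)
pose B := ec `^ q * (3 `^ q * (Bb + 1)).
have hB u : uniq u -> \sum_(n <- u) beta n `^ q <= B.
  move=> uu; rewrite (eq_bigr (fun n => ec `^ q * (b n + (n == 0)%:R) `^ q)); last first.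
    by move=> n _; rewrite /beta powRM// addr_ge0.
  rewrite -mulr_sumr ler_wpM2l ?powR_ge0//.
  apply: (@le_trans _ _ (\sum_(n <- u) 3 `^ q * (b n `^ q + (n == 0)%:R))).
    apply: ler_sum => n _; have := powR_add3_le q1 (b_ge0 n) (ler0n _ (n == 0)) (lexx 0).
    rewrite addr0 powR0 ?gt_eqF// addr0 => /le_trans; apply.
    by rewrite ler_wpM2l ?powR_ge0// lerD2l; case: eqP; rewrite ?powR1// powR0// gt_eqF.
  rewrite -mulr_sumr ler_wpM2l ?powR_ge0// big_split /= lerD//.
    rewrite -lee_fin -hBb (eq_bigr (fun n => `|b n| `^ q)).
      exact: sum_le_esum_on.
    by move=> n _; rewrite ger0_norm.
  rewrite (eq_bigr (fun n => if n == 0 then 1 else 0)); last by move=> n _; case: eqP.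
  rewrite -big_mkcond /= -big_filter.
  have [u0|u0] := boolP (0 \in u).
    by rewrite (filter_pred1_uniq uu u0) big_seq1.
  rewrite big_filter big_seq_cond big1// => i /andP[iu /eqP i0].
  by move: iu; rewrite i0 (negbTE u0).
have B0 : 0 <= B by have := hB [::] isT; rewrite big_nil.
pose C := 3 `^ q * (B + (2 `^ gamma) `^ q).
have C0 : 0 <= C by rewrite mulr_ge0 ?addr_ge0 ?powR_ge0.
pose C2 := (2 * C) `^ q^-1; have C20 : 0 <= C2 by exact: powR_ge0.
exists (HY * C2) => [|f fA j j0]; first by rewrite mulr_ge0// ltW.
have [EY [EY0 hEY ->]] := outer_mass_fin j fA.
have inn : (inner_part s' j f < +oo)%E.
  by apply: lq_norm_finite_set; have [] := digits_count (R := R) (det_trexpmx_neq0 detM j).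
have [EX EX0 hEX] := lq_norm_fin q0 inn.
rewrite /inner_part /lq_norm hEX poweR_EFin -EFinD -EFinM.
have p1 : (1 <= p)%E by apply: le_trans p_ge2; rewrite lee_fin ler1n.
have fi : torus_integrable f by case: fA => /(Lp_torus_integrable (lexx _)).
have ppi := Lp_torus_integrable p1 (phi_Lp j0).
have [pper _ _] := phi_Lp j0.
have qi := quasi_projection_integrable detM j f (phit j) pper ppi.
have gi : torus_integrable (f \- quasi_projection M j f (phi j) (phit j)).
  exact: cintegrableB.
set P := EX `^ q^-1; set Q := EY `^ q^-1.
have P0 : 0 <= P by exact: powR_ge0.
have Q0 : 0 <= Q by exact: powR_ge0.
have powK x : 0 <= x -> (x `^ q^-1) `^ q = x.
  by move=> x0; rewrite -powRrM mulVf ?gt_eqF// powRr1.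
(* Hausdorff-Young is stated for a positive bound while P + Q may vanish; the increment e / HY
   becomes e after multiplication by HY. *)
apply/lee_addgt0Pr => e e0; pose Ae := C2 * (P + Q) + e / HY.
have -> : ((HY * C2 * (P + Q))%:E + e%:E = (HY * Ae)%:E)%E.
  by rewrite -EFinD; congr EFin; rewrite /Ae [RHS]mulrDr mulrA mulrCA divff ?gt_eqF// mulr1.
have PQ0 : 0 <= C2 * (P + Q) by rewrite mulr_ge0// addr_ge0.
apply: hHY => //; first by rewrite ltr_wpDl// divr_gt0.
apply: (@le_trans _ _ (3 `^ q * (B * (EX + EY) + (2 `^ gamma) `^ q * EY))%:E).
  apply: (coset_powR_sum (det_trexpmx_neq0 detM j) q1
    (Y := outer_mass M j f q gamma)
    (X := fun r => enorm (Mstarinv R M j *m mxR r) `^ s' * cabs (fourier f r))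
    (e := coset_mass M j f q gamma) (beta := beta)) => //.
  - by move=> l; exact: outer_mass_ge0.
  - by move=> r; rewrite mulr_ge0 ?powR_ge0 ?cabs_ge0.
  - by move=> r; exact: coset_mass_ge0.
  - by move=> n; rewrite mulr_ge0// addr_ge0.
  - by move=> l; exact: cabs_ge0.
  - move=> n r hr; have [Ho Hi] := hCT _ j0.
    apply: (@coefficient_error _ _ _ d_gt0 detM j _ _ _ q N gamma s s' `|CT| K `|Cp| EY) => //.
    + by move=> l hl; apply: (le_trans (Ho _ hl)); rewrite ler_wpM2r ?powR_ge0 ?ler_norm.
    + by move=> l hl; apply: (le_trans (Hi _ hl)); rewrite ler_norm.
    + exact: phi_sf.
    + exact: phi_compat.
    + by move=> l hl; apply: (le_trans (hCp _ j0 _ hl)); rewrite ler_norm.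
  - by move=> r u hr uu; apply: (coset_mass_ge detM hEY).
  - move=> u uu uD; rewrite -lee_fin -hEX.
    rewrite (eq_bigr (fun r => `|enorm (Mstarinv R M j *m mxR r) `^ s' * cabs (fourier f r)| `^ q)).
      exact: sum_le_esum_on.
    by move=> r _; rewrite ger0_norm// mulr_ge0 ?powR_ge0 ?cabs_ge0.
  - by move=> u uu uD; apply: (coset_mass_sum detM hEY).
rewrite lee_fin; apply: (@le_trans _ _ ((C2 * (P + Q)) `^ q)); last first.
  apply: ge0_ler_powR; rewrite ?nnegrE ?(ltW q0)//.
    by rewrite addr_ge0// divr_ge0// ltW.
  by rewrite lerDl divr_ge0// ltW.
rewrite powRM ?addr_ge0// /C2 powK; last exact: mulr_ge0 (ler0n _ 2) C0.
(* Returns from q-th powers to norms: each of EX and EY is at most (P + Q)^q, which explains the 2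
   in [C2]. *)
have PQ : EX + EY <= 2 * (P + Q) `^ q.
  have h1 : EX <= (P + Q) `^ q.
    rewrite -[leLHS](powK _ EX0); apply: ge0_ler_powR; rewrite ?nnegrE ?addr_ge0 ?(ltW q0)//.
    by rewrite lerDl.
  have h2 : EY <= (P + Q) `^ q.
    rewrite -[leLHS](powK _ EY0); apply: ge0_ler_powR; rewrite ?nnegrE ?addr_ge0 ?(ltW q0)//.
    by rewrite lerDr.
  by rewrite mulr_natl mulr2n lerD.
apply: (@le_trans _ _ (C * (EX + EY))); last first.
  by rewrite [2 * C]mulrC -(mulrA C) ler_wpM2l.
rewrite /C -mulrA ler_wpM2l ?powR_ge0// mulrDl lerD2l ler_wpM2l ?powR_ge0//.
by rewrite lerDr.
Qed.

End ErrorEstimate.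

(** * Decay rates and the final inequalities *)

Section DilationRates.
Context {R : realType} {d : nat} (M : 'M[int]_d.+1).
Hypothesis dM : dilation_matrix R M.
Local Open Scope complex_scope.

Lemma dilation_mxC_unit : mxC R M \in unitmx.
Proof.
rewrite unitmxE det_map_mx unitfE intr_eq0; exact: dilation_det_neq0 dM.
Qed.

Lemma opnorm_decay_eigenvalue (vartheta : R) : 0 < vartheta ->
  (forall z : R[i], eigenvalue (mxC R M) z -> vartheta < cabs z) ->
  exists2 C : R, 0 <= C & forall j, opnorm (Mstarinv R M j) <= C * vartheta ^- j.
Proof.
move=> v0 hv; apply: opnorm_decay; first exact: dilation_det_neq0 dM.
exact: decays_one v0 (mulVmx dilation_mxC_unit) hv.
Qed.

Lemma opnorm_decay_isotropic (lambda : R[i]) : isotropic R M ->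
  eigenvalue (mxC R M) lambda ->
  exists2 C : R, 0 <= C & forall j, opnorm (Mstarinv R M j) <= C * cabs lambda ^- j.
Proof.
move=> [l hl [V uV sV]] /eigenvalueP[v vM v0].
have VM : V *m mxC R M = diag_mx l *m V by apply/(simmxP uV).
set u := v *m invmx V.
have uD : u *m diag_mx l = lambda *: u.
  have -> : diag_mx l = V *m mxC R M *m invmx V by rewrite VM mulmxK.
  by rewrite /u !mulmxA mulmxKV// vM -scalemxAl.
have [i ui] : exists i, u 0 i != 0.
  apply/existsP; rewrite -negb_forall; apply: contra v0 => /forallP u0.
  have -> : v = u *m V by rewrite mulmxKV.
  suff -> : u = 0 by rewrite mul0mx.
  by apply/rowP => k; have /eqP -> := u0 k; rewrite mxE.
clearbody u; have li : l 0 i = lambda.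
  have /rowP /(_ i) := uD; rewrite mul_mx_diag !mxE mulrC.
  exact: mulIf.
apply: opnorm_decay; first exact: dilation_det_neq0 dM.
have hl' k : cabs (l 0 k) = cabs lambda by rewrite (hl k i) li.
apply: (decays_diag _ (mulVmx dilation_mxC_unit) uV hl' VM).
apply: (lt_trans ltr01); apply: dM.
by apply/eigenvalueP; exists v.
Qed.

End DilationRates.

Section ErrorRate.
Context (R : realType) (d : nat) (M : 'M[int]_d) (p : \bar R) (q s gamma : R)
  (phi : nat -> 'cV[R]_d -> R[i]) (phit : nat -> periodic_distribution R d).
Hypothesis p_ge2 : (2%:E <= p)%E.
Hypothesis pq : (p^-1 + q%:E^-1 = 1)%E.
Hypothesis s_gt0 : 0 < s.
Hypothesis gamma_gt0 : 0 < gamma.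
Local Notation mu := (Num.min s gamma).

(** The exponent mu is at most gamma, so the inner part is also bounded by the [A_q^gamma] norm. As
    rho >= 1, the outer rate rho^(-j gamma) is at least as good as rho^(-j mu). *)
Lemma error_rate (K C rho : R) : 0 <= K ->
  (forall f, A_space q gamma f -> forall j, (0 < j)%N ->
    (Lp_norm p (f \- quasi_projection M j f (phi j) (phit j))%R
     <= K%:E * (inner_part M q mu j f + outer_part M q gamma j f))%E) ->
  1 <= rho -> 0 <= C -> (forall j, opnorm (Mstarinv R M j) <= C * rho ^- j) ->
  forall f, A_space q gamma f -> forall j, (0 < j)%N ->
    (Lp_norm p (f \- quasi_projection M j f (phi j) (phit j))%R
     <= (K * (C `^ mu + C `^ gamma) * rho `^ (- (j%:R * mu)))%:E
        * A_norm q gamma f)%E.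
Proof.
move=> K0 hK r1 C0 hC f fA j j0; apply: (le_trans (hK f fA j j0)).
have [_ fin] := fA.
have A0 : (0 <= A_norm q gamma f)%E by exact: poweR_ge0.
have mu0 : 0 < mu by rewrite lt_min s_gt0.
have r0 : 0 < rho by lra.
set t := rho `^ (- (j%:R * mu)).
have tE : (rho ^- j) `^ mu = t.
  by rewrite -powR_invn ?(ltW r0)// -powRrM mulNr.
have rj : 0 < rho ^- j <= 1.
  by rewrite invr_gt0 exprn_gt0// invf_le1 ?exprn_gt0// exprn_ege1.
have rj0 : 0 <= rho ^- j by case/andP: rj => /ltW.
have opn alpha : 0 <= alpha ->
    opnorm (Mstarinv R M j) `^ alpha <= C `^ alpha * (rho ^- j) `^ alpha.
  move=> a0; rewrite -powRM//; apply: ge0_ler_powR => //.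
    by rewrite nnegrE opnorm_ge0.
  by rewrite nnegrE mulr_ge0.
rewrite -mulrA EFinM -muleA lee_wpmul2l// mulrDl EFinD ge0_muleDl; last 2 first.
- by rewrite lee_fin mulr_ge0// powR_ge0.
- by rewrite lee_fin mulr_ge0// powR_ge0.
apply: leeD.
  have mg : mu <= gamma by rewrite ge_min lexx orbT.
  apply: (le_trans (inner_part_le p_ge2 pq (ltW mu0) mg (@subsetT _ _) fin)).
  by rewrite lee_wpmul2r// lee_fin -tE opn// ltW.
apply: (le_trans (outer_part_le p_ge2 pq gamma_gt0 (@subsetT _ _) fin)).
rewrite lee_wpmul2r// lee_fin (le_trans (opn _ (ltW gamma_gt0)))//.
rewrite ler_wpM2l ?powR_ge0// -tE ger_powR//.
by rewrite ge_min lexx orbT.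
Qed.

End ErrorRate.

Theorem theorem9 (R : realType) (d : nat) (d_gt0 : (0 < d)%N) (M : 'M[int]_d)
    (p : \bar R) (q N s gamma : R) (b : 'cV[int]_d -> R)
    (phi : nat -> 'cV[R]_d -> R[i]) (phit : nat -> periodic_distribution R d)
    (M_dilation : dilation_matrix R M)
    (p_ge2 : (2%:E <= p)%E) (pq : (p^-1 + q%:E^-1 = 1)%E)
    (N_ge0 : 0 <= N) (s_gt0 : 0 < s)
    (phi_Lp : forall j, (0 < j)%N -> Lp_torus p (phi j))
    (b_ge0 : forall n, 0 <= b n) (b_lq : (lq_norm q setT b < +oo)%E)
    (phit_growth : growth_condition M N phit)
    (phi_sf : strang_fix M s b phi)
    (phi_compat : weak_compatibility M s b phi phit)
    (phi_bounded : uniformly_bounded M phi)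
    (gamma_gt0 : 0 < gamma)
    (gamma_big : q != 1 -> (N%:E + d%:R%:E / p < gamma%:E)%E)
    (gamma_big1 : q = 1 -> N <= gamma) :
  [/\ (* the series defining Q_j(f, phi_j, phit_j) converge *)
      forall f, A_space q gamma f -> forall j, (0 < j)%N -> forall k,
        csummable (pairing_term M j f (phit j) k),
      exists C1 C2 : R, forall f, A_space q gamma f -> forall j, (0 < j)%N ->
        (Lp_norm p (f \- quasi_projection M j f (phi j) (phit j))%R
         <= (C1 * opnorm (Mstarinv R M j) `^ s)%:E * A_norm_in M j q s f
          + (C2 * opnorm (Mstarinv R M j) `^ gamma)%:E
            * A_norm_out M j q gamma f)%E,
      forall vartheta : R, 0 < vartheta ->
        (forall z : R[i], eigenvalue (mxC R M) z -> vartheta < cabs z) ->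
        exists C : R, forall f, A_space q gamma f -> forall j, (0 < j)%N ->
          (Lp_norm p (f \- quasi_projection M j f (phi j) (phit j))%R
           <= (C * vartheta `^ (- (j%:R * Num.min s gamma)))%:E
              * A_norm q gamma f)%E
    & isotropic R M ->
      forall lambda : R[i], eigenvalue (mxC R M) lambda ->
        exists C : R, forall f, A_space q gamma f -> forall j, (0 < j)%N ->
          (Lp_norm p (f \- quasi_projection M j f (phi j) (phit j))%R
           <= (C * cabs lambda `^ (- (j%:R * Num.min s gamma)))%:E
              * A_norm q gamma f)%E ].
Proof.
(* The dimension is put in successor form, in which the results on matrix powers and Cayley-Hamilton
   are stated. *)
case: d d_gt0 M b phi phit M_dilation phi_Lp b_ge0 b_lq phit_growth phi_sf
  phi_compat phi_bounded gamma_big gamma_big1 => // {}d {}d_gt0 {}M {}b {}phi {}phit.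
move=> M_dilation phi_Lp b_ge0 b_lq phit_growth phi_sf phi_compat phi_bounded
  gamma_big gamma_big1.
have detM := dilation_det_neq0 M_dilation.
have error := quasi_projection_error d_gt0 detM p_ge2 pq phi_Lp b_ge0 b_lq
  phit_growth phi_sf phi_compat phi_bounded gamma_gt0 gamma_big gamma_big1.
have mu_gt0 : 0 < Num.min s gamma by rewrite lt_min s_gt0.
have mu_le : Num.min s gamma <= s by rewrite ge_min lexx.
have [K K0 hK] := error _ mu_gt0 mu_le.
have rate := error_rate p_ge2 pq s_gt0 gamma_gt0 K0 hK.
split.
- move=> f fA j j0 k.
  exact: (pairing_summable d_gt0 detM p_ge2 pq phit_growth gamma_gt0 gamma_big gamma_big1).
- have [C C0 hC] := error _ s_gt0 (lexx s).
  exists C, C => f fA j j0; apply: (le_trans (hC f fA j j0)).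
  have fin_in : (A_norm_in M j q s f < +oo)%E.
    apply: lq_norm_finite_set.
    by have [] := digits_count (R := R) (det_trexpmx_neq0 detM j).
  have fin_out : (A_norm_out M j q gamma f < +oo)%E.
    case: fA => _ fA; apply: le_lt_trans (fA); rewrite -[leRHS]mul1e.
    have q_gt0 := lt_le_trans ltr01 (conjugate_exponent_ge1 p_ge2 pq).
    by apply: (lq_norm_le q_gt0 ler01 (@subsetT _ _) _ fA) => l _; rewrite mul1r.
  rewrite !EFinM -!muleA ge0_muleDr ?poweR_ge0// leeD// lee_wpmul2l//.
    exact: (inner_part_le p_ge2 pq (ltW s_gt0) (lexx s) (@subset_refl _ _) fin_in).
  exact: (outer_part_le p_ge2 pq gamma_gt0 (@subset_refl _ _) fin_out).
- move=> vartheta v0 hv.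
  (* vartheta may be below 1, where [error_rate] does not apply. All eigenvalues exceed 1 in
     modulus, so max(1, vartheta) is also admissible, and its rate is at least as good. *)
  have [C C0 hC] : exists2 C : R, 0 <= C & forall j,
      opnorm (Mstarinv R M j) <= C * Num.max 1 vartheta ^- j.
    apply: (opnorm_decay_eigenvalue M_dilation); first by rewrite lt_max ltr01.
    by move=> z hz; rewrite gt_max (M_dilation z hz) hv.
  have r1 : 1 <= Num.max 1 vartheta by rewrite le_max lexx.
  exists (K * (C `^ Num.min s gamma + C `^ gamma)) => f fA j j0.
  apply: (le_trans (rate _ _ r1 C0 hC f fA j j0)).
  apply: lee_wpmul2r; first exact: poweR_ge0.
  rewrite lee_fin; apply: ler_wpM2l; first by rewrite mulr_ge0 ?addr_ge0 ?powR_ge0.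
  rewrite !powRN lef_pV2 ?posrE ?powR_gt0// ?lt_max ?ltr01//.
  apply: ge0_ler_powR; rewrite ?nnegrE ?(ltW v0) ?mulr_ge0 ?(ltW mu_gt0)//.
    exact: le_trans ler01 r1.
  by rewrite le_max lexx orbT.
- move=> iso lambda hl.
  have [C C0 hC] := opnorm_decay_isotropic M_dilation iso hl.
  exists (K * (C `^ Num.min s gamma + C `^ gamma)) => f fA j j0.
  exact: (rate _ _ (ltW (M_dilation _ hl)) C0 hC f fA j j0).
Qed.
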